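(* Fix $c>0$ and $\alpha>0$, and for $n\in\mathbb{N}$ let $$f_{n,\alpha}(z) := \frac{(z-1+c)^n}{(z+1+c)^{n+\alpha}},\qquad \operatorname{Re} z\ge 0.$$ Let $M_1>0$ and $n_1\in\mathbb{N}$ be constants such that $$|f_{n,\alpha}(i\sqrt{n})|\ge \frac{M_1}{n^{\alpha/2}}\quad\text{for all } n\ge n_1;$$ such constants exist, and they involve only $c$ and $\alpha$. Let $B$ be a self-adjoint operator on a Hilbert space $H$ such that, for some $n_2\in\mathbb{N}$, $$\sigma(B)\supset\{\sqrt{n}: n\in\mathbb{N}\text{ and } n\ge n_2\},$$ and define $A := iB+cI$. Then $-A$ is the generator of an exponentially stable $C_0$-semigroup on $H$, and with $V(A) := (A-I)(A+I)^{-1}$ one has $$\|V(A)^n(A+I)^{-\alpha}\| = \|f_{n,\alpha}(iB)\| = \sup_{\lambda\in\sigma(iB)}|f_{n,\alpha}(\lambda)|$$ for all $n\in\mathbb{N}$, and $$\|V(A)^nA^{-\alpha}\|\ge\frac{M_2}{n^{\alpha/2}}\quad\text{for all } n\ge\max\{n_1,n_2\},\qquad\text{where } M_2 := \frac{M_1}{\|(I+A^{-1})^{-\alpha}\|}.$$ Consequently, for $\alpha>0$, the following estimate cannot be improved in general: for every generator $-A$ of an exponentially stable $C_0$-semigroup on a Hilbert space and all $0<\omega_p\le\omega_q<\infty$, there exist $M>0$ and $n_0\in\mathbb{N}$ such that $\left\|\left(\prod_{k=1}^n V_{\omega_k}(A)\right)A^{-\alpha}\right\|\le M n^{-\alpha/2}$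 for all $n\ge n_0$ and all sequences $(\omega_k)_{k\in\mathbb{N}}$ in $[\omega_p,\omega_q]$.
   Context: $\sigma(\cdot)$ denotes the spectrum. A $C_0$-semigroup $(e^{-tA})_{t\ge0}$ with generator $-A$ is exponentially stable if $\lim_{t\to\infty}\|e^{\varepsilon t}e^{-tA}\|=0$ for some $\varepsilon>0$; in that case $A$ has a bounded inverse, and $A^{-\alpha}$ denotes the (bounded) fractional power. For $\omega>0$, $V_\omega(A):=(A-\omega I)(A+\omega I)^{-1}$ is the Cayley transform of $A$ with parameter $\omega$, and $V(A)=V_1(A)$. The operator $f_{n,\alpha}(iB)$ is $(iB-I+cI)^n(iB+I+cI)^{-(n+\alpha)}$. *)

(* Defs.v *)
(* Vanilla Stdlib reals with Coquelicot.  Conventions: the natural numbers of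
   the text are 1, 2, 3, ...; inner products are linear in the first argument;
   norms and suprema are extended reals ([Rbar]). *)
From Stdlib Require Import Reals Lra.
From Coquelicot Require Import Coquelicot.
Open Scope R_scope.

Record Hilbert := mkHilbert {
  carrier :> CompleteNormedModule C_AbsRing;
  inner : carrier -> carrier -> C;
  inner_plus_l : forall x y z, inner (plus x y) z = Cplus (inner x z) (inner y z);
  inner_scal_l : forall (a : C) x y, inner (scal a x) y = Cmult a (inner x y);
  inner_conj : forall x y, inner y x = Cconj (inner x y);
  inner_norm : forall x, inner x x = RtoC (norm x ^ 2)
}.
Arguments inner {h} _ _.

(* The same space over the reals, with unchanged topology and norm:
   Coquelicot's vector-valued integrals require real scalars. *)
Section Real_space.
Variable H : Hilbert.

Definition rscal (r : R) (x : H) : H := scal (RtoC r : C_AbsRing) x.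

Lemma rscal_assoc (r s : R) (x : H) : rscal r (rscal s x) = rscal (mult r s) x.
Proof.
unfold rscal; rewrite scal_assoc.
apply (f_equal (fun a : C_AbsRing => scal a x)); symmetry; exact (RtoC_mult r s).
Qed.

Lemma rscal_one (x : H) : rscal one x = x.
Proof. exact (scal_one (x : carrier H)). Qed.

Lemma rscal_distr_l (r : R) (x y : H) :
  rscal r (plus x y) = plus (rscal r x) (rscal r y).
Proof. exact (scal_distr_l (RtoC r : C_AbsRing) x y). Qed.

Lemma rscal_distr_r (r s : R) (x : H) :
  rscal (plus r s) x = plus (rscal r x) (rscal s x).
Proof.
etransitivity; [| exact (scal_distr_r (RtoC r : C_AbsRing) (RtoC s) x)].
apply (f_equal (fun a : C_AbsRing => scal a x)); exact (RtoC_plus r s).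
Qed.

Definition real_ModuleSpace_mixin :=
  ModuleSpace.Mixin R_Ring (NormedModule.AbelianGroup _ (carrier H))
    rscal rscal_assoc rscal_one rscal_distr_l rscal_distr_r.

Definition real_NormedModuleAux : NormedModuleAux R_AbsRing :=
  NormedModuleAux.Pack R_AbsRing H
    (NormedModuleAux.Class R_AbsRing H
      (ModuleSpace.Class R_Ring H _ real_ModuleSpace_mixin)
      (UniformSpace.class (NormedModule.UniformSpace _ (carrier H)))) H.

Lemma norm_rscal (r : R) (x : H) : norm (rscal r x) <= Rabs r * norm x.
Proof.
rewrite <- Cmod_R; exact (norm_scal (RtoC r : C_AbsRing) x).
Qed.

Definition real_NormedModule_mixin :=
  NormedModule.Mixin R_AbsRing real_NormedModuleAux
    (norm : H -> R) (@norm_factor _ (carrier H))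
    norm_triangle norm_rscal norm_compat1 norm_compat2 norm_eq_zero.

Definition real_space : NormedModule R_AbsRing :=
  NormedModule.Pack R_AbsRing H
    (NormedModule.Class R_AbsRing H _ real_NormedModule_mixin) H.
End Real_space.

(* A possibly unbounded operator is represented by its graph:
   [T x y] means that x is in the domain of T and T x = y. *)
Definition op (H : Hilbert) := H -> H -> Prop.

Section Operators.
Context {H : Hilbert}.
Implicit Types (S T : op H).

Definition op_eq S T : Prop := forall x y, S x y <-> T x y.
Definition dom T (x : H) : Prop := exists y, T x y.

Definition linear_op T : Prop :=
  (forall x y z, T x y -> T x z -> y = z) /\
  T zero zero /\
  (forall x y u v, T x u -> T y v -> T (plus x y) (plus u v)) /\
  (forall (a : C) x u, T x u -> T (scal (a : C_AbsRing) x) (scal (a : C_AbsRing) u)).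

Definition graph (f : H -> H) : op H := fun x y => y = f x.
Definition op_id : op H := graph (fun x => x).
Definition op_scal (a : C) T : op H :=
  fun x y => exists u, T x u /\ y = scal (a : C_AbsRing) u.
Definition op_opp T : op H := op_scal (RtoC (-1)) T.
Definition op_add S T : op H :=
  fun x y => exists u v, S x u /\ T x v /\ y = plus u v.
Definition op_sub S T : op H := op_add S (op_opp T).
Definition op_comp S T : op H := fun x z => exists y, T x y /\ S y z.
Definition op_inv T : op H := fun x y => T y x.
Fixpoint op_pow T (n : nat) : op H :=
  match n with O => op_id | Datatypes.S m => op_comp T (op_pow T m) end.

(* everywhere defined and bounded *)
Definition bounded_op T : Prop :=
  exists f : H -> H, is_linear f /\ op_eq T (graph f).

Definition opnorm T : Rbar :=
  Lub_Rbar (fun r => exists x y, T x y /\ norm x <= 1 /\ r = norm y).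

Definition adjoint T : op H :=
  fun y z => forall x w, T x w -> inner w y = inner x z.
Definition densely_defined T : Prop :=
  forall (x : H) (eps : posreal), exists y, dom T y /\ norm (minus x y) < eps.
Definition self_adjoint T : Prop :=
  linear_op T /\ densely_defined T /\ op_eq (adjoint T) T.

Definition spectrum T (l : C) : Prop :=
  ~ bounded_op (op_inv (op_sub (op_scal l op_id) T)).

(* Semigroups are families indexed by R, used for nonnegative times only. *)
Record C0_semigroup (U : R -> H -> H) : Prop := {
  C0_linear : forall t, 0 <= t -> is_linear (U t);
  C0_zero : forall x, U 0 x = x;
  C0_plus : forall s t x, 0 <= s -> 0 <= t -> U (s + t) x = U s (U t x);
  C0_cont : forall x, filterlim (fun t => U t x) (at_right 0) (locally x)
}.

Definition generator (U : R -> H -> H) : op H := fun x y =>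
  filterlim (fun t => scal (RtoC (/ t) : C_AbsRing) (minus (U t x) x))
    (at_right 0) (locally y).

Definition exp_stable (U : R -> H -> H) : Prop :=
  exists eps, 0 < eps /\
    is_lim (fun t => real (opnorm (op_scal (RtoC (exp (eps * t))) (graph (U t)))))
      p_infty 0.

Definition generates_exp_stable T : Prop :=
  exists U, C0_semigroup U /\ op_eq (generator U) T /\ exp_stable U.

Definition Gamma (b : R) : R :=
  RInt_gen (fun t => Rpower t (b - 1) * exp (- t)) (at_right 0) (Rbar_locally p_infty).

(* [neg_pow b T] is T^(-b), b > 0, for -T the generator of an exponentially
   stable C0-semigroup U:
     Gamma(b) T^(-b) x = integral over (0,oo) of t^(b-1) U(t) x dt,
   a norm-convergent improper integral in H. *)
Definition neg_pow (b : R) T : op H := fun x y =>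
  exists U, C0_semigroup U /\ op_eq (generator U) (op_opp T) /\ exp_stable U /\
    @is_RInt_gen (real_space H) (fun t => rscal H (Rpower t (b - 1)) (U t x))
      (at_right 0) (Rbar_locally p_infty) (rscal H (Gamma b) y).

Definition cayley (w : R) T : op H :=
  op_comp (op_sub T (op_scal (RtoC w) op_id))
          (op_inv (op_add T (op_scal (RtoC w) op_id))).

Fixpoint cayley_prod (w : nat -> R) T (n : nat) : op H :=
  match n with
  | O => op_id
  | Datatypes.S m => op_comp (cayley_prod w T m) (cayley (w (Datatypes.S m)) T)
  end.

(* The estimate
     || (prod_(1 <= k <= n) V_(w_k)(T)) T^(-alpha) || <= M * r n,  n >= n0,
   with M and n0 uniform over all sequences w in [wp, wq]. *)
Definition cayley_estimate T (alpha wp wq : R) (r : nat -> R) : Prop :=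
  exists (M : R) (n0 : nat), 0 < M /\
    forall n, (n0 <= n)%nat ->
    forall w : nat -> R, (forall k, (1 <= k)%nat -> wp <= w k <= wq) ->
      Rbar_le (opnorm (op_comp (cayley_prod w T n) (neg_pow alpha T))) (M * r n).

End Operators.

(* principal argument and principal branch of z^b, for z <> 0 *)
Definition Carg (z : C) : R :=
  if Rle_dec 0 (Im z) then acos (Re z / Cmod z) else - acos (Re z / Cmod z).
Definition Crpow (z : C) (b : R) : C :=
  Cmult (RtoC (Rpower (Cmod z) b)) (cos (b * Carg z), sin (b * Carg z)).

Definition f_na (c alpha : R) (n : nat) (z : C) : C :=
  ((z - 1 + c) ^ n / Crpow (z + 1 + c) (INR n + alpha))%C.

(* f_(n,alpha)(iB) = (iB - I + cI)^n (iB + I + cI)^(-(n+alpha)) *)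
Definition f_op {H : Hilbert} (c alpha : R) (n : nat) (B : op H) : op H :=
  let iB := op_scal Ci B in
  let cI := op_scal (RtoC c) op_id in
  op_comp (op_pow (op_add (op_sub iB op_id) cI) n)
          (neg_pow (INR n + alpha) (op_add (op_add iB op_id) cI)).

(* Main.v *)
Require Import Defs.
From Stdlib Require Import Reals Lra Lia ZArith Classical ClassicalEpsilon.
From Stdlib Require Import FunctionalExtensionality PropExtensionality ProofIrrelevance.
From Coquelicot Require Import Coquelicot.
Open Scope R_scope.

(* The operator iB is m-accretive, so -(iB + s) generates a semigroup with
   ||U(t)|| <= e^(-st), obtained as the limit of the powers
   (1 + 2^-k T)^(-floor(2^k t)).  On an approximate eigenvector of B for lambda
   the semigroup acts like e^(-(s + i lambda) t), up to an error controlled by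
   the residual; integrating against t^(b-1) shows that (iB + s)^(-b) acts
   there like a scalar of modulus |s + i lambda|^(-b).  Hence |f(i lambda)| is
   a lower bound of ||f(iB)|| for lambda in the spectrum of B, and the same
   remark applied to V(A)^n A^(-alpha) and to (I + A^(-1))^(-alpha) gives the
   estimate with M2 without any product rule for fractional powers.

   For the converse, put F = f(iB).  Then X = F^* F is a bounded self-adjoint
   operator with approximate eigenvalue m^2, m = ||F||, and X commutes with the
   resolvent R of iB.  A commuting pair of bounded self-adjoint operators has
   joint approximate eigenvectors, so there are unit vectors x with
   X x ~ m^2 x and R x ~ rho x.  If rho <> 0 these give an approximate
   eigenvector of B at some real lambda, where |f(i lambda)| = m; and rho = 0
   is impossible because fractional powers are small where the resolvent is.

   Optimality is witnessed by B = diag(sqrt k) on square-summable sequences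
   with all Cayley parameters equal to 1; there the norm is a supremum of explicit
   scalars, which bounds it from above by a multiple of n^(-alpha/2). *)

Declare Scope hil_scope.
Local Notation "x +h y" := (@plus (CompleteNormedModule.AbelianMonoid C_AbsRing (carrier _)) x y)
  (at level 50, left associativity) : hil_scope.
Local Notation "x -h y" := (@minus (CompleteNormedModule.AbelianGroup C_AbsRing (carrier _)) x y)
  (at level 50, left associativity) : hil_scope.
Local Notation "~h x" := (@opp (CompleteNormedModule.AbelianGroup C_AbsRing (carrier _)) x)
  (at level 35, right associativity) : hil_scope.
Local Notation "a *h x" := (@scal C_Ring (CompleteNormedModule.ModuleSpace C_AbsRing (carrier _)) a x)
  (at level 40, left associativity) : hil_scope.
Local Notation "0h" := (@zero (CompleteNormedModule.AbelianMonoid C_AbsRing (carrier _))) : hil_scope.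
Local Open Scope hil_scope.

(** A vector that nearly attains the norm of [F] says nothing about [B] by itself, because [F] is in
    general not self-adjoint and [B] is unbounded. Passing to [X] turns such vectors into
    approximate eigenvectors, and splitting the resolvent into two commuting self-adjoint parts lets
    a numerical range be maximized twice, each time among the vectors already selected. The constant
    M2 is a comparison of three moduli at [lambda]: |c + i lambda|^(-alpha) is |c + 1 + i
    lambda|^(-alpha) divided by |1 + 1/(c + i lambda)|^(-alpha), and this divisor is at most the
    norm of (I + A^(-1))^(-alpha). [neg_pow] admits every semigroup with the right generator, so
    existence and uniqueness of semigroups are both needed before a fractional power is a function.
    Its value at a complex point enters through the modulus alone, computed by differentiating the
    Gamma integral in the frequency; hence no branch has to be matched with [Crpow]. *)

Definition rip {H : Hilbert} (x y : H) : R := Re (inner x y).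

(** * Complex Hilbert spaces *)

Lemma minus_plus_cancel (G : AbelianGroup) (x y : G) : plus (minus x y) y = x.
Proof. unfold minus; rewrite <- plus_assoc, plus_opp_l; apply plus_zero_r. Qed.

Section InnerProduct.
Context {H : Hilbert}.
Implicit Types x y z : H.

Lemma inner_plus_r x y z : inner x (y +h z) = Cplus (inner x y) (inner x z).
Proof.
rewrite inner_conj, inner_plus_l, (inner_conj _ y x), (inner_conj _ z x).
unfold Cconj, Cplus; simpl; f_equal; ring.
Qed.

Lemma inner_scal_r (a : C) x y : inner x (a *h y) = Cmult (Cconj a) (inner x y).
Proof.
rewrite inner_conj, inner_scal_l, (inner_conj _ y x).
unfold Cconj, Cmult; simpl; f_equal; ring.
Qed.

Lemma opp_scal x : ~h x = (RtoC (-1)) *h x.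
Proof.
symmetry; replace (RtoC (-1) : C_AbsRing) with (opp (one : C_AbsRing)).
- exact (scal_opp_one (x : carrier H)).
- unfold opp, one; simpl; unfold Copp, RtoC; simpl; f_equal; ring.
Qed.

Lemma inner_opp_l x y : inner (~h x) y = Copp (inner x y).
Proof.
rewrite opp_scal, inner_scal_l; unfold Copp, Cmult; simpl; f_equal; ring.
Qed.

Lemma inner_opp_r x y : inner x (~h y) = Copp (inner x y).
Proof.
rewrite opp_scal, inner_scal_r; unfold Copp, Cmult, Cconj; simpl; f_equal; ring.
Qed.

Lemma inner_minus_l x y z : inner (x -h y) z = Cminus (inner x z) (inner y z).
Proof. unfold minus; rewrite inner_plus_l, inner_opp_l; reflexivity. Qed.

Lemma inner_minus_r x y z : inner z (x -h y) = Cminus (inner z x) (inner z y).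
Proof. unfold minus; rewrite inner_plus_r, inner_opp_r; reflexivity. Qed.

Lemma inner_zero_l x : @inner H 0h x = RtoC 0.
Proof.
replace (0h : H) with (RtoC 0 *h (0h : H)) by exact (@scal_zero_r C_AbsRing (carrier H) (RtoC 0)).
rewrite inner_scal_l; apply Cmult_0_l.
Qed.

Lemma inner_zero_r x : @inner H x 0h = RtoC 0.
Proof.
rewrite inner_conj, inner_zero_l; unfold Cconj, RtoC; simpl; f_equal; ring.
Qed.

Lemma norm_sq_rip x : norm x ^ 2 = rip x x.
Proof. unfold rip; rewrite inner_norm; reflexivity. Qed.

Lemma norm_nonneg x : 0 <= norm x.
Proof. apply norm_ge_0. Qed.

Lemma h_norm_eq_zero x : norm x = 0 -> x = 0h.
Proof. exact (@norm_eq_zero C_AbsRing (carrier H) x). Qed.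

Lemma h_triangle x y : norm (x +h y) <= norm x + norm y.
Proof. exact (@norm_triangle C_AbsRing (carrier H) x y). Qed.

Lemma h_add_0_l x : 0h +h x = x.
Proof. exact (@plus_zero_l (carrier H) x). Qed.

Lemma h_sub_add x y : (x -h y) +h y = x.
Proof. exact (minus_plus_cancel (carrier H) x y). Qed.

Lemma vec_ext x y : (forall z, inner x z = inner y z) -> x = y.
Proof.
intros E.
assert (Z : x -h y = 0h).
{ apply h_norm_eq_zero.
  assert (K : norm (x -h y) ^ 2 = 0).
  { rewrite norm_sq_rip; unfold rip; rewrite inner_minus_l, E.
    unfold Cminus, Cplus, Copp; simpl; ring. }
  pose proof (norm_nonneg (x -h y)); nra. }
rewrite <- (h_sub_add x y), Z; apply h_add_0_l.
Qed.
End InnerProduct.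

(* The casts make the rewriting insensitive to the canonical-structure path
   through which each operation was elaborated. *)
Ltac inner_expand :=
  repeat match goal with
  | |- context [@inner ?H (@plus ?G ?x ?y) ?z] =>
      rewrite (@inner_plus_l H x y z : @inner H (@plus G x y) z = _)
  | |- context [@inner ?H ?z (@plus ?G ?x ?y)] =>
      rewrite (@inner_plus_r H z x y : @inner H z (@plus G x y) = _)
  | |- context [@inner ?H (@minus ?G ?x ?y) ?z] =>
      rewrite (@inner_minus_l H x y z : @inner H (@minus G x y) z = _)
  | |- context [@inner ?H ?z (@minus ?G ?x ?y)] =>
      rewrite (@inner_minus_r H x y z : @inner H z (@minus G x y) = _)
  | |- context [@inner ?H (@scal ?K ?G ?a ?x) ?z] =>
      rewrite (@inner_scal_l H a x z : @inner H (@scal K G a x) z = _)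
  | |- context [@inner ?H ?z (@scal ?K ?G ?a ?x)] =>
      rewrite (@inner_scal_r H a z x : @inner H z (@scal K G a x) = _)
  | |- context [@inner ?H (@opp ?G ?x) ?z] =>
      rewrite (@inner_opp_l H x z : @inner H (@opp G x) z = _)
  | |- context [@inner ?H ?z (@opp ?G ?x)] =>
      rewrite (@inner_opp_r H z x : @inner H z (@opp G x) = _)
  | |- context [@inner ?H (@zero ?G) ?z] =>
      rewrite (@inner_zero_l H z : @inner H (@zero G) z = _)
  | |- context [@inner ?H ?z (@zero ?G)] =>
      rewrite (@inner_zero_r H z : @inner H z (@zero G) = _)
  end.

(* Vector identities are decided by testing against all vectors, which turns
   them into identities between complex (then real) numbers. *)
Ltac cpair :=
  repeat match goal with |- context [@inner ?H ?x ?y] =>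
     let u := fresh "u" in let v := fresh "v" in destruct (@inner H x y) as [u v] end;
  unfold Cminus, Cdiv, Cinv, Cplus, Cmult, Copp, Cconj, RtoC, Ci; simpl.
Ltac vec_z := apply vec_ext; let z := fresh "z" in intros z; inner_expand.
Ltac vec := vec_z; cpair; f_equal; try ring; try field.

Section InnerProduct2.
Context {H : Hilbert}.
Implicit Types x y z : H.

Lemma rip_sym x y : rip x y = rip y x.
Proof. unfold rip; rewrite (inner_conj _ x y); reflexivity. Qed.
Lemma rip_plus_l x y z : rip (x +h y) z = rip x z + rip y z.
Proof. unfold rip; rewrite inner_plus_l; reflexivity. Qed.
Lemma rip_minus_l x y z : rip (x -h y) z = rip x z - rip y z.
Proof. unfold rip; rewrite inner_minus_l; reflexivity. Qed.
Lemma rip_scal_l (r : R) x z : rip (RtoC r *h x) z = r * rip x z.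
Proof. unfold rip; rewrite inner_scal_l; unfold Re, Im; simpl; ring. Qed.
Lemma rip_opp_l x z : rip (~h x) z = - rip x z.
Proof. unfold rip; rewrite inner_opp_l; unfold Re, Im; simpl; ring. Qed.
Lemma rip_zero_l z : rip (0h : H) z = 0.
Proof. unfold rip; rewrite inner_zero_l; reflexivity. Qed.
Lemma rip_plus_r x y z : rip z (x +h y) = rip z x + rip z y.
Proof. rewrite rip_sym, rip_plus_l, !(rip_sym z); ring. Qed.
Lemma rip_minus_r x y z : rip z (x -h y) = rip z x - rip z y.
Proof. rewrite rip_sym, rip_minus_l, !(rip_sym z); ring. Qed.
Lemma rip_scal_r (r : R) x z : rip z (RtoC r *h x) = r * rip z x.
Proof. rewrite rip_sym, rip_scal_l, !(rip_sym z); ring. Qed.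
Lemma rip_opp_r x z : rip z (~h x) = - rip z x.
Proof. rewrite rip_sym, rip_opp_l, (rip_sym z); ring. Qed.
Lemma rip_zero_r z : rip z 0h = 0.
Proof. rewrite rip_sym, rip_zero_l; ring. Qed.

Lemma im_inner_rip x y : Im (inner x y) = - rip (Ci *h x) y.
Proof. unfold rip; rewrite inner_scal_l; unfold Re, Im; simpl; ring. Qed.

(** The real part of the inner product determines the rest: replacing [z] by [-i z] moves the
    imaginary part into the real one. Vector identities below are therefore tested with real numbers
    only. *)
Lemma rip_ext x y : (forall z, rip x z = rip y z) -> x = y.
Proof.
intros E; apply vec_ext; intros z.
pose proof (E z) as E1; pose proof (E (RtoC (-1) *h (Ci *h z))) as E2.
unfold rip in *; revert E1 E2; inner_expand.
destruct (inner x z), (inner y z); simpl; intros; f_equal; lra.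
Qed.

(** A normed module postulates only an inequality for scalar multiples; the inner product upgrades
    it to an equality. *)
Lemma norm_sq_scal (a : C) x : norm (a *h x) ^ 2 = (Cmod a * norm x) ^ 2.
Proof.
rewrite norm_sq_rip; unfold rip; inner_expand.
rewrite inner_norm; unfold Cmod.
replace ((sqrt (fst a ^ 2 + snd a ^ 2) * norm x) ^ 2)
  with ((sqrt (fst a ^ 2 + snd a ^ 2)) ^ 2 * norm x ^ 2) by ring.
rewrite pow2_sqrt by nra; unfold Re, RtoC; simpl; ring.
Qed.

Lemma norm_scal_eq (a : C) x : norm (a *h x) = Cmod a * norm x.
Proof.
pose proof (norm_sq_scal a x) as E; rewrite <- !Rsqr_pow2 in E.
apply Rsqr_inj in E; auto using norm_nonneg.
apply Rmult_le_pos; [apply Cmod_ge_0 | apply norm_nonneg].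
Qed.

Lemma norm_scal_R_eq (r : R) x : norm (RtoC r *h x) = Rabs r * norm x.
Proof. rewrite norm_scal_eq, Cmod_R; reflexivity. Qed.

Lemma norm_opp_eq x : norm (~h x) = norm x.
Proof. exact (@norm_opp C_AbsRing (carrier H) x). Qed.

Lemma norm_minus_sym x y : norm (x -h y) = norm (y -h x).
Proof. rewrite <- norm_opp_eq; apply f_equal. vec. Qed.

Lemma norm_zero_eq : norm (0h : H) = 0.
Proof. exact (@norm_zero C_AbsRing (carrier H)). Qed.

Lemma norm_minus_le x y : norm (x -h y) <= norm x + norm y.
Proof. unfold minus; rewrite <- (norm_opp_eq y); apply h_triangle. Qed.

Lemma norm_tri x y z : norm (x -h z) <= norm (x -h y) + norm (y -h z).
Proof.
replace (x -h z) with ((x -h y) +h (y -h z)) by vec; apply h_triangle.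
Qed.

Lemma norm_le_minus x y : norm x <= norm y + norm (x -h y).
Proof.
replace x with (y +h (x -h y)) at 1 by vec; apply h_triangle.
Qed.

Lemma minus_zero_eq x y : norm (x -h y) <= 0 -> x = y.
Proof.
intros L; pose proof (norm_nonneg (x -h y)).
assert (Z : x -h y = 0h) by (apply h_norm_eq_zero; lra).
rewrite <- (h_sub_add x y), Z; apply h_add_0_l.
Qed.

Lemma sq_le_le (a b : R) : 0 <= b -> a ^ 2 <= b ^ 2 -> a <= b.
Proof. intros; nra. Qed.

Lemma norm_sq_plus x y : norm (x +h y) ^ 2 = norm x ^ 2 + 2 * rip x y + norm y ^ 2.
Proof. rewrite !norm_sq_rip, rip_plus_l, !rip_plus_r, (rip_sym y x); ring. Qed.

Lemma norm_sq_minus x y : norm (x -h y) ^ 2 = norm x ^ 2 - 2 * rip x y + norm y ^ 2.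
Proof. rewrite !norm_sq_rip, rip_minus_l, !rip_minus_r, (rip_sym y x); ring. Qed.

(** Expanding the square of the norm of [norm y * x - norm x * y] gives twice [norm x * norm y]
    times the difference of the two sides, so only the cases of a zero vector have to be
    separated. *)
Lemma rip_le x y : rip x y <= norm x * norm y.
Proof.
destruct (Req_dec (norm y) 0) as [Z | Z].
{ rewrite (h_norm_eq_zero y Z), rip_zero_r, norm_zero_eq; lra. }
pose proof (norm_nonneg x); pose proof (norm_nonneg y).
pose proof (norm_sq_minus (RtoC (norm y) *h x) (RtoC (norm x) *h y)) as E.
rewrite !norm_scal_R_eq, rip_scal_l, rip_scal_r, !Rabs_pos_eq in E by auto.
pose proof (pow2_ge_0 (norm (RtoC (norm y) *h x -h RtoC (norm x) *h y))).
destruct (Req_dec (norm x) 0) as [Zx | Zx].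
{ rewrite (h_norm_eq_zero x Zx), rip_zero_l, norm_zero_eq; lra. }
assert (0 < norm x * norm y) by nra.
nra.
Qed.

Lemma rip_abs_le x y : Rabs (rip x y) <= norm x * norm y.
Proof.
apply Rabs_le; split; [| apply rip_le].
pose proof (rip_le (~h x) y) as E; rewrite rip_opp_l, norm_opp_eq in E; lra.
Qed.

(** Dual description of the norm, tested at [y = x]. Through it, bounds on vector-valued integrals
    are reduced to bounds on real integrals. *)
Lemma norm_le_of_rip x (K : R) : 0 <= K -> (forall y, rip x y <= K * norm y) -> norm x <= K.
Proof.
intros HK E; specialize (E x); rewrite <- norm_sq_rip in E.
pose proof (norm_nonneg x); destruct (Req_dec (norm x) 0); nra.
Qed.

Lemma parallelogram x y : norm (x +h y) ^ 2 + norm (x -h y) ^ 2 = 2 * norm x ^ 2 + 2 * norm y ^ 2.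
Proof. rewrite norm_sq_plus, norm_sq_minus; ring. Qed.
End InnerProduct2.

(** * Sequential limits in norm *)

Section Limits.
Context {H : Hilbert}.
Implicit Types x y z : H.

Definition vlim (u : nat -> H) (l : H) : Prop :=
  forall eps, 0 < eps -> exists K, forall k, (K <= k)%nat -> norm (u k -h l) <= eps.

Lemma cauchy_vlim (u : nat -> H) :
  (forall eps, 0 < eps -> exists K, forall k m, (K <= k)%nat -> (K <= m)%nat -> norm (u k -h u m) <= eps) ->
  exists l, vlim u l.
Proof.
intros Hc.
destruct (proj1 (@filterlim_locally_cauchy nat (CompleteNormedModule.CompleteSpace _ (carrier H)) eventually _ u)) as [l Hl].
{ intros [eps Heps]; simpl.
  destruct (Hc (eps / 2)) as [K HK]; [lra |].
  exists (fun k => (K <= k)%nat); split; [exists K; auto |].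
  intros k m Hk Hm; apply (@norm_compat1 C_AbsRing (carrier H)).
  eapply Rle_lt_trans; [apply HK; auto | lra]. }
exists l; intros eps Heps.
apply (proj1 (@filterlim_locally_ball_norm C_AbsRing nat (carrier H) eventually _ u l)) with (eps := mkposreal eps Heps) in Hl.
destruct Hl as [K HK]; exists K; intros k Hk.
apply Rlt_le, (HK k Hk).
Qed.

Lemma vlim_unique (u : nat -> H) l l' : vlim u l -> vlim u l' -> l = l'.
Proof.
intros L1 L2; apply minus_zero_eq, le_epsilon; intros eps Heps.
destruct (L1 (eps / 2)) as [K1 HK1]; [lra |].
destruct (L2 (eps / 2)) as [K2 HK2]; [lra |].
specialize (HK1 (K1 + K2)%nat ltac:(lia)); specialize (HK2 (K1 + K2)%nat ltac:(lia)).
rewrite norm_minus_sym in HK1.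
pose proof (norm_tri l (u (K1 + K2)%nat) l'); lra.
Qed.

Lemma vlim_const x : vlim (fun _ => x) x.
Proof. intros eps He; exists 0%nat; intros; replace (x -h x) with (0h : H) by vec; rewrite norm_zero_eq; lra. Qed.

Lemma vlim_plus u v l m : vlim u l -> vlim v m -> vlim (fun k => u k +h v k) (l +h m).
Proof.
intros L1 L2 eps Heps.
destruct (L1 (eps / 2)) as [K1 HK1]; [lra |].
destruct (L2 (eps / 2)) as [K2 HK2]; [lra |].
exists (K1 + K2)%nat; intros k Hk.
specialize (HK1 k ltac:(lia)); specialize (HK2 k ltac:(lia)).
replace (u k +h v k -h (l +h m)) with ((u k -h l) +h (v k -h m)) by vec.
eapply Rle_trans; [apply h_triangle |]; unfold carrier in *; lra.
Qed.

Lemma vlim_map (f : H -> H) (M : R) u l :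
  (forall x y, norm (f x -h f y) <= M * norm (x -h y)) -> vlim u l -> vlim (fun k => f (u k)) (f l).
Proof.
intros Lf L eps Heps.
assert (P : 0 < Rabs M + 1) by (pose proof (Rabs_pos M); lra).
destruct (L (eps / (Rabs M + 1))) as [K HK]; [apply Rdiv_lt_0_compat; auto |].
exists K; intros k Hk; specialize (HK k Hk).
eapply Rle_trans; [apply Lf |].
apply Rle_trans with ((Rabs M + 1) * norm (u k -h l)).
- apply Rmult_le_compat_r; [apply norm_nonneg | pose proof (Rle_abs M); lra].
- apply Rmult_le_compat_l with (r := Rabs M + 1) in HK; [| lra].
  replace ((Rabs M + 1) * (eps / (Rabs M + 1))) with eps in HK by (field; lra); auto.
Qed.

Lemma vlim_scal (a : C) u l : vlim u l -> vlim (fun k => a *h u k) (a *h l).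
Proof.
apply (vlim_map (fun x => a *h x) (Cmod a)); intros x y.
rewrite <- norm_scal_eq; right; apply f_equal; vec.
Qed.

Lemma vlim_norm_le u l M : vlim u l -> (exists K, forall k, (K <= k)%nat -> norm (u k) <= M) -> norm l <= M.
Proof.
intros L [K0 B]; apply le_epsilon; intros eps Heps.
destruct (L eps Heps) as [K HK].
specialize (HK (K0 + K)%nat ltac:(lia)); specialize (B (K0 + K)%nat ltac:(lia)).
rewrite norm_minus_sym in HK; pose proof (norm_le_minus l (u (K0 + K)%nat)); lra.
Qed.

Lemma vlim_ext u v l : (forall k, u k = v k) -> vlim u l -> vlim v l.
Proof. intros E L eps He; destruct (L eps He) as [K HK]; exists K; intros; rewrite <- E; auto. Qed.

Lemma vlim_close u v l : vlim u l -> vlim (fun k => v k -h u k) (0h : H) -> vlim v l.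
Proof.
intros L1 L2; apply vlim_ext with (fun k => u k +h (v k -h u k)); [intros; vec |].
rewrite <- (@plus_zero_r (carrier H) l); apply vlim_plus; auto.
Qed.

Lemma vlim_zero_bound (u : nat -> H) (C : R) : (forall k, norm (u k) <= C * (/ 2) ^ k) -> vlim u (0h : H).
Proof.
intros B eps Heps.
destruct (pow_lt_1_zero (/ 2)) with (y := eps / (Rabs C + 1)) as [K HK].
{ rewrite Rabs_pos_eq; lra. }
{ apply Rdiv_lt_0_compat; auto; pose proof (Rabs_pos C); lra. }
exists K; intros k Hk; specialize (HK k ltac:(lia)).
replace (u k -h (0h : H)) with (u k) by vec.
assert (P : 0 < Rabs C + 1) by (pose proof (Rabs_pos C); lra).
assert (Q : 0 < (/ 2) ^ k) by (apply pow_lt; lra).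
rewrite Rabs_pos_eq in HK by lra.
eapply Rle_trans; [apply B |].
apply Rle_trans with ((Rabs C + 1) * (/ 2) ^ k).
- apply Rmult_le_compat_r; [lra | pose proof (Rle_abs C); lra].
- apply Rmult_lt_compat_l with (r := Rabs C + 1) in HK; [| lra].
  replace ((Rabs C + 1) * (eps / (Rabs C + 1))) with eps in HK by (field; lra); lra.
Qed.

Lemma geometric_vlim (u : nat -> H) (C : R) :
  (forall k, norm (u (S k) -h u k) <= C * (/ 2) ^ k) -> exists l, vlim u l.
Proof.
intros B.
assert (HC : 0 <= C).
{ specialize (B 0%nat); simpl in B; pose proof (norm_nonneg (u 1%nat -h u 0%nat)); lra. }
(* Telescoping; the factor 1 - 2^(-m), the partial sum of the geometric series, is what lets the
   induction on [m] close. *)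
assert (T : forall m k, norm (u (k + m)%nat -h u k) <= 2 * C * (/ 2) ^ k * (1 - (/ 2) ^ m)).
{ induction m as [| m IH]; intros k.
  - rewrite Nat.add_0_r; replace (u k -h u k) with (0h : H) by vec; rewrite norm_zero_eq; simpl; lra.
  - pose proof (norm_tri (u (k + S m)%nat) (u (k + m)%nat) (u k)) as T.
    specialize (IH k); replace (k + S m)%nat with (S (k + m)) in * by lia.
    specialize (B (k + m)%nat); rewrite pow_add in B.
    simpl in *; nra. }
apply cauchy_vlim; intros eps Heps.
destruct (pow_lt_1_zero (/ 2)) with (y := eps / (4 * C + 1)) as [K HK].
{ rewrite Rabs_pos_eq; lra. }
{ apply Rdiv_lt_0_compat; lra. }
assert (Z : forall k, (K <= k)%nat -> norm (u k -h u K) <= eps / 2).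
{ intros k Hk; specialize (T (k - K)%nat K).
  replace (K + (k - K))%nat with k in T by lia.
  specialize (HK K ltac:(lia)).
  assert (Q : forall j, 0 < (/ 2) ^ j) by (intros; apply pow_lt; lra).
  rewrite Rabs_pos_eq in HK by (left; auto).
  assert ((4 * C + 1) * (/ 2) ^ K <= eps).
  { apply Rmult_lt_compat_l with (r := 4 * C + 1) in HK; [| lra].
    replace ((4 * C + 1) * (eps / (4 * C + 1))) with eps in HK by (field; lra); lra. }
  pose proof (Q K); pose proof (Q (k - K)%nat).
  assert (0 <= C * (/ 2) ^ K * (/ 2) ^ (k - K)) by (apply Rmult_le_pos; [apply Rmult_le_pos |]; lra).
  nra. }
exists K; intros k m Hk Hm.
pose proof (norm_tri (u k) (u K) (u m)); pose proof (Z k Hk); pose proof (Z m Hm).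
rewrite (norm_minus_sym (u K)) in H0; lra.
Qed.
End Limits.

(** * Closed subspaces with trivial orthogonal complement *)

Section Projection.
Context {H : Hilbert}.
Variable M : H -> Prop.
Hypothesis M_zero : M (0h : H).
Hypothesis M_plus : forall x y, M x -> M y -> M (x +h y).
Hypothesis M_scal : forall (a : C) x, M x -> M (a *h x).
Hypothesis M_closed : forall (u : nat -> H) l, (forall k, M (u k)) -> vlim u l -> M l.

(** A sequence in [M] minimizing the distance to [x] is Cauchy by the parallelogram law. For its
    limit [m], the vector [x - m] is orthogonal to [M], hence zero by assumption. *)
Lemma closed_subspace_full :
  (forall z, (forall m, M m -> inner m z = RtoC 0) -> z = (0h : H)) -> forall x : H, M x.
Proof.
intros Z x.
(* The supremum [d] is taken over negated squared distances, so the infimum of the squared distances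
   is [- d]. *)
destruct (completeness (fun r => exists m, M m /\ r = - norm (x -h m) ^ 2)) as [d [Ub Lb]].
{ exists 0; intros r [m [_ ->]]; pose proof (pow2_ge_0 (norm (x -h m))); lra. }
{ exists (- norm (x -h 0h) ^ 2), 0h; auto. }
assert (Low : forall m, M m -> - d <= norm (x -h m) ^ 2).
{ intros m Hm; assert (- norm (x -h m) ^ 2 <= d) by (apply Ub; eauto); lra. }
assert (Ex : forall k : nat, exists m, M m /\ norm (x -h m) ^ 2 <= - d + (/ 4) ^ k).
{ intros k; apply NNPP; intros N.
  assert (Q : 0 < (/ 4) ^ k) by (apply pow_lt; lra).
  assert (d <= d - (/ 4) ^ k); [| lra].
  apply Lb; intros r [m [Hm ->]].
  apply Rnot_lt_le; intros L; apply N; exists m; split; auto; lra. }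
(* An excess of 4^(-k) in the squared distance becomes a step of order 2^(-k) between consecutive
   minimizers, so the sequence converges geometrically. *)
destruct (choice _ Ex) as [u Hu].
destruct (geometric_vlim u 2) as [m Hm].
{ intros k; apply sq_le_le.
  { apply Rmult_le_pos; [lra | apply pow_le; lra]. }
  pose proof (parallelogram (x -h u (S k)) (x -h u k)) as P.
  set (a := (RtoC (/ 2)) *h (u (S k) +h u k)).
  assert (Ma : M a) by (apply M_scal, M_plus; apply Hu).
  pose proof (Low a Ma) as La.
  replace ((x -h u (S k)) +h (x -h u k)) with (RtoC 2 *h (x -h a)) in P by (unfold a; vec).
  rewrite norm_scal_R_eq, Rabs_pos_eq in P by lra.
  replace ((x -h u (S k)) -h (x -h u k)) with (u k -h u (S k)) in P by vec.
  rewrite (norm_minus_sym (u k)) in P.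
  destruct (Hu k) as [_ B1]; destruct (Hu (S k)) as [_ B2].
  assert (Q : 0 < (/ 4) ^ k) by (apply pow_lt; lra).
  replace ((2 * (/ 2) ^ k) ^ 2) with (4 * (/ 4) ^ k).
  2: { replace (/ 4) with (/ 2 * / 2) by lra; rewrite Rpow_mult_distr; ring. }
  rewrite Rpow_mult_distr in P; change ((/ 4) ^ S k) with (/ 4 * (/ 4) ^ k) in B2.
  nra. }
assert (Mm : M m) by (apply (M_closed u); auto; apply Hu).
assert (Dm : norm (x -h m) ^ 2 <= - d).
{ apply le_epsilon; intros eps Heps.
  set (b := norm (x -h m)).
  assert (Hb : 0 <= b) by apply norm_nonneg.
  set (e := Rmin 1 (eps / (2 * (b + 1)))).
  assert (He : 0 < e).
  { unfold e; apply Rmin_pos; [lra | apply Rdiv_lt_0_compat; nra]. }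
  assert (He2 : e * (2 * (b + 1)) <= eps).
  { pose proof (Rmin_r 1 (eps / (2 * (b + 1)))) as R; fold e in R.
    apply Rmult_le_compat_r with (r := 2 * (b + 1)) in R; [| lra].
    replace (eps / (2 * (b + 1)) * (2 * (b + 1))) with eps in R by (field; lra); lra. }
  assert (He1 : e <= 1) by apply Rmin_l.
  destruct (Hm (e / 2)) as [K1 HK1]; [lra |].
  destruct (pow_lt_1_zero (/ 4)) with (y := e) as [K2 HK2]; [rewrite Rabs_pos_eq; lra | auto |].
  specialize (HK1 (K1 + K2)%nat ltac:(lia)); specialize (HK2 (K1 + K2)%nat ltac:(lia)).
  destruct (Hu (K1 + K2)%nat) as [_ B].
  pose proof (norm_tri x (u (K1 + K2)%nat) m) as T; fold b in T.
  apply Rabs_def2 in HK2.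
  set (c := norm (x -h u (K1 + K2)%nat)) in *.
  assert (0 <= c) by apply norm_nonneg.
  destruct (Rle_dec b (e / 2)); nra. }
assert (E : x -h m = 0h).
{ apply Z; intros p Hp.
  assert (R0 : forall q, M q -> rip q (x -h m) = 0).
  { intros q Hq; set (z := x -h m) in *.
    assert (Q : forall t : R, 0 <= - 2 * t * rip q z + t ^ 2 * norm q ^ 2).
    { intros t.
      assert (L : - d <= norm (x -h (m +h (RtoC t *h q))) ^ 2) by (apply Low; auto).
      replace (x -h (m +h (RtoC t *h q))) with (z -h RtoC t *h q) in L by (unfold z; vec).
      rewrite norm_sq_minus, norm_scal_R_eq, rip_scal_r, (rip_sym z q) in L.
      replace ((Rabs t * norm q) ^ 2) with (t ^ 2 * norm q ^ 2) in L
        by (rewrite Rpow_mult_distr, pow2_abs; ring).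
      fold z in Dm; lra. }
    set (N := norm q ^ 2) in *.
    assert (0 <= N) by apply pow2_ge_0.
    (* The minimizing parameter would be [r / N]; dividing by [N + 1] still makes the quadratic
       negative unless [r = 0] and covers [N = 0] as well. *)
    pose proof (Q (rip q z / (N + 1))) as Q1.
    set (r := rip q z) in *.
    replace (-2 * (r / (N + 1)) * r + (r / (N + 1)) ^ 2 * N)
      with (- (r ^ 2 * (N + 2)) / (N + 1) ^ 2) in Q1 by (field; lra).
    assert (0 < (N + 1) ^ 2) by nra.
    assert (r ^ 2 * (N + 2) <= 0).
    { apply Rnot_lt_le; intros L.
      assert (- (r ^ 2 * (N + 2)) / (N + 1) ^ 2 < 0); [| lra].
      unfold Rdiv; rewrite Ropp_mult_distr_l_reverse.
      apply Ropp_lt_gt_0_contravar, Rmult_lt_0_compat; auto using Rinv_0_lt_compat. }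
    nra. }
  pose proof (R0 p Hp) as A1; pose proof (R0 _ (M_scal Ci p Hp)) as A2.
  pose proof (im_inner_rip p (x -h m)) as A3; rewrite A2 in A3.
  unfold rip in A1; apply injective_projections; simpl; [exact A1 |].
  unfold Im in A3; rewrite A3; lra. }
replace x with m; auto.
rewrite <- (h_sub_add x m), E; symmetry; apply h_add_0_l.
Qed.
End Projection.

(** * The Hille-Yosida theorem for m-accretive operators *)

Lemma op_ext {H : Hilbert} (S T : op H) : op_eq S T -> S = T.
Proof.
intros E; apply functional_extensionality; intros x; apply functional_extensionality; intros y.
apply propositional_extensionality, E.
Qed.

Lemma at_right_vec {H : Hilbert} (f : R -> H) (l : H) :
  filterlim f (at_right 0) (locally l) <->
  (forall eps, 0 < eps -> exists d, 0 < d /\ forall t, 0 < t < d -> norm (f t -h l) <= eps).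
Proof.
rewrite (@filterlim_locally_ball_norm C_AbsRing R (carrier H) (at_right 0) _ f l); split.
- intros L eps He; destruct (L (mkposreal eps He)) as [d Hd].
  exists d; split; [apply cond_pos |]; intros t Ht; left; apply Hd; [| lra].
  change (Rabs (t - 0) < d); rewrite Rminus_0_r, Rabs_pos_eq; lra.
- intros L eps; destruct (L (eps / 2)) as [d [Hd Ld]]; [destruct eps; simpl; lra |].
  exists (mkposreal d Hd); intros t Ht Pt; unfold ball_norm.
  change (Rabs (t - 0) < d) in Ht; rewrite Rminus_0_r, Rabs_pos_eq in Ht by lra.
  eapply Rle_lt_trans; [apply Ld; lra |]; destruct eps; simpl; lra.
Qed.

Lemma op_opp_iff {H : Hilbert} (T : op H) x y : op_opp T x y <-> exists u, T x u /\ y = ~h u.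
Proof.
unfold op_opp, op_scal; split; intros [u [Tu ->]]; exists u; split; auto.
- symmetry; apply opp_scal.
- apply opp_scal.
Qed.

(** The number of steps of length 2^(-k) that fit into [[0, t]]. *)
Definition dyadic_floor (t : R) (k : nat) : nat := Z.to_nat (Int_part (t * 2 ^ k)).

Lemma dyadic_floor_spec t k : 0 <= t ->
  INR (dyadic_floor t k) <= t * 2 ^ k < INR (dyadic_floor t k) + 1.
Proof.
intros Ht; unfold dyadic_floor.
assert (P : 0 <= t * 2 ^ k) by (apply Rmult_le_pos; auto; apply pow_le; lra).
destruct (base_Int_part (t * 2 ^ k)) as [B1 B2].
assert (Q : (0 <= Int_part (t * 2 ^ k))%Z).
{ assert (L : IZR (-1) < IZR (Int_part (t * 2 ^ k))) by lra.
  apply lt_IZR in L; lia. }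
rewrite INR_IZR_INZ, Z2Nat.id by auto; lra.
Qed.

Lemma dyadic_floor_double t k : 0 <= t ->
  dyadic_floor t (S k) = (2 * dyadic_floor t k)%nat \/ dyadic_floor t (S k) = S (2 * dyadic_floor t k).
Proof.
intros Ht; pose proof (dyadic_floor_spec t k Ht) as [A B].
pose proof (dyadic_floor_spec t (S k) Ht) as [A' B']; simpl pow in *.
set (n := dyadic_floor t k) in *; set (m := dyadic_floor t (S k)) in *.
assert (L1 : INR (2 * n) < INR (S m)) by (rewrite mult_INR, (S_INR m); simpl; lra).
assert (L2 : INR m < INR (2 * n + 2)) by (rewrite plus_INR, mult_INR; simpl; lra).
apply INR_lt in L1; apply INR_lt in L2; lia.
Qed.

Lemma dyadic_floor_plus s t k : 0 <= s -> 0 <= t ->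
  dyadic_floor (s + t) k = (dyadic_floor s k + dyadic_floor t k)%nat \/
  dyadic_floor (s + t) k = S (dyadic_floor s k + dyadic_floor t k).
Proof.
intros Hs Ht; pose proof (dyadic_floor_spec t k Ht) as [A B].
pose proof (dyadic_floor_spec s k Hs) as [A1 B1].
pose proof (dyadic_floor_spec (s + t) k ltac:(lra)) as [A' B'].
set (n := dyadic_floor t k) in *; set (m := dyadic_floor s k) in *; set (p := dyadic_floor (s + t) k) in *.
assert (L1 : INR (m + n) < INR (S p)) by (rewrite plus_INR, (S_INR p); lra).
assert (L2 : INR p < INR (m + n + 2)) by (rewrite !plus_INR; simpl; lra).
apply INR_lt in L1; apply INR_lt in L2; lia.
Qed.

(** The range condition is imposed for every positive [h] at once, which spares the continuation
    argument from one [h] to all others. *)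
Record m_accretive {H : Hilbert} (T : op H) : Prop := {
  acc_linear : linear_op T;
  acc_dense : densely_defined T;
  acc_nonneg : forall x y, T x y -> 0 <= rip y x;
  acc_surj : forall h, 0 < h -> forall z, exists x y, T x y /\ z = x +h RtoC h *h y
}.

(** This is (1 + h T)^(-1), one backward Euler step. The chosen solution is unique by
    accretivity. *)
Definition resolvent {H : Hilbert} (T : op H) (h : R) (z : H) : H :=
  epsilon (inhabits (0h : H)) (fun x => exists y, T x y /\ z = x +h RtoC h *h y).

Section LinearOp.
Context {H : Hilbert} {T : op H} (LT : linear_op T).
Lemma lop_fun x y z : T x y -> T x z -> y = z. Proof. apply LT. Qed.
Lemma lop_plus x y u v : T x u -> T y v -> T (x +h y) (u +h v). Proof. apply LT. Qed.
Lemma lop_scal (a : C) x u : T x u -> T (a *h x) (a *h u). Proof. apply LT. Qed.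
Lemma lop_minus x y u v : T x u -> T y v -> T (x -h y) (u -h v).
Proof.
intros A B; replace (x -h y) with (x +h RtoC (-1) *h y) by vec.
replace (u -h v) with (u +h RtoC (-1) *h v) by vec; apply lop_plus; auto; apply lop_scal; auto.
Qed.
Lemma lop_zero : T (0h : H) 0h. Proof. apply LT. Qed.
End LinearOp.

(** * The backward Euler scheme and its limit semigroup *)

Section HilleYosida.
Context {H : Hilbert} {T : op H} (HT : m_accretive T).
Implicit Types x y z : H.
Let LT := acc_linear T HT.
Notation J := (resolvent T).

Lemma resolvent_spec h z : 0 < h -> exists y, T (J h z) y /\ z = J h z +h RtoC h *h y.
Proof. intros Hh; unfold resolvent; apply epsilon_spec, (acc_surj T HT); auto. Qed.

(** Pairing [x + h y] with [x] gives [norm x ^ 2] plus a nonnegative term, and Cauchy-Schwarz bounds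
    the pairing from above. This yields injectivity of 1 + h T and contractivity of its inverse. *)
Lemma accretive_bound h x y : 0 <= h -> T x y -> norm x <= norm (x +h RtoC h *h y).
Proof.
intros Hh Txy; pose proof (acc_nonneg T HT _ _ Txy) as P.
set (z := x +h RtoC h *h y).
assert (E : rip z x = norm x ^ 2 + h * rip y x).
{ unfold z; rewrite rip_plus_l, rip_scal_l, norm_sq_rip; ring. }
pose proof (rip_le z x); pose proof (norm_nonneg x); pose proof (norm_nonneg z).
assert (0 <= h * rip y x) by (apply Rmult_le_pos; auto).
destruct (Req_dec (norm x) 0); nra.
Qed.

Lemma resolvent_eq h x y z : 0 < h -> T x y -> z = x +h RtoC h *h y -> J h z = x.
Proof.
intros Hh Txy ->; destruct (resolvent_spec h (x +h RtoC h *h y) Hh) as [y' [T' E]].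
set (w := J h (x +h RtoC h *h y)) in *.
apply minus_zero_eq.
eapply Rle_trans; [apply (accretive_bound h _ (y' -h y)); [lra | apply lop_minus; auto] |].
replace (w -h x +h RtoC h *h (y' -h y)) with ((w +h RtoC h *h y') -h (x +h RtoC h *h y)) by vec.
rewrite <- E; replace (x +h RtoC h *h y -h (x +h RtoC h *h y)) with (0h : H) by vec.
rewrite norm_zero_eq; lra.
Qed.

Lemma resolvent_contr h z : 0 < h -> norm (J h z) <= norm z.
Proof.
intros Hh; destruct (resolvent_spec h z Hh) as [y [Ty E]].
rewrite E at 2; apply accretive_bound; auto; lra.
Qed.

Lemma resolvent_plus h x y : 0 < h -> J h (x +h y) = J h x +h J h y.
Proof.
intros Hh; destruct (resolvent_spec h x Hh) as [u [Tu E]]; destruct (resolvent_spec h y Hh) as [v [Tv F]].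
apply resolvent_eq with (u +h v); auto.
- apply lop_plus; auto.
- rewrite E at 1; rewrite F at 1; vec.
Qed.

Lemma resolvent_scal h (a : C) x : 0 < h -> J h (a *h x) = a *h J h x.
Proof.
intros Hh; destruct (resolvent_spec h x Hh) as [u [Tu E]].
apply resolvent_eq with (a *h u); auto.
- apply lop_scal; auto.
- rewrite E at 1; vec.
Qed.

(** The resolvent commutes with [T] on the domain, so one Euler step moves [x] by [h] times a vector
    no longer than [T x]. *)
Lemma resolvent_dom h x y : 0 < h -> T x y -> T (J h x) (J h y) /\ x -h J h x = RtoC h *h J h y.
Proof.
intros Hh Txy; destruct (resolvent_spec h x Hh) as [v [Tv E]].
assert (J h y = v) as ->.
{ pose proof (lop_scal LT (RtoC (/ h)) _ _ (lop_minus LT _ _ _ _ Txy Tv)) as K.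
  replace (RtoC (/ h) *h (x -h J h x)) with v in K.
  - apply resolvent_eq with (RtoC (/ h) *h (y -h v)); auto; vec; lra.
  - rewrite E at 1; vec; lra. }
split; auto; rewrite E at 1; vec.
Qed.

Definition euler (h : R) (n : nat) (x : H) : H := Nat.iter n (J h) x.

Lemma euler_S h n x : euler h (S n) x = euler h n (J h x).
Proof. unfold euler; simpl; rewrite <- Nat.iter_succ_r; reflexivity. Qed.

Lemma euler_add h n m x : euler h (n + m) x = euler h n (euler h m x).
Proof. unfold euler; apply Nat.iter_add. Qed.

Lemma euler_contr h n x : 0 < h -> norm (euler h n x) <= norm x.
Proof.
intros Hh; induction n as [| n IH]; simpl; [apply Rle_refl |].
eapply Rle_trans; [apply resolvent_contr; auto | exact IH].
Qed.

Lemma euler_plus h n x y : 0 < h -> euler h n (x +h y) = euler h n x +h euler h n y.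
Proof.
intros Hh; induction n as [| n IH]; simpl; auto.
change (Nat.iter n (J h) (x +h y)) with (euler h n (x +h y)); rewrite IH; apply resolvent_plus; auto.
Qed.

Lemma euler_scal h n a x : 0 < h -> euler h n (a *h x) = a *h euler h n x.
Proof.
intros Hh; induction n as [| n IH]; simpl; auto.
change (Nat.iter n (J h) (a *h x)) with (euler h n (a *h x)); rewrite IH; apply resolvent_scal; auto.
Qed.

Lemma euler_minus h n x y : 0 < h -> euler h n (x -h y) = euler h n x -h euler h n y.
Proof.
intros Hh; replace (x -h y) with (x +h RtoC (-1) *h y) by vec.
rewrite euler_plus, euler_scal by auto; vec.
Qed.

Lemma euler_dom h n x y : 0 < h -> T x y -> T (euler h n x) (euler h n y).
Proof. intros Hh Txy; induction n as [| n IH]; simpl; auto; apply resolvent_dom; auto. Qed.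

Lemma euler_move h n x y : 0 < h -> T x y -> norm (euler h n x -h x) <= INR n * h * norm y.
Proof.
intros Hh Txy; induction n as [| n IH].
- simpl; replace (x -h x) with (0h : H) by vec; rewrite norm_zero_eq; lra.
- pose proof (norm_tri (euler h (S n) x) (euler h n x) x) as Tr.
  destruct (resolvent_dom h _ _ Hh (euler_dom h n x y Hh Txy)) as [_ E].
  assert (B : norm (euler h (S n) x -h euler h n x) <= h * norm y).
  { rewrite norm_minus_sym; change (euler h (S n) x) with (J h (euler h n x)).
    rewrite E, norm_scal_R_eq, Rabs_pos_eq by lra.
    apply Rmult_le_compat_l; [lra |].
    eapply Rle_trans; [apply resolvent_contr; auto | apply euler_contr; auto]. }
  rewrite S_INR; lra.
Qed.

Lemma euler_diff h n m x y : 0 < h -> T x y -> norm (euler h (n + m) x -h euler h m x) <= INR n * h * norm y.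
Proof.
intros Hh Txy; rewrite Nat.add_comm, euler_add, <- euler_minus by auto.
eapply Rle_trans; [apply euler_contr; auto | apply euler_move; auto].
Qed.

(* (1 + h/2 T)^2 = (1 + h T) + h^2/4 T^2 *)
Lemma resolvent_halve h x y z : 0 < h -> T x y -> T y z ->
  norm (J (h / 2) (J (h / 2) x) -h J h x) <= h ^ 2 / 4 * norm z.
Proof.
intros Hh Txy Tyz.
assert (H2 : 0 < h / 2) by lra.
destruct (resolvent_dom _ _ _ H2 Txy) as [T1 E1]; destruct (resolvent_dom _ _ _ H2 T1) as [T2 E2].
destruct (resolvent_dom _ _ _ H2 Tyz) as [T3 E3]; destruct (resolvent_dom _ _ _ H2 T3) as [T4 E4].
destruct (resolvent_dom _ _ _ Hh Txy) as [T5 E5].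
set (a := J (h / 2) x) in *; set (b := J (h / 2) a) in *.
set (y1 := J (h / 2) y) in *; set (y2 := J (h / 2) y1) in *.
set (z2 := J (h / 2) (J (h / 2) z)) in *.
set (c := J h x) in *.
assert (Bz : norm z2 <= norm z).
{ eapply Rle_trans; apply resolvent_contr; auto. }
eapply Rle_trans.
{ apply (accretive_bound h _ (y2 -h J h y)); [lra | apply lop_minus; auto]. }
(* Here 1 + h T is applied to the difference of the two schemes. Both start from [x]; two half-steps
   satisfy [x = b + h y2 + (h^2 / 4) z2], so only the quadratic term survives. *)
replace (b -h c +h RtoC h *h (y2 -h J h y)) with (RtoC (- (h ^ 2 / 4)) *h z2).
{ rewrite norm_scal_R_eq, Rabs_Ropp, Rabs_pos_eq; [| nra]; apply Rmult_le_compat_l; nra. }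
assert (F1 : x = a +h RtoC (h / 2) *h y1) by (rewrite <- E1; vec).
assert (F2 : a = b +h RtoC (h / 2) *h y2) by (rewrite <- E2; vec).
assert (F4 : y1 = y2 +h RtoC (h / 2) *h z2) by (rewrite <- E4; vec).
assert (F5 : RtoC h *h J h y = a +h RtoC (h / 2) *h y1 -h c) by (rewrite <- E5, <- F1; vec).
replace (RtoC h *h (y2 -h J h y)) with (RtoC h *h y2 -h RtoC h *h J h y) by vec.
rewrite F5, F2, F4; vec.
Qed.

(** Local errors of order h^2 simply add up, because the remaining steps are contractions and
    [T (T x)] does not grow under the resolvent. *)
Lemma euler_halve h n x y z : 0 < h -> T x y -> T y z ->
  norm (euler (h / 2) (2 * n) x -h euler h n x) <= INR n * (h ^ 2 / 4) * norm z.
Proof.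
intros Hh; assert (H2 : 0 < h / 2) by lra.
revert x y z; induction n as [| n IH]; intros x y z Txy Tyz.
- simpl; replace (x -h x) with (0h : H) by vec; rewrite norm_zero_eq; lra.
- replace (2 * S n)%nat with (S (S (2 * n))) by lia; rewrite !euler_S.
  pose proof (norm_tri (euler (h / 2) (2 * n) (J (h / 2) (J (h / 2) x)))
    (euler (h / 2) (2 * n) (J h x)) (euler h n (J h x))) as Tr.
  rewrite <- euler_minus in Tr by auto.
  pose proof (euler_contr (h / 2) (2 * n) (J (h / 2) (J (h / 2) x) -h J h x) H2).
  pose proof (resolvent_halve h x y z Hh Txy Tyz).
  destruct (resolvent_dom _ _ _ Hh Txy) as [T1 _]; destruct (resolvent_dom _ _ _ Hh Tyz) as [T2 _].
  specialize (IH _ _ _ T1 T2).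
  assert (INR n * (h ^ 2 / 4) * norm (J h z) <= INR n * (h ^ 2 / 4) * norm z).
  { apply Rmult_le_compat_l; [apply Rmult_le_pos; [apply pos_INR | nra] | apply resolvent_contr; auto]. }
  rewrite S_INR; lra.
Qed.

Definition step (k : nat) : R := (/ 2) ^ k.
Lemma step_pos k : 0 < step k. Proof. apply pow_lt; lra. Qed.
Lemma step_S k : step (S k) = step k / 2. Proof. unfold step; simpl; lra. Qed.
Lemma step_floor t k : 0 <= t -> INR (dyadic_floor t k) * step k <= t < INR (dyadic_floor t k) * step k + step k.
Proof.
intros Ht; destruct (dyadic_floor_spec t k Ht) as [A B].
assert (E : t * 2 ^ k * step k = t).
{ unfold step; rewrite Rmult_assoc, <- Rpow_mult_distr, Rinv_r, pow1 by lra; ring. }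
pose proof (step_pos k); split.
- rewrite <- E at 2; apply Rmult_le_compat_r; lra.
- rewrite <- E at 1; replace (INR (dyadic_floor t k) * step k + step k)
    with ((INR (dyadic_floor t k) + 1) * step k) by ring; apply Rmult_lt_compat_r; lra.
Qed.

Definition euler_t (t : R) (k : nat) (x : H) : H := euler (step k) (dyadic_floor t k) x.

(** Halving the step doubles the number of steps up to one. The doubling costs at most [t * norm z]
    times the step since [n h <= t]; the possible extra half-step costs at most [norm y] times the
    step. The bound is summable in [k]. *)
Lemma euler_t_step t k x y z : 0 <= t -> T x y -> T y z ->
  norm (euler_t t (S k) x -h euler_t t k x) <= (t * norm z + norm y) * (/ 2) ^ k.
Proof.
intros Ht Txy Tyz; unfold euler_t; fold (step k).
pose proof (step_pos k) as Sp; pose proof (step_floor t k Ht) as [Fl _].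
rewrite step_S; set (h := step k) in *; set (n := dyadic_floor t k) in *.
assert (H2 : 0 < h / 2) by lra.
assert (h1 : h <= 1).
{ unfold h, step; rewrite <- (pow1 k); apply pow_incr; lra. }
pose proof (norm_nonneg y); pose proof (norm_nonneg z); pose proof (pos_INR n).
pose proof (euler_halve h n x y z Sp Txy Tyz) as E1.
assert (E3 : INR n * (h ^ 2 / 4) * norm z <= t * norm z * h).
{ assert (0 <= norm z * h) by nra. assert (0 <= INR n * h) by nra.
  replace (INR n * (h ^ 2 / 4) * norm z) with ((INR n * h / 4) * (norm z * h)) by field.
  rewrite Rmult_assoc; apply Rmult_le_compat_r; lra. }
destruct (dyadic_floor_double t k Ht) as [-> | ->]; fold n.
- assert (0 <= norm y * h) by nra; lra.
- pose proof (norm_tri (euler (h / 2) (S (2 * n)) x) (euler (h / 2) (2 * n) x) (euler h n x)).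
  pose proof (euler_diff (h / 2) 1 (2 * n) x y H2 Txy) as E2; change (1 + 2 * n)%nat with (S (2 * n)) in E2; change (INR 1) with 1 in E2.
  assert (0 <= norm y * h) by nra; lra.
Qed.

Lemma dom_approx x eps : 0 < eps -> exists x' y', T x' y' /\ norm (x -h x') <= eps.
Proof.
intros He; destruct (acc_dense T HT x (mkposreal eps He)) as [x' [[y' Ty] L]].
exists x', y'; split; auto; left; exact L.
Qed.

(** The refinement estimate requires [T x] to lie in the domain too. Resolvents [J h u] of domain
    vectors have this property and approximate [u] as [h] tends to 0. *)
Lemma dom2_approx x eps : 0 < eps -> exists x' y' z', T x' y' /\ T y' z' /\ norm (x -h x') <= eps.
Proof.
intros He; destruct (dom_approx x (eps / 2)) as [u [v [Tuv Lu]]]; [lra |].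
set (h := eps / 2 / (norm v + 1)).
assert (P : 0 < norm v + 1) by (pose proof (norm_nonneg v); lra).
assert (Hh : 0 < h) by (apply Rdiv_lt_0_compat; lra).
destruct (resolvent_dom h u v Hh Tuv) as [T1 E].
destruct (resolvent_spec h v Hh) as [w [Tw _]].
exists (J h u), (J h v), w; split; [| split]; auto.
assert (norm (u -h J h u) <= eps / 2).
{ rewrite E, norm_scal_R_eq, Rabs_pos_eq by lra.
  apply Rle_trans with (h * (norm v + 1)).
  - apply Rmult_le_compat_l; [lra |]; pose proof (resolvent_contr h v Hh); lra.
  - unfold h; right; field; lra. }
pose proof (norm_tri x u (J h u)); lra.
Qed.

Lemma euler_t_contr t k x : norm (euler_t t k x) <= norm x.
Proof. apply euler_contr, step_pos. Qed.

Lemma euler_t_minus t k x y : euler_t t k (x -h y) = euler_t t k x -h euler_t t k y.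
Proof. apply euler_minus, step_pos. Qed.

(** Convergence on the dense set just described extends to all vectors because the schemes are
    uniformly contractive. *)
Lemma euler_t_lim t x : 0 <= t -> exists l, vlim (fun k => euler_t t k x) l.
Proof.
intros Ht; apply cauchy_vlim; intros eps He.
destruct (dom2_approx x (eps / 3)) as [x' [y' [z' [T1 [T2 L]]]]]; [lra |].
destruct (geometric_vlim (fun k => euler_t t k x') (t * norm z' + norm y')) as [l Hl].
{ intros k; apply euler_t_step; auto. }
destruct (Hl (eps / 6)) as [K HK]; [lra |].
exists K; intros k m Hk Hm; pose proof (HK k Hk) as A; pose proof (HK m Hm) as B.
assert (D : forall j, norm (euler_t t j x -h euler_t t j x') <= eps / 3).
{ intros j; rewrite <- euler_t_minus; eapply Rle_trans; [apply euler_t_contr | exact L]. }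
pose proof (D k) as D1; pose proof (D m) as D2.
rewrite (norm_minus_sym (euler_t t m x)) in D2; rewrite (norm_minus_sym (euler_t t m x') l) in B.
pose proof (norm_tri (euler_t t k x) (euler_t t k x') (euler_t t m x)).
pose proof (norm_tri (euler_t t k x') l (euler_t t m x)).
pose proof (norm_tri l (euler_t t m x') (euler_t t m x)).
lra.
Qed.

Definition hy_semigroup (t : R) (x : H) : H := epsilon (inhabits (0h : H)) (vlim (fun k => euler_t t k x)).
Notation U := hy_semigroup.

Lemma hy_lim t x : 0 <= t -> vlim (fun k => euler_t t k x) (U t x).
Proof. intros Ht; unfold hy_semigroup; apply epsilon_spec, euler_t_lim; auto. Qed.

Lemma hy_contr t x : 0 <= t -> norm (U t x) <= norm x.
Proof. intros Ht; apply (vlim_norm_le _ _ _ (hy_lim t x Ht)); exists 0%nat; intros; apply euler_t_contr. Qed.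

Lemma hy_plus t x y : 0 <= t -> U t (x +h y) = U t x +h U t y.
Proof.
intros Ht; apply vlim_unique with (1 := hy_lim t _ Ht).
apply vlim_ext with (fun k => euler_t t k x +h euler_t t k y).
- intros k; symmetry; apply euler_plus, step_pos.
- apply vlim_plus; apply hy_lim; auto.
Qed.

Lemma hy_scal t (a : C) x : 0 <= t -> U t (a *h x) = a *h U t x.
Proof.
intros Ht; apply vlim_unique with (1 := hy_lim t _ Ht).
apply vlim_ext with (fun k => a *h euler_t t k x).
- intros k; symmetry; apply euler_scal, step_pos.
- apply vlim_scal; apply hy_lim; auto.
Qed.

Lemma hy_minus t x y : 0 <= t -> U t (x -h y) = U t x -h U t y.
Proof.
intros Ht; replace (x -h y) with (x +h RtoC (-1) *h y) by vec.
rewrite hy_plus, hy_scal by auto; vec.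
Qed.

Lemma hy_dense_eq (f g : H -> H) :
  (forall x y, norm (f x -h f y) <= norm (x -h y)) -> (forall x y, norm (g x -h g y) <= norm (x -h y)) ->
  (forall x y, T x y -> f x = g x) -> forall x, f x = g x.
Proof.
intros Lf Lg E x; apply minus_zero_eq, le_epsilon; intros eps He.
destruct (dom_approx x (eps / 2)) as [x' [y' [T1 L]]]; [lra |].
pose proof (Lf x x'); pose proof (Lg x' x); rewrite (E _ _ T1) in H0.
rewrite (norm_minus_sym x' x) in H1.
pose proof (norm_tri (f x) (g x') (g x)); lra.
Qed.

(** The step counts for [s] and [t] add up to the one for [s + t] or fall short by one, and one step
    moves a domain vector by at most 2^(-k) [norm y]. Density of the domain does the rest. *)
Lemma hy_sg s t x : 0 <= s -> 0 <= t -> U (s + t) x = U s (U t x).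
Proof.
intros Hs Ht; revert x; apply hy_dense_eq; auto.
{ intros x y; rewrite <- hy_minus by lra; apply hy_contr; lra. }
{ intros x y; rewrite <- !hy_minus by lra.
  eapply Rle_trans; apply hy_contr; lra. }
intros x y Txy; apply vlim_unique with (1 := hy_lim (s + t) x ltac:(lra)).
apply vlim_close with (fun k => euler_t s k (euler_t t k x)).
- apply vlim_close with (fun k => euler_t s k (U t x)); [apply hy_lim; auto |].
  intros eps He; destruct (hy_lim t x Ht eps He) as [K HK]; exists K; intros k Hk.
  rewrite <- euler_t_minus.
  replace (euler_t s k (euler_t t k x -h U t x) -h 0h) with (euler_t s k (euler_t t k x -h U t x)) by vec.
  eapply Rle_trans; [apply euler_t_contr | auto].
- apply vlim_zero_bound with (norm y); intros k; fold (step k).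
  pose proof (step_pos k) as Sp; pose proof (norm_nonneg y).
  unfold euler_t; rewrite <- euler_add.
  destruct (dyadic_floor_plus s t k Hs Ht) as [-> | ->].
  + set (w := euler _ _ _); replace (w -h w) with (0h : H) by vec; rewrite norm_zero_eq; nra.
  + eapply Rle_trans; [apply (euler_diff (step k) 1 (dyadic_floor s k + dyadic_floor t k) x y); auto |].
    simpl; lra.
Qed.

Lemma hy_move t x y : 0 <= t -> T x y -> norm (U t x -h x) <= t * norm y.
Proof.
intros Ht Txy.
apply (vlim_norm_le (fun k => euler_t t k x -h x)).
{ intros eps He; destruct (hy_lim t x Ht eps He) as [K HK]; exists K; intros k Hk.
  replace (euler_t t k x -h x -h (U t x -h x)) with (euler_t t k x -h U t x) by vec; auto. }
exists 0%nat; intros k _; eapply Rle_trans; [apply euler_move with (1 := step_pos k) (2 := Txy) |].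
apply Rmult_le_compat_r; [apply norm_nonneg | apply step_floor; auto].
Qed.

(** First-order expansion of an orbit with an explicit remainder. As [y] need not lie in the domain,
    it is compared with some [y'] that does and whose drift up to time [t] is at most
    [t * norm z']. *)
Lemma hy_expand t x y : 0 <= t -> T x y -> forall y' z', T y' z' ->
  norm (U t x -h x +h RtoC t *h y) <= t * (2 * norm (y -h y') + t * norm z').
Proof.
intros Ht Txy y' z' T'; apply le_epsilon; intros eps He.
set (D := 2 * norm (y -h y') + t * norm z').
(* The same expansion for the discrete scheme: each step subtracts [h] times the current image of
   [y], which stays within [D] of [y]. *)
assert (E : forall k n, INR n * step k <= t -> norm (euler (step k) n x -h x +h RtoC (INR n * step k) *h y) <= INR n * step k * D).
{ intros k n; set (h := step k); assert (Sp : 0 < h) by apply step_pos.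
  induction n as [| n IH]; intros Hn.
  - simpl; replace (x -h x +h RtoC (0 * h) *h y) with (0h : H) by vec; rewrite norm_zero_eq; lra.
  - rewrite S_INR in *; specialize (IH ltac:(lra)).
    destruct (resolvent_dom h _ _ Sp (euler_dom h n x y Sp Txy)) as [_ E].
    change (J h (euler h n x)) with (euler h (S n) x) in E; change (J h (euler h n y)) with (euler h (S n) y) in E.
    replace (euler h (S n) x -h x +h RtoC ((INR n + 1) * h) *h y) with
      ((euler h n x -h x +h RtoC (INR n * h) *h y) +h RtoC h *h (y -h euler h (S n) y)).
    2: { replace (euler h (S n) x) with (euler h n x -h RtoC h *h euler h (S n) y) by (rewrite <- E; vec); vec. }
    eapply Rle_trans; [apply h_triangle |].
    assert (norm (y -h euler h (S n) y) <= D).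
    { pose proof (norm_tri y y' (euler h (S n) y)).
      pose proof (norm_tri y' (euler h (S n) y') (euler h (S n) y)).
      pose proof (euler_move h (S n) y' z' Sp T').
      pose proof (euler_contr h (S n) (y' -h y) Sp).
      rewrite euler_minus in H3 by auto.
      rewrite (norm_minus_sym y' (euler h (S n) y')) in H1; rewrite (norm_minus_sym y' y) in H3.
      assert (INR (S n) * h * norm z' <= t * norm z').
      { apply Rmult_le_compat_r; [apply norm_nonneg | rewrite S_INR; lra]. }
      unfold D; lra. }
    rewrite norm_scal_R_eq, (Rabs_pos_eq h) by lra.
    assert (h * norm (y -h euler h (S n) y) <= h * D) by (apply Rmult_le_compat_l; lra).
    lra. }
assert (HD : 0 <= D).
{ pose proof (norm_nonneg (y -h y')); pose proof (norm_nonneg z').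
  assert (0 <= t * norm z') by (apply Rmult_le_pos; auto). unfold D; lra. }
destruct (hy_lim t x Ht (eps / 2)) as [K1 HK1]; [lra |].
assert (Py : 0 < norm y + 1) by (pose proof (norm_nonneg y); lra).
destruct (pow_lt_1_zero (/ 2)) with (y := eps / 2 / (norm y + 1)) as [K2 HK2]; [rewrite Rabs_pos_eq; lra | apply Rdiv_lt_0_compat; lra |].
specialize (HK1 (K1 + K2)%nat ltac:(lia)); specialize (HK2 (K1 + K2)%nat ltac:(lia)).
set (k := (K1 + K2)%nat) in *; fold (step k) in HK2; pose proof (step_pos k) as Sp.
rewrite Rabs_pos_eq in HK2 by lra.
destruct (step_floor t k Ht) as [F1 F2].
specialize (E k (dyadic_floor t k) F1); fold (euler_t t k x) in E.
set (m := INR (dyadic_floor t k) * step k) in *.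
replace (U t x -h x +h RtoC t *h y) with ((U t x -h euler_t t k x) +h (euler_t t k x -h x +h RtoC m *h y) +h RtoC (t - m) *h y) by vec.
eapply Rle_trans; [apply h_triangle |].
pose proof (h_triangle (U t x -h euler_t t k x) (euler_t t k x -h x +h RtoC m *h y)).
rewrite (norm_minus_sym (U t x)) in H0.
rewrite norm_scal_R_eq, (Rabs_pos_eq (t - m)) by lra.
assert ((t - m) * norm y <= eps / 2).
{ apply Rle_trans with (step k * (norm y + 1)).
  - pose proof (norm_nonneg y); apply Rmult_le_compat; lra.
  - apply Rmult_lt_compat_r with (r := norm y + 1) in HK2; [| auto].
    replace (eps / 2 / (norm y + 1) * (norm y + 1)) with (eps / 2) in HK2 by (field; lra); lra. }
assert (m * D <= t * D) by (apply Rmult_le_compat_r; lra).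
fold D; lra.
Qed.

Lemma hy_zero x : U 0 x = x.
Proof.
apply vlim_unique with (1 := hy_lim 0 x ltac:(lra)).
apply vlim_ext with (fun _ => x); [| apply vlim_const].
intros k; unfold euler_t; replace (dyadic_floor 0 k) with 0%nat; auto.
destruct (dyadic_floor_spec 0 k) as [A _]; [lra |].
rewrite Rmult_0_l in A; destruct (dyadic_floor 0 k); auto.
pose proof (pos_INR n); rewrite S_INR in A; lra.
Qed.

Lemma hy_is_linear t : 0 <= t -> is_linear (U t).
Proof.
intros Ht; constructor.
- intros x y; apply hy_plus; auto.
- intros a x; apply hy_scal; auto.
- exists 1; split; [lra |]; intros x; rewrite Rmult_1_l; apply hy_contr; auto.
Qed.

Lemma hy_cont x eps : 0 < eps -> exists d, 0 < d /\ forall t, 0 < t < d -> norm (U t x -h x) <= eps.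
Proof.
intros He; destruct (dom_approx x (eps / 3)) as [x' [y' [T' L]]]; [lra |].
assert (P : 0 < norm y' + 1) by (pose proof (norm_nonneg y'); lra).
exists (eps / 3 / (norm y' + 1)); split; [apply Rdiv_lt_0_compat; lra |].
intros t [Ht Ht2].
pose proof (norm_tri (U t x) (U t x') x); pose proof (norm_tri (U t x') x' x).
pose proof (hy_move t x' y' ltac:(lra) T').
pose proof (hy_contr t (x -h x') ltac:(lra)) as C; rewrite hy_minus in C by lra.
rewrite (norm_minus_sym x' x) in H1.
assert (t * norm y' <= eps / 3).
{ apply Rmult_lt_compat_r with (r := norm y' + 1) in Ht2; auto.
  replace (eps / 3 / (norm y' + 1) * (norm y' + 1)) with (eps / 3) in Ht2 by (field; lra); nra. }
lra.
Qed.

Lemma hy_C0 : C0_semigroup U.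
Proof.
constructor.
- apply hy_is_linear.
- apply hy_zero.
- apply hy_sg.
- intros x; apply at_right_vec; apply hy_cont.
Qed.

(** Commutation passes from resolvents to Euler products and then, since [L] is bounded, to their
    limits. *)
Lemma hy_commute (L : H -> H) : is_linear L -> (forall h x, 0 < h -> L (J h x) = J h (L x)) ->
  forall t x, 0 <= t -> L (U t x) = U t (L x).
Proof.
intros LL C t x Ht.
assert (E : forall h n z, 0 < h -> L (euler h n z) = euler h n (L z)).
{ intros h n z Hh; induction n as [| n IH]; simpl; auto; rewrite C by auto; f_equal; exact IH. }
symmetry; apply vlim_unique with (1 := hy_lim t (L x) Ht).
apply vlim_ext with (fun k => L (euler_t t k x)).
{ intros k; apply E, step_pos. }
destruct (linear_norm L LL) as [M [_ HM]].
apply (vlim_map L M); [| apply hy_lim; auto].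
intros u v; eapply Rle_trans; [| apply HM].
right; apply f_equal; unfold minus; symmetry; etransitivity; [apply (linear_plus L LL) |].
apply f_equal; rewrite (opp_scal v), (opp_scal (L v)); apply (linear_scal L LL).
Qed.

(** That domain vectors are differentiable at 0 is the expansion above. Conversely, let the
    difference quotients at [x] tend to [y]. Applying [J 1], which commutes with the semigroup,
    identifies [J 1 y] with the derivative at [J 1 x], known since [J 1 x] is in the domain; this
    puts [x] into the range of [J 1]. *)
Lemma hy_generator : op_eq (generator U) (op_opp T).
Proof.
assert (Fwd : forall x y, T x y -> forall eps, 0 < eps -> exists d, 0 < d /\
  forall t, 0 < t < d -> norm (RtoC (/ t) *h (U t x -h x) -h ~h y) <= eps).
{ intros x y Txy eps He.
  destruct (dom_approx y (eps / 4)) as [y' [z' [T' L]]]; [lra |].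
  assert (P : 0 < norm z' + 1) by (pose proof (norm_nonneg z'); lra).
  exists (eps / 2 / (norm z' + 1)); split; [apply Rdiv_lt_0_compat; lra |].
  intros t [Ht Ht2].
  replace (RtoC (/ t) *h (U t x -h x) -h ~h y) with (RtoC (/ t) *h (U t x -h x +h RtoC t *h y)) by (vec; lra).
  rewrite norm_scal_R_eq, Rabs_pos_eq by (left; apply Rinv_0_lt_compat; auto).
  pose proof (hy_expand t x y ltac:(lra) Txy y' z' T') as E.
  apply Rmult_le_compat_l with (r := / t) in E; [| left; apply Rinv_0_lt_compat; auto].
  eapply Rle_trans; [apply E |].
  rewrite <- Rmult_assoc, Rinv_l, Rmult_1_l by lra.
  assert (t * norm z' <= eps / 2).
  { apply Rmult_lt_compat_r with (r := norm z' + 1) in Ht2; auto.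
    replace (eps / 2 / (norm z' + 1) * (norm z' + 1)) with (eps / 2) in Ht2 by (field; lra); nra. }
  lra. }
intros x y; rewrite op_opp_iff; unfold generator.
split.
2: { intros [u [Tu ->]]; apply at_right_vec; apply Fwd; auto. }
intros G0; pose proof (proj1 (at_right_vec (fun t => RtoC (/ t) *h (U t x -h x)) y) G0) as G.
exists (~h y); split; [| vec].
destruct (resolvent_spec 1 x) as [v [Tv Ev]]; [lra |].
assert (Comm : forall t, 0 <= t -> J 1 (U t x) = U t (J 1 x)).
{ intros t Ht; apply (hy_commute (J 1)); auto.
  - constructor; [intros; apply resolvent_plus; lra | intros; apply resolvent_scal; lra |].
    exists 1; split; [lra |]; intros z; rewrite Rmult_1_l; apply resolvent_contr; lra.
  - intros h z Hh.
    destruct (resolvent_spec 1 z) as [w [Tw Ew]]; [lra |].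
    destruct (resolvent_dom h _ _ Hh Tw) as [T1 _].
    symmetry in Ew.
    apply resolvent_eq with (J h w); [lra | auto |].
    rewrite <- resolvent_scal, <- resolvent_plus, Ew by auto; reflexivity. }
assert (E : J 1 y = ~h v).
{ apply minus_zero_eq, le_epsilon; intros eps He.
  destruct (G (eps / 2)) as [d1 [Hd1 G1]]; [lra |].
  destruct (Fwd _ _ Tv (eps / 2)) as [d2 [Hd2 G2]]; [lra |].
  set (t := Rmin d1 d2 / 2).
  assert (0 < Rmin d1 d2) by (apply Rmin_pos; auto).
  pose proof (Rmin_l d1 d2); pose proof (Rmin_r d1 d2).
  specialize (G1 t ltac:(unfold t; lra)); specialize (G2 t ltac:(unfold t; lra)).
  rewrite <- Comm in G2 by (unfold t; lra).
  pose proof (resolvent_contr 1 (RtoC (/ t) *h (U t x -h x) -h y) ltac:(lra)) as C.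
  replace (J 1 (RtoC (/ t) *h (U t x -h x) -h y)) with
    (RtoC (/ t) *h (J 1 (U t x) -h J 1 x) -h J 1 y) in C.
  2: { replace (RtoC (/ t) *h (U t x -h x) -h y) with
         (RtoC (/ t) *h (U t x +h RtoC (-1) *h x) +h RtoC (-1) *h y) by vec.
       rewrite !resolvent_plus, !resolvent_scal, !resolvent_plus, !resolvent_scal by lra; vec. }
  rewrite norm_minus_sym in C.
  pose proof (norm_tri (J 1 y) (RtoC (/ t) *h (J 1 (U t x) -h J 1 x)) (~h v)).
  lra. }
(* From [x = J 1 x + v] and [J 1 y = - v]. *)
assert (Ex : x = J 1 (x -h y)).
{ replace (x -h y) with (x +h RtoC (-1) *h y) by vec.
  rewrite resolvent_plus, resolvent_scal, E by lra.
  rewrite Ev at 1; vec. }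
destruct (resolvent_spec 1 (x -h y)) as [w [Tw Ew]]; [lra |].
rewrite <- Ex in Tw, Ew.
replace (~h y) with w; auto.
replace w with (RtoC 1 *h w) by vec.
replace (RtoC 1 *h w) with ((x +h RtoC 1 *h w) -h x) by vec; rewrite <- Ew; vec.
Qed.
End HilleYosida.
Arguments euler {H} T h n x.
Arguments euler_t {H} T t k x.
Arguments hy_semigroup {H} T t x.

(** * Uniqueness and decay of semigroups *)

Section LinearMaps.
Context {H : Hilbert} {f : H -> H} (Lf : is_linear f).
Lemma lin_plus x y : f (x +h y) = f x +h f y.
Proof. apply (linear_plus f Lf). Qed.
Lemma lin_scal (a : C) x : f (a *h x) = a *h f x.
Proof. apply (linear_scal f Lf). Qed.
Lemma lin_minus x y : f (x -h y) = f x -h f y.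
Proof.
replace (x -h y) with (x +h RtoC (-1) *h y) by vec; rewrite lin_plus, lin_scal; vec.
Qed.
Lemma lin_opp x : f (~h x) = ~h (f x).
Proof. rewrite !opp_scal; apply lin_scal. Qed.
Lemma lin_zero : f (0h : H) = 0h.
Proof. replace (0h : H) with (RtoC 0 *h (0h : H)) at 1 by vec; rewrite lin_scal; vec. Qed.
End LinearMaps.

(** * Local boundedness and differentiability of an arbitrary C0-semigroup *)

Section C0.
Context {H : Hilbert} {U : R -> H -> H} (HU : C0_semigroup U).
Implicit Types x y : H.

Lemma C0_cont_eps x eps : 0 < eps -> exists d, 0 < d /\ forall t, 0 < t < d -> norm (U t x -h x) <= eps.
Proof. exact (proj1 (at_right_vec (fun t => U t x) x) (C0_cont U HU x) eps). Qed.

(* One step of the gliding hump behind uniform boundedness. *)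
Lemma C0_hump (n : nat) x r :
  (forall d M, 0 < d -> exists t y, 0 < t < d /\ M * norm y < norm (U t y)) -> 0 < r ->
  exists x' r', 0 < r' <= r / 2 /\ norm (x' -h x) <= r / 2 /\
    exists t, 0 < t < / (INR n + 1) /\ forall z, norm (z -h x') <= r' -> INR n <= norm (U t z).
Proof.
intros N Hr; pose proof (pos_INR n) as Pn.
(* The constant is chosen so that [y], rescaled to length [r / 2], has an image of length at least
   [n + 1]. *)
destruct (N (/ (INR n + 1)) (2 * (INR n + 1) / r)) as [t [y [Ht L]]].
{ apply Rinv_0_lt_compat; lra. }
pose proof (C0_linear U HU t ltac:(lra)) as LU.
assert (Ny : 0 < norm y).
{ destruct (norm_nonneg y) as [P | P]; auto; exfalso.
  rewrite (h_norm_eq_zero y (eq_sym P)), (lin_zero LU), norm_zero_eq in L; lra. }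
set (w := RtoC (r / 2 / norm y) *h y).
assert (Q : 0 < r / 2 / norm y) by (apply Rdiv_lt_0_compat; lra).
assert (Nw : norm w = r / 2).
{ unfold w; rewrite norm_scal_R_eq, Rabs_pos_eq by lra; field; lra. }
assert (NU : INR n + 1 <= norm (U t w)).
{ unfold w; rewrite (lin_scal LU), norm_scal_R_eq, Rabs_pos_eq by lra.
  apply Rle_trans with (r / 2 / norm y * (2 * (INR n + 1) / r * norm y)).
  - right; field; lra.
  - apply Rmult_le_compat_l; lra. }
(* The images of [x + w] and [x - w] differ by twice that of [w], so at least one of them has length
   [n + 1] or more. *)
assert (Ex : exists x', norm (x' -h x) <= r / 2 /\ INR n + 1 <= norm (U t x')).
{ destruct (Rle_dec (INR n + 1) (norm (U t (x +h w)))) as [A | A].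
  - exists (x +h w); split; auto; replace (x +h w -h x) with w by vec; lra.
  - exists (x -h w); split.
    + replace (x -h w -h x) with (~h w) by vec; rewrite norm_opp_eq; lra.
    + pose proof (norm_minus_le (U t (x +h w)) (U t (x -h w))) as B.
      rewrite <- (lin_minus LU) in B.
      replace (x +h w -h (x -h w)) with (RtoC 2 *h w) in B by vec.
      rewrite (lin_scal LU), norm_scal_R_eq, Rabs_pos_eq in B by lra; lra. }
destruct Ex as [x' [D Big]].
destruct (linear_norm _ LU) as [M [PM HM]].
exists x', (Rmin (r / 2) (/ M)); split; [split |].
{ apply Rmin_pos; [lra | apply Rinv_0_lt_compat; auto]. }
{ apply Rmin_l. }
split; auto; exists t; split; auto.
intros z Hz; pose proof (norm_le_minus (U t x') (U t z)) as B.
rewrite <- (lin_minus LU), (lin_minus LU), norm_minus_sym, <- (lin_minus LU) in B.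
assert (norm (U t (z -h x')) <= 1).
{ eapply Rle_trans; [apply HM |]; pose proof (Rmin_r (r / 2) (/ M)).
  apply Rle_trans with (M * / M); [apply Rmult_le_compat_l; lra | right; field; lra]. }
lra.
Qed.

(** Otherwise humps can be placed in nested balls with radii at least halved each time. The common
    point [l] has an image of norm at least [n] at some time below 1/(n + 1), for every [n], which
    contradicts continuity of its orbit at 0. *)
Lemma C0_locally_bounded : exists d M, 0 < d /\ 1 <= M /\ forall t x, 0 <= t < d -> norm (U t x) <= M * norm x.
Proof.
apply NNPP; intros N0.
assert (N : forall d M, 0 < d -> exists t y, 0 < t < d /\ M * norm y < norm (U t y)).
{ intros d M Hd; apply NNPP; intros N1; apply N0.
  exists d, (Rmax 1 M); split; auto; split; [apply Rmax_l |].
  intros t x Ht; pose proof (norm_nonneg x).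
  pose proof (Rmax_l 1 M); pose proof (Rmax_r 1 M).
  destruct (Req_dec t 0) as [-> | Zt].
  { rewrite (C0_zero U HU); nra. }
  apply Rle_trans with (M * norm x); [| apply Rmult_le_compat_r; auto].
  apply Rnot_lt_le; intros L; apply N1; exists t, x; split; auto; lra. }
assert (St : forall p : nat * (H * R), exists q : H * R, 0 < snd (snd p) ->
  0 < snd q <= snd (snd p) / 2 /\ norm (fst q -h fst (snd p)) <= snd (snd p) / 2 /\
    exists t, 0 < t < / (INR (fst p) + 1) /\ forall z, norm (z -h fst q) <= snd q -> INR (fst p) <= norm (U t z)).
{ intros [n [x r]]; destruct (Rlt_dec 0 r) as [Hr | Hr].
  - destruct (C0_hump n x r N Hr) as [x' [r' P]]; exists (x', r'); intros _; exact P.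
  - exists (x, r); simpl; intros; lra. }
destruct (choice _ St) as [F HF].
(* Pairs of a centre and a radius. *)
set (s := fix s (k : nat) : H * R := match k with O => (0h, 1) | Datatypes.S m => F (m, s m) end).
assert (Pos : forall k, 0 < snd (s k)).
{ induction k as [| k IH]; simpl; [lra |].
  destruct (HF (k, s k) IH) as [[A _] _]; exact A. }
assert (Half : forall k, snd (s (S k)) <= snd (s k) / 2).
{ intros k; destruct (HF (k, s k) (Pos k)) as [[_ A] _]; exact A. }
assert (Mv : forall k, norm (fst (s (S k)) -h fst (s k)) <= snd (s k) / 2).
{ intros k; destruct (HF (k, s k) (Pos k)) as [_ [A _]]; exact A. }
assert (Geo : forall k, snd (s k) <= (/ 2) ^ k).
{ induction k as [| k IH]; [simpl; lra |].
  pose proof (Half k); change ((/ 2) ^ S k) with (/ 2 * (/ 2) ^ k); lra. }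
destruct (geometric_vlim (fun k => fst (s k)) 1) as [l Hl].
{ intros k; pose proof (Mv k); pose proof (Geo k); pose proof (Pos k); lra. }
assert (Near : forall k, norm (l -h fst (s k)) <= snd (s k)).
{ intros k; apply (vlim_norm_le (fun m => fst (s m) -h fst (s k))).
  { intros eps He; destruct (Hl eps He) as [K HK]; exists K; intros m Hm.
    replace (fst (s m) -h fst (s k) -h (l -h fst (s k))) with (fst (s m) -h l) by vec; auto. }
  exists k; intros m Hm; replace m with (k + (m - k))%nat by lia.
  generalize (m - k)%nat; intros j.
  (* Each move is at most half the current radius, hence at most the loss of radius, so distances
     between centres telescope. *)
  cut (norm (fst (s (k + j)%nat) -h fst (s k)) <= snd (s k) - snd (s (k + j)%nat)).
  { pose proof (Pos (k + j)%nat); lra. }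
  induction j as [| j IH].
  - rewrite Nat.add_0_r; replace (fst (s k) -h fst (s k)) with (0h : H) by vec; rewrite norm_zero_eq; lra.
  - replace (k + S j)%nat with (S (k + j)) by lia.
    pose proof (norm_tri (fst (s (S (k + j)))) (fst (s (k + j)%nat)) (fst (s k))).
    pose proof (Mv (k + j)%nat); pose proof (Half (k + j)%nat); lra. }
destruct (C0_cont_eps l 1) as [d [Hd Ld]]; [lra |].
(* The hump with index [n + 1] then occurs before time [d] and exceeds [norm l + 1]. *)
destruct (nfloor_ex (norm l + 1 + / d)) as [n [_ Hn]].
{ pose proof (norm_nonneg l); pose proof (Rinv_0_lt_compat d Hd); lra. }
destruct (HF (S n, s (S n)) (Pos (S n))) as [_ [_ [t [Ht Big]]]].
specialize (Big l (Near (S (S n)))); simpl fst in *.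
pose proof (Rinv_0_lt_compat d Hd); pose proof (norm_nonneg l).
rewrite S_INR in *.
assert (Td : t < d).
{ apply Rlt_trans with (1 := proj2 Ht); rewrite <- (Rinv_inv d).
  apply Rinv_lt_contravar; [| lra]; apply Rmult_lt_0_compat; lra. }
specialize (Ld t ltac:(lra)).
pose proof (norm_le_minus (U t l) l); lra.
Qed.

Lemma C0_bounded_upto t0 : 0 <= t0 -> exists M, 1 <= M /\ forall t x, 0 <= t <= t0 -> norm (U t x) <= M * norm x.
Proof.
intros Ht0; destruct C0_locally_bounded as [d [M [Hd [HM B]]]].
assert (P : forall n t x, 0 <= t <= INR n * (d / 2) -> norm (U t x) <= M ^ n * norm x).
{ induction n as [| n IH]; intros t x Ht.
  - simpl in Ht; replace t with 0 by lra; rewrite (C0_zero U HU); simpl; lra.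
  - rewrite S_INR in Ht; pose proof (norm_nonneg x); pose proof (pow_R1_Rle M n HM).
    assert (0 <= M ^ n * norm x) by nra.
    destruct (Rle_dec t (d / 2)) as [L | L].
    + eapply Rle_trans; [apply B; lra |]; simpl.
      apply Rmult_le_compat_r; auto; rewrite <- (Rmult_1_r M) at 1; apply Rmult_le_compat_l; lra.
    + replace t with (d / 2 + (t - d / 2)) by ring; rewrite (C0_plus U HU) by lra.
      eapply Rle_trans; [apply B; lra |]; simpl; rewrite Rmult_assoc.
      apply Rmult_le_compat_l; [lra |]; apply IH; lra. }
destruct (nfloor_ex (t0 / (d / 2))) as [n [_ Hn]].
{ apply Rmult_le_pos; auto; left; apply Rinv_0_lt_compat; lra. }
exists (M ^ S n); split; [apply pow_R1_Rle; auto |].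
intros t x Ht; apply P; split; [lra |]; rewrite S_INR.
apply Rle_trans with (t0 / (d / 2) * (d / 2)); [replace (t0 / (d / 2) * (d / 2)) with t0 by (field; lra); lra |].
apply Rmult_le_compat_r; lra.
Qed.

Lemma generator_eps x y : generator U x y -> forall eps, 0 < eps ->
  exists d, 0 < d /\ forall t, 0 < t < d -> norm (U t x -h x -h RtoC t *h y) <= eps * t.
Proof.
intros G eps He.
destruct (proj1 (at_right_vec (fun t => RtoC (/ t) *h (U t x -h x)) y) G eps He) as [d [Hd L]].
exists d; split; auto; intros t Ht; specialize (L t Ht).
replace (U t x -h x -h RtoC t *h y) with (RtoC t *h (RtoC (/ t) *h (U t x -h x) -h y)) by (vec; lra).
rewrite norm_scal_R_eq, Rabs_pos_eq by lra; rewrite Rmult_comm; apply Rmult_le_compat_r; lra.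
Qed.

Lemma generator_orbit t x y : 0 <= t -> generator U x y -> generator U (U t x) (U t y).
Proof.
intros Ht G; apply (proj2 (at_right_vec (fun h => RtoC (/ h) *h (U h (U t x) -h U t x)) (U t y))).
intros eps He; pose proof (C0_linear U HU t Ht) as LU.
destruct (linear_norm _ LU) as [M [PM HM]].
destruct (proj1 (at_right_vec (fun t => RtoC (/ t) *h (U t x -h x)) y) G (eps / M)) as [d [Hd L]].
{ apply Rdiv_lt_0_compat; auto. }
exists d; split; auto; intros h Hh; specialize (L h Hh).
rewrite <- (C0_plus U HU), Rplus_comm, (C0_plus U HU), <- (lin_minus LU), <- (lin_scal LU), <- (lin_minus LU) by lra.
eapply Rle_trans; [apply HM |].
apply Rmult_le_compat_l with (r := M) in L; [| lra].
replace (M * (eps / M)) with eps in L by (field; lra); exact L.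
Qed.

Definition vder (u : R -> H) (t : R) (d : H) : Prop :=
  forall eps, 0 < eps -> exists r, 0 < r /\
    forall h, Rabs h < r -> norm (u (t + h) -h u t -h RtoC h *h d) <= eps * Rabs h.

(** The right derivative is immediate. For the left one, [U t] is written as [U (t - k)] after
    [U k], and the factor [U (t - k)] varies with [k]; the uniform bound on [[0, t]] controls it. *)
Lemma orbit_vder t x y : 0 < t -> generator U x y -> vder (fun r => U r x) t (U t y).
Proof.
intros Ht G eps He.
destruct (C0_bounded_upto t) as [M [HM B]]; [lra |].
assert (PM : 0 < eps / (2 * M)) by (apply Rdiv_lt_0_compat; lra).
destruct (generator_eps x y G (eps / (2 * M)) PM) as [d1 [Hd1 L1]].
destruct (C0_cont_eps y (eps / (2 * M)) PM) as [d2 [Hd2 L2]].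
exists (Rmin t (Rmin d1 d2)); split; [repeat apply Rmin_pos; auto |].
intros h Hh.
pose proof (Rmin_l t (Rmin d1 d2)); pose proof (Rmin_r t (Rmin d1 d2)).
pose proof (Rmin_l d1 d2); pose proof (Rmin_r d1 d2).
assert (Em : M * (eps / (2 * M)) = eps / 2) by (field; lra).
destruct (Rtotal_order h 0) as [N | [-> | P]].
- rewrite (Rabs_left h) in * by auto.
  set (k := - h) in *; replace h with (- k) by (unfold k; ring); assert (0 < k) by (unfold k; lra).
  specialize (L1 k ltac:(lra)); specialize (L2 k ltac:(lra)).
  pose proof (C0_linear U HU (t + - k) ltac:(lra)) as LU.
  replace (U t x) with (U (t + - k) (U k x)) by (rewrite <- (C0_plus U HU) by lra; f_equal; ring).
  replace (U t y) with (U (t + - k) (U k y)) by (rewrite <- (C0_plus U HU) by lra; f_equal; ring).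
  replace (U (t + - k) x -h U (t + - k) (U k x) -h RtoC (- k) *h U (t + - k) (U k y))
    with (RtoC k *h U (t + - k) (U k y -h y) -h U (t + - k) (U k x -h x -h RtoC k *h y)).
  2: { rewrite !(lin_minus LU), (lin_scal LU); vec. }
  eapply Rle_trans; [apply norm_minus_le |].
  rewrite norm_scal_R_eq, Rabs_pos_eq by lra.
  pose proof (B (t + - k) (U k y -h y) ltac:(lra)) as B1.
  pose proof (B (t + - k) (U k x -h x -h RtoC k *h y) ltac:(lra)) as B2.
  assert (M * norm (U k y -h y) <= eps / 2) by (rewrite <- Em; apply Rmult_le_compat_l; lra).
  assert (M * norm (U k x -h x -h RtoC k *h y) <= eps / 2 * k).
  { rewrite <- Em, Rmult_assoc; apply Rmult_le_compat_l; lra. }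
  assert (k * norm (U (t + - k) (U k y -h y)) <= k * (eps / 2)) by (apply Rmult_le_compat_l; lra).
  lra.
- rewrite Rplus_0_r, Rabs_R0; replace (U t x -h U t x -h RtoC 0 *h U t y) with (0h : H) by vec.
  rewrite norm_zero_eq; lra.
- rewrite (Rabs_pos_eq h) in * by lra.
  specialize (L1 h ltac:(lra)); pose proof (C0_linear U HU t ltac:(lra)) as LU.
  rewrite (C0_plus U HU), <- (lin_minus LU), <- (lin_scal LU), <- (lin_minus LU) by lra.
  eapply Rle_trans; [apply B; lra |].
  apply Rle_trans with (M * (eps / (2 * M) * h)); [apply Rmult_le_compat_l; lra |].
  rewrite <- Rmult_assoc, Em; nra.
Qed.
End C0.

(** * Energy estimates, decay and uniqueness *)

Section Energy.
Context {H : Hilbert}.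
Implicit Types x y : H.

Lemma vder_minus (u v : R -> H) t a b : vder u t a -> vder v t b -> vder (fun r => u r -h v r) t (a -h b).
Proof.
intros A B eps He; destruct (A (eps / 2)) as [r1 [P1 L1]]; [lra |]; destruct (B (eps / 2)) as [r2 [P2 L2]]; [lra |].
exists (Rmin r1 r2); split; [apply Rmin_pos; auto |]; intros h Hh.
pose proof (Rmin_l r1 r2); pose proof (Rmin_r r1 r2).
specialize (L1 h ltac:(lra)); specialize (L2 h ltac:(lra)).
replace (u (t + h) -h v (t + h) -h (u t -h v t) -h RtoC h *h (a -h b))
  with ((u (t + h) -h u t -h RtoC h *h a) -h (v (t + h) -h v t -h RtoC h *h b)) by vec.
eapply Rle_trans; [apply norm_minus_le |]; lra.
Qed.

Lemma is_derive_eps (f : R -> R) t l :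
  (forall eps, 0 < eps -> exists r, 0 < r /\ forall h, Rabs h < r -> Rabs (f (t + h) - f t - h * l) <= eps * Rabs h) ->
  is_derive f t l.
Proof.
intros E; apply is_derive_Reals; intros eps He.
destruct (E (eps / 2)) as [r [Hr L]]; [lra |].
exists (mkposreal r Hr); simpl; intros h Hh Lh; specialize (L h Lh).
replace ((f (t + h) - f t) / h - l) with ((f (t + h) - f t - h * l) / h) by (field; auto).
rewrite Rabs_div by auto; pose proof (Rabs_pos_lt h Hh).
apply Rmult_lt_reg_r with (Rabs h); auto.
unfold Rdiv; rewrite Rmult_assoc, Rinv_l by lra; nra.
Qed.

Lemma vder_rip (u : R -> H) t d y : vder u t d -> is_derive (fun r => rip (u r) y) t (rip d y).
Proof.
intros V; apply is_derive_eps; intros eps He.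
assert (P : 0 < norm y + 1) by (pose proof (norm_nonneg y); lra).
destruct (V (eps / (norm y + 1))) as [r [Hr L]]; [apply Rdiv_lt_0_compat; auto |].
exists r; split; auto; intros h Hh; specialize (L h Hh).
replace (rip (u (t + h)) y - rip (u t) y - h * rip d y) with (rip (u (t + h) -h u t -h RtoC h *h d) y)
  by (rewrite !rip_minus_l, rip_scal_l; ring).
eapply Rle_trans; [apply rip_abs_le |].
pose proof (norm_nonneg y); pose proof (Rabs_pos h).
apply Rle_trans with (eps / (norm y + 1) * Rabs h * (norm y + 1)).
- apply Rmult_le_compat; auto using norm_nonneg; lra.
- right; field; lra.
Qed.

Lemma vder_norm_sq (u : R -> H) t d : vder u t d -> is_derive (fun r => norm (u r) ^ 2) t (2 * rip d (u t)).
Proof.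
intros V; apply is_derive_eps; intros eps He.
set (a := norm (u t)); set (b := norm d).
assert (Pa : 0 <= a) by apply norm_nonneg; assert (Pb : 0 <= b) by apply norm_nonneg.
set (e := Rmin 1 (eps / (4 * (a + 1)))).
assert (He1 : 0 < e) by (apply Rmin_pos; [lra | apply Rdiv_lt_0_compat; lra]).
assert (e <= 1) by apply Rmin_l.
assert (Hea : e * (4 * (a + 1)) <= eps).
{ pose proof (Rmin_r 1 (eps / (4 * (a + 1)))) as R; fold e in R.
  apply Rmult_le_compat_r with (r := 4 * (a + 1)) in R; [| lra].
  replace (eps / (4 * (a + 1)) * (4 * (a + 1))) with eps in R by (field; lra); lra. }
destruct (V e He1) as [r [Hr L]].
set (s := eps / (2 * (b + 1) ^ 2)).
assert (Hs : 0 < s) by (apply Rdiv_lt_0_compat; nra).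
exists (Rmin r s); split; [apply Rmin_pos; auto |]; intros h Hh.
pose proof (Rmin_l r s); pose proof (Rmin_r r s).
specialize (L h ltac:(lra)).
set (w := u (t + h) -h u t -h RtoC h *h d) in *.
replace (u (t + h)) with (u t +h (RtoC h *h d +h w)) by (unfold w; vec).
rewrite norm_sq_plus, rip_plus_r, rip_scal_r, (rip_sym (u t) d).
match goal with |- Rabs ?X <= _ => replace X with (2 * rip (u t) w + norm (RtoC h *h d +h w) ^ 2) by (unfold a; ring) end.
assert (N1 : norm (RtoC h *h d +h w) <= Rabs h * (b + 1)).
{ eapply Rle_trans; [apply h_triangle |]; rewrite norm_scal_R_eq; fold b.
  pose proof (Rabs_pos h); nra. }
pose proof (rip_abs_le (u t) w) as N2; fold a in N2.
pose proof (Rabs_pos h) as Ph.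
eapply Rle_trans; [apply Rabs_triang |].
rewrite Rabs_mult, (Rabs_pos_eq 2), (Rabs_pos_eq (norm _ ^ 2)) by (try lra; apply pow2_ge_0).
assert (Q1 : 2 * Rabs (rip (u t) w) <= eps / 2 * Rabs h).
{ apply Rle_trans with (2 * (a * (e * Rabs h))); [apply Rmult_le_compat_l; [lra |]; eapply Rle_trans; [apply N2 |]; apply Rmult_le_compat_l; auto |].
  replace (2 * (a * (e * Rabs h))) with (e * (2 * a) * Rabs h) by ring.
  apply Rmult_le_compat_r; nra. }
assert (Q2 : norm (RtoC h *h d +h w) ^ 2 <= eps / 2 * Rabs h).
{ apply Rle_trans with ((Rabs h * (b + 1)) ^ 2); [apply pow_incr; split; auto using norm_nonneg |].
  replace ((Rabs h * (b + 1)) ^ 2) with (Rabs h * (b + 1) ^ 2 * Rabs h) by ring.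
  apply Rmult_le_compat_r; auto.
  apply Rle_trans with (s * (b + 1) ^ 2); [apply Rmult_le_compat_r; nra |].
  unfold s; right; field; lra. }
lra.
Qed.

Lemma nonincreasing_of_derive (f df : R -> R) :
  (forall t, 0 < t -> is_derive f t (df t) /\ df t <= 0) -> forall a b, 0 < a <= b -> f b <= f a.
Proof.
intros D a b Hab; destruct (MVT_gen f a b df) as [c [Hc E]].
- rewrite Rmin_left, Rmax_right by lra; intros x Hx; apply D; lra.
- rewrite Rmin_left, Rmax_right by lra; intros x Hx.
  apply continuity_pt_filterlim; apply @ex_derive_continuous; exists (df x); apply D; lra.
- rewrite Rmin_left, Rmax_right in Hc by lra.
  assert (df c <= 0) by (apply D; lra); nra.
Qed.

(** The function [exp (2 s t) * norm (u t) ^ 2] is nonincreasing for positive times; the initial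
    value is then reached by letting the left endpoint tend to 0, where only continuity of [u] is
    assumed. *)
Lemma energy_bound (u d : R -> H) (u0 : H) (s : R) : 0 <= s ->
  (forall t, 0 < t -> vder u t (~h (d t)) /\ s * norm (u t) ^ 2 <= rip (d t) (u t)) ->
  (forall eps, 0 < eps -> exists r, 0 < r /\ forall t, 0 < t < r -> norm (u t -h u0) <= eps) ->
  forall t, 0 < t -> norm (u t) <= exp (- (s * t)) * norm u0.
Proof.
intros Hs D L t Ht.
assert (Mono : forall a b, 0 < a <= b -> exp (2 * s * b) * norm (u b) ^ 2 <= exp (2 * s * a) * norm (u a) ^ 2).
{ apply (nonincreasing_of_derive (fun r => exp (2 * s * r) * norm (u r) ^ 2)
    (fun r => 2 * s * exp (2 * s * r) * norm (u r) ^ 2 + exp (2 * s * r) * (2 * rip (~h (d r)) (u r)))).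
  intros r Hr; destruct (D r Hr) as [V P]; split.
  - apply (is_derive_mult (fun r => exp (2 * s * r)) (fun r => norm (u r) ^ 2)).
    + auto_derive; auto; ring.
    + apply vder_norm_sq; auto.
    + intros; apply Rmult_comm.
  - rewrite rip_opp_l; pose proof (exp_pos (2 * s * r)).
    replace (2 * s * exp (2 * s * r) * norm (u r) ^ 2 + exp (2 * s * r) * (2 * - rip (d r) (u r)))
      with (2 * exp (2 * s * r) * (s * norm (u r) ^ 2 - rip (d r) (u r))) by ring.
    assert (0 <= exp (2 * s * r) * (rip (d r) (u r) - s * norm (u r) ^ 2)) by (apply Rmult_le_pos; lra).
    lra. }
assert (Mono' : forall a, 0 < a <= t -> exp (s * t) * norm (u t) <= exp (s * a) * norm (u a)).
{ intros a Ha; specialize (Mono a t Ha).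
  assert (Sq : forall r, exp (2 * s * r) = exp (s * r) ^ 2).
  { intros r; simpl; rewrite Rmult_1_r, <- exp_plus; f_equal; ring. }
  rewrite !Sq, <- !Rpow_mult_distr in Mono; apply sq_le_le; auto.
  apply Rmult_le_pos; [left; apply exp_pos | apply norm_nonneg]. }
assert (Q : exp (s * t) * norm (u t) <= norm u0).
{ apply le_epsilon; intros eps He.
  set (K := norm u0 + 1); assert (PK : 0 < K) by (unfold K; pose proof (norm_nonneg u0); lra).
  assert (Cexp : exists r, 0 < r /\ forall a, 0 < a < r -> exp (s * a) <= 1 + Rmin 1 (eps / (2 * K))).
  { assert (C : continuity_pt (fun a => exp (s * a)) 0).
    { apply continuity_pt_filterlim, (@ex_derive_continuous R_AbsRing R_NormedModule (fun a => exp (s * a)) 0); auto_derive; auto. }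
    assert (Pm : 0 < Rmin 1 (eps / (2 * K))) by (apply Rmin_pos; [lra | apply Rdiv_lt_0_compat; lra]).
    destruct (C _ Pm) as [r [Hr Cr]]; exists r; split; auto; intros a Ha.
    specialize (Cr a); simpl in Cr; unfold R_dist, D_x, no_cond in Cr.
    rewrite Rmult_0_r, exp_0, Rminus_0_r in Cr.
    assert (A : Rabs (exp (s * a) - 1) < Rmin 1 (eps / (2 * K))).
    { apply Cr; split; [split; auto; lra | rewrite Rabs_pos_eq; lra]. }
    apply Rabs_def2 in A; lra. }
  destruct Cexp as [r1 [Hr1 E1]].
  destruct (L (Rmin 1 (eps / 4))) as [r2 [Hr2 E2]]; [apply Rmin_pos; lra |].
  set (a := Rmin t (Rmin r1 r2) / 2).
  assert (0 < Rmin t (Rmin r1 r2)) by (repeat apply Rmin_pos; auto).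
  pose proof (Rmin_l t (Rmin r1 r2)); pose proof (Rmin_r t (Rmin r1 r2)).
  pose proof (Rmin_l r1 r2); pose proof (Rmin_r r1 r2).
  specialize (E1 a ltac:(unfold a; lra)); specialize (E2 a ltac:(unfold a; lra)).
  pose proof (Mono' a ltac:(unfold a; lra)).
  pose proof (norm_le_minus (u a) u0).
  set (m := Rmin 1 (eps / (2 * K))) in *.
  assert (m <= 1) by apply Rmin_l.
  assert (Hm : m * K <= eps / 2).
  { pose proof (Rmin_r 1 (eps / (2 * K))) as R; fold m in R.
    apply Rmult_le_compat_r with (r := K) in R; [| lra].
    replace (eps / (2 * K) * K) with (eps / 2) in R by (field; lra); lra. }
  pose proof (Rmin_l 1 (eps / 4)); pose proof (Rmin_r 1 (eps / 4)).
  pose proof (exp_pos (s * a)); pose proof (norm_nonneg (u a)); pose proof (norm_nonneg u0).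
  assert (exp (s * a) * norm (u a) <= (1 + m) * (norm u0 + Rmin 1 (eps / 4))) by (apply Rmult_le_compat; lra).
  assert (0 < m) by (apply Rmin_pos; [lra | apply Rdiv_lt_0_compat; lra]).
  unfold K in *; nra. }
rewrite exp_Ropp; apply Rmult_le_reg_l with (exp (s * t)); [apply exp_pos |].
rewrite <- Rmult_assoc, Rinv_r; [lra |]; apply Rgt_not_eq, exp_pos.
Qed.

Definition strongly_accretive (s : R) (T : op H) : Prop :=
  linear_op T /\ densely_defined T /\ forall x y, T x y -> s * norm x ^ 2 <= rip y x.

Section Dissipative.
Context {U : R -> H -> H} {T : op H} {s : R}.
Hypotheses (HU : C0_semigroup U) (HG : op_eq (generator U) (op_opp T)) (HT : strongly_accretive s T) (Hs : 0 <= s).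

Lemma generator_iff x y : T x y <-> generator U x (~h y).
Proof.
rewrite (HG x (~h y)), op_opp_iff; split.
- intros Txy; exists y; auto.
- intros [u [Tu E]]; replace y with u; auto.
  replace y with (~h (~h y)) by vec; rewrite E; vec.
Qed.

Lemma orbit_dom t x y : 0 <= t -> T x y -> T (U t x) (U t y).
Proof.
intros Ht; rewrite !generator_iff; intros G; rewrite <- (lin_opp (C0_linear U HU t Ht)).
apply generator_orbit; auto.
Qed.

Lemma orbit_derive t x y : 0 < t -> T x y -> vder (fun r => U r x) t (~h (U t y)).
Proof.
intros Ht; rewrite generator_iff; intros G; rewrite <- (lin_opp (C0_linear U HU t ltac:(lra))).
apply orbit_vder; auto.
Qed.

(** Holds for any semigroup with this generator, not just the one built above. The energy estimate
    applies to orbits of domain vectors; at fixed [t], boundedness of [U t] extends it to the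
    closure. *)
Lemma semigroup_decay t x : 0 <= t -> norm (U t x) <= exp (- (s * t)) * norm x.
Proof.
intros Ht; destruct (Req_dec t 0) as [-> | Nt].
{ rewrite (C0_zero U HU), Rmult_0_r, Ropp_0, exp_0; lra. }
destruct HT as [_ [Dn Ac]].
apply le_epsilon; intros eps He.
destruct (C0_linear U HU t Ht) as [_ _ [M [PM HM]]].
pose proof (exp_pos (- (s * t))) as Pe.
set (e := exp (- (s * t))) in *.
assert (Pd : 0 < eps / (M + e)) by (apply Rdiv_lt_0_compat; lra).
destruct (Dn x (mkposreal _ Pd)) as [x' [[y' Ty] L]]; simpl in L.
assert (B : norm (U t x') <= e * norm x').
{ apply (energy_bound (fun r => U r x') (fun r => U r y') x' s Hs); [| | lra].
  - intros r Hr; split; [apply orbit_derive; auto |].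
    apply Ac, orbit_dom; auto; lra.
  - intros ep Hep; apply C0_cont_eps; auto. }
pose proof (norm_le_minus (U t x) (U t x')) as A1; rewrite <- (lin_minus (C0_linear U HU t Ht)) in A1.
pose proof (norm_le_minus x' x) as A2; rewrite norm_minus_sym in A2.
pose proof (HM (x -h x')) as A3.
change (norm (minus x x')) with (norm (x -h x')) in L.
assert (M * norm (x -h x') + e * norm (x -h x') <= eps).
{ rewrite <- Rmult_plus_distr_r; apply Rmult_lt_compat_l with (r := M + e) in L; [| lra].
  replace ((M + e) * (eps / (M + e))) with eps in L by (field; lra); lra. }
assert (e * norm x' <= e * (norm x + norm (x -h x'))) by (apply Rmult_le_compat_l; lra).
lra.
Qed.
End Dissipative.

(** The difference of two orbits from the same domain vector satisfies the energy estimate with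
    initial value 0. This is what makes the semigroup quantified inside [neg_pow] irrelevant to its
    value. *)
Lemma semigroup_unique (U V : R -> H -> H) (T : op H) : strongly_accretive 0 T ->
  C0_semigroup U -> op_eq (generator U) (op_opp T) ->
  C0_semigroup V -> op_eq (generator V) (op_opp T) ->
  forall t x, 0 <= t -> U t x = V t x.
Proof.
intros HT HU GU HV GV t x Ht; destruct (Req_dec t 0) as [-> | Nt].
{ rewrite (C0_zero U HU), (C0_zero V HV); auto. }
apply minus_zero_eq, le_epsilon; intros eps He.
pose proof (fun t x => semigroup_decay HU GU HT (Rle_refl 0) t x) as DU.
pose proof (fun t x => semigroup_decay HV GV HT (Rle_refl 0) t x) as DV.
pose proof (C0_linear U HU t Ht) as LU; pose proof (C0_linear V HV t Ht) as LV.
destruct HT as [Li [Dn Ac]].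
destruct (Dn x (mkposreal (eps / 2) ltac:(lra))) as [x' [[y' Ty] L]]; simpl in L.
change (norm (minus x x')) with (norm (x -h x')) in L.
assert (B : U t x' = V t x').
{ apply minus_zero_eq.
  pose proof (energy_bound (fun r => U r x' -h V r x') (fun r => U r y' -h V r y') 0h 0 (Rle_refl 0)) as E.
  rewrite norm_zero_eq in E; eapply Rle_trans; [apply (E); [| | lra] | rewrite Rmult_0_r; apply Rle_refl].
  - intros r Hr; split.
    + replace (~h (U r y' -h V r y')) with (~h (U r y') -h ~h (V r y')) by vec.
      apply vder_minus.
      * apply (orbit_derive (T := T) HU GU); auto.
      * apply (orbit_derive (T := T) HV GV); auto.
    + apply Ac, (lop_minus Li); [apply (orbit_dom HU GU) | apply (orbit_dom HV GV)]; auto; lra.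
  - intros ep Hep.
    destruct (C0_cont_eps HU x' (ep / 2)) as [d1 [Hd1 E1]]; [lra |].
    destruct (C0_cont_eps HV x' (ep / 2)) as [d2 [Hd2 E2]]; [lra |].
    exists (Rmin d1 d2); split; [apply Rmin_pos; auto |]; intros r Hr.
    pose proof (Rmin_l d1 d2); pose proof (Rmin_r d1 d2).
    specialize (E1 r ltac:(lra)); specialize (E2 r ltac:(lra)).
    replace (U r x' -h V r x' -h 0h) with ((U r x' -h x') -h (V r x' -h x')) by vec.
    eapply Rle_trans; [apply norm_minus_le |]; lra. }
replace (U t x -h V t x) with (U t (x -h x') -h V t (x -h x')).
2: { rewrite (lin_minus LU), (lin_minus LV), B; vec. }
eapply Rle_trans; [apply norm_minus_le |].
pose proof (DU t (x -h x') Ht) as A1; pose proof (DV t (x -h x') Ht) as A2.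
rewrite Rmult_0_l, Ropp_0, exp_0, Rmult_1_l in A1, A2; lra.
Qed.
End Energy.

(** * Improper integrals over the half-line *)

(** From ln v <= v at v = k u / p; the constant is (p / k)^p. *)
Lemma Rpower_exp_bound p k : 0 < p -> 0 < k ->
  exists C, 0 < C /\ forall u, 0 < u -> Rpower u p * exp (- (k * u)) <= C.
Proof.
intros Hp Hk; exists (exp (p * ln (p / k))); split; [apply exp_pos |].
intros u Hu; unfold Rpower; rewrite <- exp_plus.
assert (L : ln (u * (k / p)) <= u * (k / p)).
{ pose proof (exp_ineq1_le (ln (u * (k / p)))) as E.
  rewrite exp_ln in E; [lra |]; apply Rmult_lt_0_compat; auto; apply Rdiv_lt_0_compat; auto. }
rewrite ln_mult in L; auto; [| apply Rdiv_lt_0_compat; auto].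
rewrite !ln_div in * by auto.
apply Rmult_le_compat_l with (r := p) in L; [| lra].
replace (p * (u * (k / p))) with (k * u) in L by (field; lra).
assert (M : p * ln u + - (k * u) <= p * (ln p - ln k)) by lra.
destruct M as [M | M]; [left; apply exp_increasing; auto | right; rewrite M; auto].
Qed.

Lemma Rpower_pos x y : 0 < Rpower x y.
Proof. apply exp_pos. Qed.

Lemma Rpower_S x b : 0 < x -> Rpower x b = Rpower x (b - 1) * x.
Proof.
intros Hx; replace b with (b - 1 + 1) at 1 by ring; rewrite Rpower_plus, Rpower_1; auto.
Qed.

Definition gkernel (b s t : R) : R := Rpower t (b - 1) * exp (- (s * t)).

Lemma gkernel_pos b s t : 0 < gkernel b s t.
Proof. apply Rmult_lt_0_compat; [apply Rpower_pos | apply exp_pos]. Qed.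

Lemma gkernel_S b s t : 0 < t -> gkernel (b + 1) s t = t * gkernel b s t.
Proof.
intros Ht; unfold gkernel; replace (b + 1 - 1) with b by ring; rewrite (Rpower_S t b) by auto; ring.
Qed.

(* A majorant of the Gamma kernel with an elementary antiderivative. *)
Definition maj (b t : R) : R := Rpower t (b - 1) / (1 + Rpower t b) ^ 2.
Definition maj_prim (b t : R) : R := - / (b * (1 + Rpower t b)).

(** The exponential dominates (1 + t^b)^2, which is at most 2 + 2 t^(2b). *)
Lemma maj_bound b s : 0 < b -> 0 < s -> exists C, 0 < C /\ forall t, 0 < t -> gkernel b s t <= C * maj b t.
Proof.
intros Hb Hs; destruct (Rpower_exp_bound (2 * b) s) as [C [HC B]]; [lra | auto |].
exists (2 + 2 * C); split; [lra |]; intros t Ht; unfold gkernel, maj.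
pose proof (Rpower_pos t (b - 1)) as P1; pose proof (Rpower_pos t b) as P2.
assert (Q : exp (- (s * t)) * (1 + Rpower t b) ^ 2 <= 2 + 2 * C).
{ pose proof (B t Ht) as B1.
  replace (Rpower t (2 * b)) with (Rpower t b ^ 2) in B1
    by (simpl; rewrite Rmult_1_r, <- Rpower_plus; f_equal; ring).
  pose proof (exp_pos (- (s * t))) as P3.
  assert (P4 : exp (- (s * t)) <= 1).
  { rewrite <- exp_0; left; apply exp_increasing; nra. }
  assert (exp (- (s * t)) * (1 + Rpower t b) ^ 2 <= exp (- (s * t)) * (2 + 2 * Rpower t b ^ 2)).
  { apply Rmult_le_compat_l; [lra |]; pose proof (pow2_ge_0 (1 - Rpower t b)); lra. }
  lra. }
assert (P5 : 0 < (1 + Rpower t b) ^ 2) by (apply pow_lt; lra).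
apply Rmult_le_reg_r with ((1 + Rpower t b) ^ 2); auto.
replace ((2 + 2 * C) * (Rpower t (b - 1) / (1 + Rpower t b) ^ 2) * (1 + Rpower t b) ^ 2)
  with (Rpower t (b - 1) * (2 + 2 * C)) by (field; lra).
rewrite Rmult_assoc; apply Rmult_le_compat_l; lra.
Qed.

Lemma is_derive_Rpower t b : 0 < t -> is_derive (fun t => Rpower t b) t (b * Rpower t (b - 1)).
Proof. intros Ht; apply is_derive_Reals, derivable_pt_lim_power; auto. Qed.

Lemma maj_derive b t : 0 < b -> 0 < t -> is_derive (maj_prim b) t (maj b t).
Proof.
intros Hb Ht; unfold maj_prim, maj; pose proof (Rpower_pos t b) as P.
pose proof (is_derive_Rpower t b Ht) as D.
assert (E : is_derive (fun u => - / (b * (1 + u))) (Rpower t b) (/ (b * (1 + Rpower t b) ^ 2))).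
{ auto_derive; [nra | field; split; lra]. }
pose proof (is_derive_comp (fun u => - / (b * (1 + u))) (fun t => Rpower t b) t _ _ E D) as K.
replace (Rpower t (b - 1) / (1 + Rpower t b) ^ 2) with (scal (b * Rpower t (b - 1)) (/ (b * (1 + Rpower t b) ^ 2))); auto.
unfold scal; simpl; unfold mult; simpl; field; split; lra.
Qed.

Lemma Rpower_continuous t b : 0 < t -> continuous (fun t => Rpower t b) t.
Proof. intros Ht; apply (@ex_derive_continuous R_AbsRing R_NormedModule); exists (b * Rpower t (b - 1)); apply is_derive_Rpower; auto. Qed.

Lemma maj_continuous b t : 0 < b -> 0 < t -> continuous (maj b) t.
Proof.
intros Hb Ht; unfold maj; pose proof (Rpower_pos t b) as P.
apply (@ex_derive_continuous R_AbsRing R_NormedModule); unfold Rpower; auto_derive.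
unfold Rpower in P; repeat split; auto; nra.
Qed.

Lemma at_right_0_iff (P : R -> Prop) : at_right 0 P <-> exists d, 0 < d /\ forall t, 0 < t < d -> P t.
Proof.
split.
- intros [d Hd]; exists d; split; [apply cond_pos |]; intros t Ht; apply Hd; [| lra].
  change (Rabs (t - 0) < d); rewrite Rminus_0_r, Rabs_pos_eq; lra.
- intros [d [Hd L]]; exists (mkposreal d Hd); intros t Ht Pt.
  change (Rabs (t - 0) < d) in Ht; rewrite Rminus_0_r, Rabs_pos_eq in Ht by lra; apply L; lra.
Qed.

Lemma Rpower_lim_0 b eps : 0 < b -> 0 < eps -> exists d, 0 < d /\ forall t, 0 < t < d -> Rpower t b < eps.
Proof.
intros Hb He; exists (Rpower eps (/ b)); split; [apply Rpower_pos |]; intros t Ht.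
apply Rlt_le_trans with (Rpower (Rpower eps (/ b)) b).
- apply Rlt_Rpower_l; lra.
- rewrite Rpower_mult, Rinv_l, Rpower_1 by lra; lra.
Qed.

Lemma Rpower_lim_infty b K : 0 < b -> 0 < K -> exists M, 0 < M /\ forall t, M < t -> K < Rpower t b.
Proof.
intros Hb HK; exists (Rpower K (/ b)); split; [apply Rpower_pos |]; intros t Ht.
pose proof (Rpower_pos K (/ b)).
apply Rle_lt_trans with (Rpower (Rpower K (/ b)) b).
- rewrite Rpower_mult, Rinv_l, Rpower_1 by lra; lra.
- apply Rlt_Rpower_l; lra.
Qed.

Local Notation improper_filter := (filter_prod (at_right 0) (Rbar_locally p_infty)).

Lemma improper_filter_intro (P : R * R -> Prop) (d M : R) : 0 < d ->
  (forall a b, 0 < a < d -> M < b -> P (a, b)) -> improper_filter P.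
Proof.
intros Hd L; apply Filter_prod with (fun a => 0 < a < d) (fun b => M < b).
- apply at_right_0_iff; exists d; auto.
- exists M; auto.
- auto.
Qed.

Lemma minus_middle (G : AbelianGroup) (p l q : G) : minus (plus p (plus l q)) l = plus p q.
Proof.
etransitivity.
- apply (f_equal (fun z => plus z (opp l))); etransitivity; [apply (f_equal (plus p)), plus_comm | apply plus_assoc].
- etransitivity; [symmetry; apply plus_assoc |].
  etransitivity; [apply (f_equal (plus (plus p q))), plus_opp_r | apply plus_zero_r].
Qed.

(** * Convergence of dominated vector-valued integrals *)

Section ImproperVector.
Context {V : CompleteNormedModule R_AbsRing}.
Variables (f : R -> V) (b K : R).
Hypotheses (Hb : 0 < b) (HK : 0 <= K).
Hypothesis f_cont : forall t, 0 < t -> continuous f t.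
Hypothesis f_bound : forall t, 0 < t -> norm (f t) <= K * maj b t.

Lemma dominated_RInt_bound x y l : 0 < x -> 0 < y -> is_RInt f x y l ->
  norm l <= K * Rabs (maj_prim b y - maj_prim b x).
Proof.
assert (Main : forall x y l, 0 < x <= y -> is_RInt f x y l -> norm l <= K * (maj_prim b y - maj_prim b x)).
{ intros x0 y0 l0 Hxy I.
  apply (norm_RInt_le f (fun t => K * maj b t) x0 y0 l0); [lra | intros; apply f_bound; lra | auto |].
  apply (is_RInt_scal (V := R_NormedModule) (maj b) x0 y0 K).
  apply (is_RInt_derive (V := R_CompleteNormedModule) (maj_prim b) (maj b)).
  - rewrite Rmin_left, Rmax_right by lra; intros; apply maj_derive; lra.
  - rewrite Rmin_left, Rmax_right by lra; intros; apply maj_continuous; lra. }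
intros Hx Hy I; destruct (Rle_dec x y) as [L | L].
- eapply Rle_trans; [apply (Main x y); auto |]; apply Rmult_le_compat_l; auto; apply Rle_abs.
- rewrite <- norm_opp; eapply Rle_trans; [apply (Main y x); [lra | apply is_RInt_swap; auto] |].
  apply Rmult_le_compat_l; auto; rewrite Rabs_minus_sym; apply Rle_abs.
Qed.

Lemma dominated_ex_RInt x y : 0 < x -> 0 < y -> ex_RInt f x y.
Proof.
intros Hx Hy; apply ex_RInt_continuous; intros z [Hz _]; apply f_cont.
apply Rlt_le_trans with (2 := Hz); apply Rmin_pos; auto.
Qed.

(** Cauchy criterion: integrals over two intervals differ by two end pieces, each bounded by an
    increment of [maj_prim], which tends to [- / b] at 0 and to 0 at infinity. *)
Lemma dominated_improper : exists l, is_RInt_gen f (at_right 0) (Rbar_locally p_infty) l.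
Proof.
apply (filterlimi_locally_cauchy (U := V)).
{ apply improper_filter_intro with 1 1; [lra |]; simpl; intros x y Hx Hy; split.
  - apply dominated_ex_RInt; lra.
  - intros u v Hu Hv; rewrite <- (is_RInt_unique _ _ _ _ Hu); apply is_RInt_unique; auto. }
intros eps.
(* Each end piece contributes at most [2 * K * e], so the total stays below [eps]. *)
set (e := eps / (8 * (K + 1))).
assert (He : 0 < e) by (apply Rdiv_lt_0_compat; [apply cond_pos | lra]).
assert (HeK : 4 * (K * e) < eps).
{ assert (e * (8 * (K + 1)) = eps) by (unfold e; field; lra). nra. }
destruct (Rpower_lim_0 b (b * e) Hb) as [d [Hd L0]]; [nra |].
destruct (Rpower_lim_infty b (/ (b * e)) Hb) as [M [HM L1]]; [apply Rinv_0_lt_compat; nra |].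
assert (G0 : forall t, 0 < t < d -> Rabs (maj_prim b t - - / b) <= e).
{ intros t Ht; specialize (L0 t Ht); unfold maj_prim; pose proof (Rpower_pos t b) as P.
  replace (- / (b * (1 + Rpower t b)) - - / b) with (Rpower t b / (b * (1 + Rpower t b))) by (field; split; lra).
  rewrite Rabs_pos_eq by (left; apply Rdiv_lt_0_compat; nra).
  apply Rmult_le_reg_r with (b * (1 + Rpower t b)); [nra |].
  unfold Rdiv; rewrite Rmult_assoc, Rinv_l by nra.
  assert (0 <= b * e) by nra; nra. }
assert (G1 : forall t, M < t -> Rabs (maj_prim b t) <= e).
{ intros t Ht; specialize (L1 t Ht); unfold maj_prim; pose proof (Rpower_pos t b) as P.
  rewrite Rabs_Ropp, Rabs_pos_eq by (left; apply Rinv_0_lt_compat; nra).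
  assert (Pb : 0 < b * e) by nra.
  apply Rmult_lt_compat_l with (r := b * e) in L1; auto; rewrite Rinv_r in L1 by lra.
  apply Rmult_le_reg_r with (b * (1 + Rpower t b)); [nra |]; rewrite Rinv_l by nra; nra. }
exists (fun ab => 0 < fst ab < d /\ M < snd ab); split.
{ apply improper_filter_intro with d M; auto. }
intros [x y] [x' y']; simpl; intros [Hx Hy] [Hx' Hy'] l l' I I'.
assert (Px : 0 < x) by lra; assert (Px' : 0 < x') by lra; assert (Py : 0 < y) by lra; assert (Py' : 0 < y') by lra.
destruct (dominated_ex_RInt x' x Px' Px) as [p Ip]; destruct (dominated_ex_RInt y y' Py Py') as [q Iq].
pose proof (is_RInt_Chasles _ _ _ _ _ _ Ip (is_RInt_Chasles _ _ _ _ _ _ I Iq)) as J.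
assert (El : l' = plus p (plus l q)).
{ rewrite <- (is_RInt_unique _ _ _ _ I'); apply is_RInt_unique; auto. }
apply (@norm_compat1 R_AbsRing V); rewrite El.
replace (minus (plus p (plus l q)) l) with (plus p q).
2: { symmetry; exact (minus_middle V p l q). }
eapply Rle_lt_trans; [apply norm_triangle |].
pose proof (dominated_RInt_bound x' x p Px' Px Ip) as B1.
pose proof (dominated_RInt_bound y y' q Py Py' Iq) as B2.
assert (D1 : Rabs (maj_prim b x - maj_prim b x') <= 2 * e).
{ replace (maj_prim b x - maj_prim b x') with ((maj_prim b x - - / b) - (maj_prim b x' - - / b)) by ring.
  eapply Rle_trans; [apply Rabs_triang |]; rewrite Rabs_Ropp.
  pose proof (G0 x Hx); pose proof (G0 x' Hx'); lra. }
assert (D2 : Rabs (maj_prim b y' - maj_prim b y) <= 2 * e).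
{ eapply Rle_trans; [apply Rabs_triang |]; rewrite Rabs_Ropp.
  pose proof (G1 y Hy); pose proof (G1 y' Hy'); lra. }
apply Rmult_le_compat_l with (r := K) in D1; auto; apply Rmult_le_compat_l with (r := K) in D2; auto.
lra.
Qed.
End ImproperVector.

Definition rint (f : R -> R) (l : R) : Prop :=
  is_RInt_gen (V := R_NormedModule) f (at_right 0) (Rbar_locally p_infty) l.

Lemma rint_unique f l m : rint f l -> rint f m -> l = m.
Proof.
intros A B; rewrite <- (is_RInt_gen_unique (V := R_CompleteNormedModule) f l A).
apply (is_RInt_gen_unique (V := R_CompleteNormedModule) f m B).
Qed.

Lemma rint_ext f g l : (forall t, 0 < t -> f t = g t) -> rint f l -> rint g l.
Proof.
intros E; apply (@is_RInt_gen_ext R_NormedModule (at_right 0) (Rbar_locally p_infty) _ _ f g l); apply improper_filter_intro with 1 1; [lra |].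
simpl; intros a b Ha Hb x Hx; apply E; rewrite Rmin_left in Hx by lra; lra.
Qed.

Lemma rint_plus f g l m : rint f l -> rint g m -> rint (fun t => f t + g t) (l + m).
Proof. intros A B; exact (@is_RInt_gen_plus R_NormedModule (at_right 0) (Rbar_locally p_infty) _ _ f g l m A B). Qed.
Lemma rint_minus f g l m : rint f l -> rint g m -> rint (fun t => f t - g t) (l - m).
Proof. intros A B; exact (@is_RInt_gen_minus R_NormedModule (at_right 0) (Rbar_locally p_infty) _ _ f g l m A B). Qed.
Lemma rint_scal k f l : rint f l -> rint (fun t => k * f t) (k * l).
Proof. intros A; exact (@is_RInt_gen_scal R_NormedModule (at_right 0) (Rbar_locally p_infty) _ _ f k l A). Qed.

Lemma rint_abs_le f g l m : (forall t, 0 < t -> Rabs (f t) <= g t) -> rint f l -> rint g m -> Rabs l <= m.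
Proof.
intros B; apply (@RInt_gen_norm R_CompleteNormedModule (at_right 0) (Rbar_locally p_infty) _ _ f g l m).
- apply improper_filter_intro with 1 1; [lra |]; simpl; intros; lra.
- apply improper_filter_intro with 1 1; [lra |]; simpl; intros; apply B; lra.
Qed.

Lemma rint_exists b s f K : 0 < b -> 0 < s -> 0 <= K -> (forall t, 0 < t -> continuous f t) ->
  (forall t, 0 < t -> Rabs (f t) <= K * gkernel b s t) -> exists l, rint f l.
Proof.
intros Hb Hs HK Cf B; destruct (maj_bound b s Hb Hs) as [C [HC M]].
apply (dominated_improper (V := R_CompleteNormedModule) f b (K * C)); auto.
{ apply Rmult_le_pos; lra. }
intros t Ht; eapply Rle_trans; [apply B; auto |]; rewrite Rmult_assoc; apply Rmult_le_compat_l; auto.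
Qed.

Lemma rint_derive (F df : R -> R) (la lb : R) :
  (forall t, 0 < t -> is_derive F t (df t)) -> (forall t, 0 < t -> continuous df t) ->
  filterlim F (at_right 0) (locally la) -> filterlim F (Rbar_locally p_infty) (locally lb) -> rint df (lb - la).
Proof.
intros D Cd La Lb.
assert (ED : forall t, 0 < t -> Derive F t = df t) by (intros; apply is_derive_unique; auto).
apply rint_ext with (Derive F); [auto |].
apply (@is_RInt_gen_Derive (at_right 0) (Rbar_locally p_infty) _ _ F la lb); auto.
- apply improper_filter_intro with 1 1; [lra |]; simpl; intros a b Ha Hb x Hx; exists (df x); apply D.
  rewrite Rmin_left in Hx by lra; lra.
- apply improper_filter_intro with 1 1; [lra |]; simpl; intros a b Ha Hb x Hx.
  rewrite Rmin_left in Hx by lra.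
  apply continuous_ext_loc with df; [| apply Cd; lra].
  assert (Px : 0 < x) by lra; exists (mkposreal x Px); intros y Hy.
  change (Rabs (y - x) < x) in Hy; apply Rabs_def2 in Hy; symmetry; apply ED; lra.
Qed.

Lemma squeeze_at_right_0 (F : R -> R) b K : 0 < b -> 0 < K ->
  (forall t, 0 < t -> Rabs (F t) <= K * Rpower t b) -> filterlim F (at_right 0) (locally 0).
Proof.
intros Hb HK B; apply filterlim_locally; intros eps; apply at_right_0_iff.
destruct (Rpower_lim_0 b (eps / K) Hb) as [d [Hd L]]; [apply Rdiv_lt_0_compat; auto; apply cond_pos |].
exists d; split; auto; intros t Ht; specialize (L t Ht).
change (Rabs (F t - 0) < eps); rewrite Rminus_0_r.
eapply Rle_lt_trans; [apply B; lra |].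
apply Rmult_lt_compat_l with (r := K) in L; auto.
replace (K * (eps / K)) with (eps : R) in L by (field; lra); auto.
Qed.

Lemma squeeze_infty (F : R -> R) b s K : 0 < b -> 0 < s -> 0 < K ->
  (forall t, 0 < t -> Rabs (F t) <= K * gkernel (b + 1) s t) -> filterlim F (Rbar_locally p_infty) (locally 0).
Proof.
intros Hb Hs HK B; apply filterlim_locally; intros eps.
destruct (Rpower_exp_bound (b + 1) s) as [C [HC L]]; [lra | auto |].
exists (Rmax 0 (K * C / eps)); intros t Ht.
pose proof (Rmax_l 0 (K * C / eps)); pose proof (Rmax_r 0 (K * C / eps)).
assert (Pt : 0 < t) by lra.
change (Rabs (F t - 0) < eps); rewrite Rminus_0_r.
eapply Rle_lt_trans; [apply B; auto |].
apply Rmult_lt_reg_r with t; auto.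
specialize (L t Pt); unfold gkernel; rewrite (Rpower_S t (b + 1)) in L by auto.
apply Rle_lt_trans with (K * C).
{ rewrite Rmult_assoc; apply Rmult_le_compat_l; [lra |]; lra. }
pose proof (cond_pos eps) as Pe.
apply Rmult_lt_compat_r with (r := eps) in Ht; auto.
assert (K * C / eps * eps = K * C) by (field; lra).
assert (K * C / eps * eps <= Rmax 0 (K * C / eps) * eps) by (apply Rmult_le_compat_r; lra).
lra.
Qed.

(** * Improper integrals with values in the Hilbert space *)

Section HilbertIntegral.
Context {H : Hilbert}.
Implicit Types x y : H.

(** Restricting the scalars leaves the uniform structure unchanged, so the completeness of the
    complex space is reused as it is. *)
Definition real_complete_class : CompleteNormedModule.class_of R_AbsRing H :=
  CompleteNormedModule.Class R_AbsRing H (NormedModule.class R_AbsRing (real_space H))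
    (CompleteNormedModule.mixin C_AbsRing H (CompleteNormedModule.class C_AbsRing (carrier H))).

Definition real_complete : CompleteNormedModule R_AbsRing :=
  CompleteNormedModule.Pack R_AbsRing H real_complete_class H.

Definition hint (f : R -> H) (v : H) : Prop :=
  @is_RInt_gen (real_space H) f (at_right 0) (Rbar_locally p_infty) v.

Lemma continuous_eps (f : R -> H) t :
  (forall eps, 0 < eps -> exists d, 0 < d /\ forall r, Rabs (r - t) < d -> norm (f r -h f t) <= eps) ->
  @continuous R_UniformSpace (real_complete) f t.
Proof.
intros E; apply (proj2 (@filterlim_locally_ball_norm C_AbsRing R (carrier H) (locally t) _ f (f t))).
intros eps; destruct (E (eps / 2)) as [d [Hd L]]; [pose proof (cond_pos eps); lra |].
exists (mkposreal d Hd); intros r Hr; specialize (L r Hr).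
eapply Rle_lt_trans; [apply L |]; pose proof (cond_pos eps); lra.
Qed.

Lemma hint_exists b s f K : 0 < b -> 0 < s -> 0 <= K ->
  (forall t, 0 < t -> forall eps, 0 < eps -> exists d, 0 < d /\ forall r, Rabs (r - t) < d -> norm (f r -h f t) <= eps) ->
  (forall t, 0 < t -> norm (f t) <= K * gkernel b s t) -> exists v, hint f v.
Proof.
intros Hb Hs HK Cf B; destruct (maj_bound b s Hb Hs) as [C [HC M]].
apply (dominated_improper (V := real_complete) f b (K * C)); auto.
{ apply Rmult_le_pos; lra. }
{ intros t Ht; apply continuous_eps; auto. }
intros t Ht; change (norm (f t) <= K * C * maj b t).
eapply Rle_trans; [apply B; auto |]; rewrite Rmult_assoc; apply Rmult_le_compat_l; auto.
Qed.

Lemma rip_filterlim (v y : H) : filterlim (fun x : H => rip x y) (locally v) (locally (rip v y)).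
Proof.
apply filterlim_locally; intros eps.
assert (P : 0 < norm y + 1) by (pose proof (norm_nonneg y); lra).
assert (Q : 0 < eps / (norm y + 1)) by (apply Rdiv_lt_0_compat; auto; apply cond_pos).
pose proof (proj1 (@filterlim_locally_ball_norm C_AbsRing H (carrier H) (locally v) _ (fun x => x) v) (filterlim_id _ _) (mkposreal _ Q)) as N.
revert N; apply filter_imp; intros x Hx.
unfold ball_norm in Hx; change (norm (x -h v) < eps / (norm y + 1)) in Hx.
change (Rabs (rip x y - rip v y) < eps); rewrite <- rip_minus_l.
eapply Rle_lt_trans; [apply rip_abs_le |].
apply Rle_lt_trans with (norm (x -h v) * (norm y + 1)); [apply Rmult_le_compat_l; [apply norm_nonneg | lra] |].
apply Rmult_lt_compat_r with (r := norm y + 1) in Hx; auto.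
replace (eps / (norm y + 1) * (norm y + 1)) with (eps : R) in Hx by (field; lra); auto.
Qed.

Lemma Riemann_sum_rip (f : R -> H) y ptd :
  rip (@Riemann_sum (real_space H) f ptd) y = Riemann_sum (V := R_ModuleSpace) (fun t => rip (f t) y) ptd.
Proof.
apply SF_cons_ind with (s := ptd).
- intros x0; unfold Riemann_sum; simpl; apply rip_zero_l.
- intros [x0 y0] s IH; rewrite !Riemann_sum_cons, <- IH.
  etransitivity; [apply rip_plus_l |]; apply (f_equal2 Rplus); [apply rip_scal_l | reflexivity].
Qed.

Lemma is_RInt_rip (f : R -> H) y a b v :
  @is_RInt (real_space H) f a b v -> is_RInt (V := R_NormedModule) (fun t => rip (f t) y) a b (rip v y).
Proof.
unfold is_RInt; intros L.
pose proof (filterlim_comp _ _ _ _ (fun x : H => rip x y) _ _ _ L (rip_filterlim v y)) as L'.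
revert L'; apply filterlim_ext; intros ptd; rewrite <- Riemann_sum_rip; apply rip_scal_l.
Qed.

(** A continuous real functional commutes with the integral; identities between vector integrals can
    thus be checked on real integrals. *)
Lemma hint_rip f v y : hint f v -> rint (fun t => rip (f t) y) (rip v y).
Proof.
intros L P HP.
generalize (L _ (rip_filterlim v y P HP)); unfold filtermapi; apply filter_imp.
intros [a b] [u [I Pu]]; exists (rip u y); split; auto; apply is_RInt_rip; auto.
Qed.

Lemma hint_unique f v w : hint f v -> hint f w -> v = w.
Proof.
intros A B; apply rip_ext; intros y.
apply (rint_unique (fun t => rip (f t) y)); apply hint_rip; auto.
Qed.

End HilbertIntegral.

(** * The Gamma integral at a complex frequency *)

Lemma derive_continuous (f : R -> R) t d : is_derive f t d -> continuous f t.
Proof. intros D; apply (@ex_derive_continuous R_AbsRing R_NormedModule); exists d; exact D. Qed.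

Lemma continuous_Rmult (f g : R -> R) t : continuous f t -> continuous g t -> continuous (fun r => f r * g r) t.
Proof. intros A B; exact (@continuous_mult R_UniformSpace R_AbsRing f g t A B). Qed.
Lemma continuous_Rplus (f g : R -> R) t : continuous f t -> continuous g t -> continuous (fun r => f r + g r) t.
Proof. intros A B; exact (@continuous_plus R_UniformSpace R_AbsRing R_NormedModule f g t A B). Qed.

Lemma is_derive_Rmult (f g : R -> R) t a b :
  is_derive f t a -> is_derive g t b -> is_derive (fun r => f r * g r) t (a * g t + f t * b).
Proof. intros A B; apply (is_derive_mult f g t a b A B); intros; apply Rmult_comm. Qed.

(** Integration by parts without boundary terms: the factor t^b annihilates the product at 0 and the
    exponential annihilates it at infinity. Every recursion for Gamma-type integrals and fractional
    powers below comes from here. *)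
Lemma rint_parts (phi dphi g dg : R -> R) b s k K : 0 < b -> 0 < s -> 0 < k -> 0 < K ->
  (forall t, 0 < t -> is_derive phi t (dphi t)) -> (forall t, 0 < t -> is_derive g t (dg t)) ->
  (forall t, 0 < t -> continuous dphi t) -> (forall t, 0 < t -> continuous dg t) ->
  (forall t, 0 < t -> Rabs (phi t) <= k * Rpower t b) ->
  (forall t, 0 < t -> Rabs (g t) <= K * exp (- (s * t))) ->
  rint (fun t => dphi t * g t + phi t * dg t) 0.
Proof.
intros Hb Hs Hk HK Dp Dg Cp Cg Bp Bg.
assert (B : forall t, 0 < t -> Rabs (phi t * g t) <= k * K * gkernel (b + 1) s t).
{ intros t Ht; rewrite Rabs_mult; unfold gkernel; replace (b + 1 - 1) with b by ring.
  replace (k * K * (Rpower t b * exp (- (s * t)))) with (k * Rpower t b * (K * exp (- (s * t)))) by ring.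
  apply Rmult_le_compat; auto using Rabs_pos. }
assert (PK : 0 < k * K) by (apply Rmult_lt_0_compat; auto).
replace 0 with (0 - 0) by ring; apply rint_derive with (F := fun t => phi t * g t).
- intros t Ht; apply is_derive_Rmult; auto.
- intros t Ht; apply continuous_Rplus; apply continuous_Rmult; auto; eapply derive_continuous; auto.
- apply squeeze_at_right_0 with b (k * K); auto.
  intros t Ht; eapply Rle_trans; [apply B; auto |]; apply Rmult_le_compat_l; [lra |].
  unfold gkernel; replace (b + 1 - 1) with b by ring; pose proof (Rpower_pos t b).
  assert (exp (- (s * t)) <= 1) by (rewrite <- exp_0; left; apply exp_increasing; nra).
  nra.
- apply squeeze_infty with b s (k * K); auto.
Qed.

Lemma gkernel_continuous b s t : 0 < t -> continuous (gkernel b s) t.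
Proof.
intros Ht; apply (@ex_derive_continuous R_AbsRing R_NormedModule); unfold gkernel, Rpower; auto_derive; auto.
Qed.

(** With [sinint], the real part and minus the imaginary part of the integral of t^(b-1) e^(-(s + i
    tau) t), whose classical value is Gamma(b) (s + i tau)^(-b). *)
Definition cosint (b s tau : R) : R :=
  RInt_gen (V := R_CompleteNormedModule) (fun t => gkernel b s t * cos (tau * t)) (at_right 0) (Rbar_locally p_infty).
Definition sinint (b s tau : R) : R :=
  RInt_gen (V := R_CompleteNormedModule) (fun t => gkernel b s t * sin (tau * t)) (at_right 0) (Rbar_locally p_infty).

Lemma rint_gen f l : rint f l -> rint f (RInt_gen (V := R_CompleteNormedModule) f (at_right 0) (Rbar_locally p_infty)).
Proof.
intros A; pose proof (@is_RInt_gen_unique R_CompleteNormedModule (at_right 0) (Rbar_locally p_infty) _ _ f l A) as E.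
rewrite E; exact A.
Qed.

Lemma rint_gkernel_mult b s (g : R -> R) : 0 < b -> 0 < s -> (forall t, continuous g t) ->
  (forall t, Rabs (g t) <= 1) ->
  rint (fun t => gkernel b s t * g t)
    (RInt_gen (V := R_CompleteNormedModule) (fun t => gkernel b s t * g t) (at_right 0) (Rbar_locally p_infty)).
Proof.
intros Hb Hs Cg Bg; destruct (rint_exists b s (fun t => gkernel b s t * g t) 1) as [l Hl]; auto; try lra.
- intros t Ht; apply continuous_Rmult; auto; apply gkernel_continuous; auto.
- intros t Ht; rewrite Rabs_mult, (Rabs_pos_eq (gkernel _ _ _)), Rmult_1_l by (left; apply gkernel_pos).
  rewrite <- (Rmult_1_r (gkernel b s t)) at 2; apply Rmult_le_compat_l; auto; left; apply gkernel_pos.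
- apply rint_gen with l; auto.
Qed.

Lemma cosint_spec b s tau : 0 < b -> 0 < s -> rint (fun t => gkernel b s t * cos (tau * t)) (cosint b s tau).
Proof.
intros; apply rint_gkernel_mult; auto.
- intros t; apply (@ex_derive_continuous R_AbsRing R_NormedModule); auto_derive; auto.
- intros; apply Rabs_le, COS_bound.
Qed.

Lemma sinint_spec b s tau : 0 < b -> 0 < s -> rint (fun t => gkernel b s t * sin (tau * t)) (sinint b s tau).
Proof.
intros; apply rint_gkernel_mult; auto.
- intros t; apply (@ex_derive_continuous R_AbsRing R_NormedModule); auto_derive; auto.
- intros; apply Rabs_le, SIN_bound.
Qed.

Definition gint (b s : R) : R := cosint b s 0.

Lemma gint_spec b s : 0 < b -> 0 < s -> rint (gkernel b s) (gint b s).
Proof.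
intros Hb Hs; apply rint_ext with (2 := cosint_spec b s 0 Hb Hs); intros t Ht.
rewrite Rmult_0_l, cos_0; ring.
Qed.

Lemma gint_Gamma b : 0 < b -> gint b 1 = Gamma b.
Proof.
intros Hb; unfold Gamma; symmetry.
apply (@is_RInt_gen_unique R_CompleteNormedModule (at_right 0) (Rbar_locally p_infty) _ _).
apply rint_ext with (2 := gint_spec b 1 Hb Rlt_0_1); intros t Ht; unfold gkernel; rewrite Rmult_1_l; auto.
Qed.

Lemma rint_le f g l m : (forall t, 0 < t -> f t <= g t) -> rint f l -> rint g m -> l <= m.
Proof.
intros B A1 A2; pose proof (rint_minus _ _ _ _ A2 A1) as A3.
assert (Rabs (m - l) <= m - l).
{ apply (rint_abs_le (fun t => g t - f t) (fun t => g t - f t)); auto.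
  intros t Ht; rewrite Rabs_pos_eq; [lra |]; pose proof (B t Ht); lra. }
pose proof (Rabs_pos (m - l)); lra.
Qed.

(** The real part of b I(b) = (s + i tau) I(b+1), where I(b) is the complex integral
    [cosint - i sinint]; the next lemma is the imaginary part. *)
Lemma cosint_parts b s tau : 0 < b -> 0 < s ->
  b * cosint b s tau = s * cosint (b + 1) s tau + tau * sinint (b + 1) s tau.
Proof.
intros Hb Hs.
assert (P : rint (fun t => b * Rpower t (b - 1) * (exp (- (s * t)) * cos (tau * t)) +
  Rpower t b * (- s * exp (- (s * t)) * cos (tau * t) - tau * exp (- (s * t)) * sin (tau * t))) 0).
{ apply rint_parts with b s 1 1; auto; try lra.
  - intros t Ht; apply is_derive_Rpower; auto.
  - intros t Ht; auto_derive; auto; ring.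
  - intros t Ht; apply continuous_Rmult; [apply continuous_const | apply Rpower_continuous; auto].
  - intros t Ht; apply (@ex_derive_continuous R_AbsRing R_NormedModule); auto_derive; auto.
  - intros t Ht; rewrite Rabs_pos_eq; [lra | left; apply Rpower_pos].
  - intros t Ht; rewrite Rabs_mult, Rabs_pos_eq, Rmult_1_l by (left; apply exp_pos).
    rewrite <- (Rmult_1_r (exp _)) at 2; apply Rmult_le_compat_l; [left; apply exp_pos | apply Rabs_le, COS_bound]. }
assert (Q : rint (fun t => b * Rpower t (b - 1) * (exp (- (s * t)) * cos (tau * t)) +
  Rpower t b * (- s * exp (- (s * t)) * cos (tau * t) - tau * exp (- (s * t)) * sin (tau * t)))
  (b * cosint b s tau - (s * cosint (b + 1) s tau + tau * sinint (b + 1) s tau))).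
{ assert (Hb1 : 0 < b + 1) by lra.
  eapply rint_ext; [| apply rint_minus; [apply rint_scal, cosint_spec; auto |
    apply rint_plus; [apply rint_scal, cosint_spec; auto | apply rint_scal, sinint_spec; auto]]].
  intros t Ht; cbv beta; rewrite !gkernel_S by auto; unfold gkernel; rewrite (Rpower_S t b) by auto; ring. }
pose proof (rint_unique _ _ _ P Q); lra.
Qed.

Lemma sinint_parts b s tau : 0 < b -> 0 < s ->
  b * sinint b s tau = s * sinint (b + 1) s tau - tau * cosint (b + 1) s tau.
Proof.
intros Hb Hs.
assert (P : rint (fun t => b * Rpower t (b - 1) * (exp (- (s * t)) * sin (tau * t)) +
  Rpower t b * (- s * exp (- (s * t)) * sin (tau * t) + tau * exp (- (s * t)) * cos (tau * t))) 0).
{ apply rint_parts with b s 1 1; auto; try lra.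
  - intros t Ht; apply is_derive_Rpower; auto.
  - intros t Ht; auto_derive; auto; ring.
  - intros t Ht; apply continuous_Rmult; [apply continuous_const | apply Rpower_continuous; auto].
  - intros t Ht; apply (@ex_derive_continuous R_AbsRing R_NormedModule); auto_derive; auto.
  - intros t Ht; rewrite Rabs_pos_eq; [lra | left; apply Rpower_pos].
  - intros t Ht; rewrite Rabs_mult, Rabs_pos_eq, Rmult_1_l by (left; apply exp_pos).
    rewrite <- (Rmult_1_r (exp _)) at 2; apply Rmult_le_compat_l; [left; apply exp_pos | apply Rabs_le, SIN_bound]. }
assert (Q : rint (fun t => b * Rpower t (b - 1) * (exp (- (s * t)) * sin (tau * t)) +
  Rpower t b * (- s * exp (- (s * t)) * sin (tau * t) + tau * exp (- (s * t)) * cos (tau * t)))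
  (b * sinint b s tau - (s * sinint (b + 1) s tau - tau * cosint (b + 1) s tau))).
{ assert (Hb1 : 0 < b + 1) by lra.
  eapply rint_ext; [| apply rint_minus; [apply rint_scal, sinint_spec; auto |
    apply rint_minus; [apply rint_scal, sinint_spec; auto | apply rint_scal, cosint_spec; auto]]].
  intros t Ht; cbv beta; rewrite !gkernel_S by auto; unfold gkernel; rewrite (Rpower_S t b) by auto; ring. }
pose proof (rint_unique _ _ _ P Q); lra.
Qed.

Lemma gint_parts b s : 0 < b -> 0 < s -> b * gint b s = s * gint (b + 1) s.
Proof. intros; unfold gint; rewrite cosint_parts by auto; ring. Qed.

Lemma gint_1_1 : gint 1 1 = 1.
Proof.
apply (rint_unique (gkernel 1 1)); [apply gint_spec; lra |].
replace 1 with (0 - -1) at 3 by ring.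
apply rint_derive with (F := fun t => - exp (- t)).
- intros t Ht; unfold gkernel; rewrite Rminus_diag, Rpower_O by auto; auto_derive; auto; rewrite !Rmult_1_l; ring.
- intros t Ht; apply gkernel_continuous; auto.
- apply filterlim_locally; intros eps; apply at_right_0_iff; exists (Rmin 1 eps).
  split; [apply Rmin_pos; [lra | apply cond_pos] |]; intros t Ht.
  pose proof (Rmin_r 1 eps); change (Rabs (- exp (- t) - -1) < eps).
  pose proof (exp_ineq1_le (- t)).
  assert (exp (- t) < 1) by (rewrite <- exp_0; apply exp_increasing; lra).
  rewrite Rabs_pos_eq; lra.
- apply filterlim_locally; intros eps; exists (Rmax 0 (/ eps)); intros t Ht.
  pose proof (Rmax_l 0 (/ eps)); pose proof (Rmax_r 0 (/ eps)); pose proof (cond_pos eps) as Pe.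
  change (Rabs (- exp (- t) - 0) < eps); rewrite Rminus_0_r, Rabs_Ropp, Rabs_pos_eq by (left; apply exp_pos).
  rewrite exp_Ropp, <- (Rinv_inv eps); apply Rinv_lt_contravar.
  + apply Rmult_lt_0_compat; [apply Rinv_0_lt_compat; auto | apply exp_pos].
  + pose proof (exp_ineq1_le t); lra.
Qed.

(** From ln t >= 1 - 1/t and e^u >= 1 + u, applied to t^(b-1) and multiplied by [t]. *)
Lemma Rpower_bernoulli t b : 1 <= b -> 0 < t -> 1 - b + b * t <= Rpower t b.
Proof.
intros Hb Ht; rewrite Rpower_S by auto.
assert (L : 1 - / t <= ln t).
{ pose proof (exp_ineq1_le (- ln t)) as E; rewrite exp_Ropp, exp_ln in E by auto; lra. }
pose proof (exp_ineq1_le ((b - 1) * ln t)) as E; fold (Rpower t (b - 1)) in E.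
apply Rle_trans with ((1 + (b - 1) * (1 - / t)) * t); [right; field; lra |].
apply Rmult_le_compat_r; [lra |].
assert ((b - 1) * (1 - / t) <= (b - 1) * ln t) by (apply Rmult_le_compat_l; lra); lra.
Qed.

(* Bernoulli's inequality bounds the integral for Gamma(b+1), b >= 1, from below. *)
Lemma Gamma_pos b : 0 < b -> 0 < Gamma b.
Proof.
intros Hb; rewrite <- gint_Gamma by auto.
pose proof (gint_parts b 1 Hb Rlt_0_1) as E1; pose proof (gint_parts (b + 1) 1 ltac:(lra) Rlt_0_1) as E2.
pose proof (gint_parts 1 1 Rlt_0_1 Rlt_0_1) as E3; rewrite gint_1_1 in E3.
assert (L : 1 <= gint (b + 1 + 1) 1).
(* The affine Bernoulli minorant with exponent [b + 1] integrates to exactly 1 against e^(-t), since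
   its zeroth and first moments are both 1. *)
{ replace 1 with ((1 - (b + 1)) * gint 1 1 + (b + 1) * gint (1 + 1) 1) at 1
    by (rewrite gint_1_1; replace (gint (1 + 1) 1) with 1 by lra; ring).
  apply (rint_le (fun t => (1 - (b + 1)) * gkernel 1 1 t + (b + 1) * gkernel (1 + 1) 1 t) (gkernel (b + 1 + 1) 1)).
  - intros t Ht; rewrite gkernel_S by auto; unfold gkernel.
    rewrite Rminus_diag, Rpower_O by auto; replace (b + 1 + 1 - 1) with (b + 1) by ring.
    pose proof (Rpower_bernoulli t (b + 1) ltac:(lra) Ht); pose proof (exp_pos (- (1 * t))); nra.
  - apply rint_plus; apply rint_scal, gint_spec; lra.
  - apply gint_spec; lra. }
(* Positivity descends from [b + 2] to [b + 1] to [b] along the recursion. *)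
assert (0 < gint (b + 1) 1) by nra; nra.
Qed.

Lemma mvt_bound (g dg : R -> R) u M :
  (forall x, is_derive g x (dg x)) -> (forall x, Rabs x <= Rabs u -> Rabs (dg x) <= M) ->
  Rabs (g u - g 0) <= M * Rabs u.
Proof.
intros D B; destruct (MVT_gen g 0 u dg) as [c [Hc E]].
- intros; apply D.
- intros; apply continuity_pt_filterlim; eapply derive_continuous; apply D.
- rewrite E, Rminus_0_r, Rabs_mult; apply Rmult_le_compat_r; [apply Rabs_pos |]; apply B.
  unfold Rmin, Rmax in Hc; destruct (Rle_dec 0 u).
  + rewrite !Rabs_pos_eq; lra.
  + rewrite !Rabs_left1; lra.
Qed.

Lemma sin_lip x u : Rabs (sin (x + u) - sin x) <= Rabs u.
Proof.
replace (sin x) with (sin (x + 0)) by (f_equal; ring); rewrite <- (Rmult_1_l (Rabs u)).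
apply (mvt_bound (fun v => sin (x + v)) (fun v => cos (x + v))).
- intros; auto_derive; auto; ring.
- intros; apply Rabs_le, COS_bound.
Qed.

Lemma cos_lip x u : Rabs (cos (x + u) - cos x) <= Rabs u.
Proof.
replace (cos x) with (cos (x + 0)) by (f_equal; ring); rewrite <- (Rmult_1_l (Rabs u)).
apply (mvt_bound (fun v => cos (x + v)) (fun v => - sin (x + v))).
- intros; auto_derive; auto; ring.
- intros; rewrite Rabs_Ropp; apply Rabs_le, SIN_bound.
Qed.

Lemma sq_abs u : Rabs u * Rabs u = u ^ 2.
Proof. rewrite <- Rabs_mult, Rabs_pos_eq by nra; ring. Qed.

Lemma cos_taylor x u : Rabs (cos (x + u) - cos x + u * sin x) <= u ^ 2.
Proof.
rewrite <- sq_abs.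
replace (cos (x + u) - cos x + u * sin x) with ((cos (x + u) + u * sin x) - (cos (x + 0) + 0 * sin x)) by (rewrite Rplus_0_r; ring).
apply (mvt_bound (fun v => cos (x + v) + v * sin x) (fun v => - (sin (x + v) - sin x))).
- intros; auto_derive; auto; ring.
- intros v Hv; rewrite Rabs_Ropp; eapply Rle_trans; [apply sin_lip | auto].
Qed.

Lemma sin_taylor x u : Rabs (sin (x + u) - sin x - u * cos x) <= u ^ 2.
Proof.
rewrite <- sq_abs.
replace (sin (x + u) - sin x - u * cos x) with ((sin (x + u) - u * cos x) - (sin (x + 0) - 0 * cos x)) by (rewrite Rplus_0_r; ring).
apply (mvt_bound (fun v => sin (x + v) - v * cos x) (fun v => cos (x + v) - cos x)).
- intros; auto_derive; auto; ring.
- intros v Hv; eapply Rle_trans; [apply cos_lip | auto].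
Qed.

Lemma exp_lip u : Rabs (exp u - 1) <= exp (Rabs u) * Rabs u.
Proof.
rewrite <- exp_0 at 1; apply (mvt_bound exp exp).
- intros; auto_derive; auto; ring.
- intros v Hv; rewrite Rabs_pos_eq by (left; apply exp_pos).
  assert (v <= Rabs u) by (pose proof (Rle_abs v); lra).
  destruct (Req_dec v (Rabs u)) as [-> | N]; [lra | left; apply exp_increasing; lra].
Qed.

Lemma exp_taylor u : Rabs (exp u - 1 - u) <= exp (Rabs u) * u ^ 2.
Proof.
rewrite <- sq_abs, <- Rmult_assoc.
replace (exp u - 1 - u) with ((exp u - u) - (exp 0 - 0)) by (rewrite exp_0; ring).
apply (mvt_bound (fun v => exp v - v) (fun v => exp v - 1)).
- intros; auto_derive; auto; ring.
- intros v Hv; eapply Rle_trans; [apply exp_lip |].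
  apply Rmult_le_compat; auto using Rabs_pos; [left; apply exp_pos |].
  destruct (Req_dec (Rabs v) (Rabs u)) as [-> | N]; [lra | left; apply exp_increasing; lra].
Qed.

Lemma is_derive_of_quadratic (f : R -> R) t l d K : 0 < d ->
  (forall h, Rabs h < d -> Rabs (f (t + h) - f t - h * l) <= K * h ^ 2) -> is_derive f t l.
Proof.
intros Hd B; apply is_derive_eps; intros eps He.
assert (PK : 0 < Rabs K + 1) by (pose proof (Rabs_pos K); lra).
exists (Rmin d (eps / (Rabs K + 1))); split; [apply Rmin_pos; auto; apply Rdiv_lt_0_compat; auto |].
intros h Hh; pose proof (Rmin_l d (eps / (Rabs K + 1))); pose proof (Rmin_r d (eps / (Rabs K + 1))).
eapply Rle_trans; [apply B; lra |]; rewrite <- sq_abs, <- Rmult_assoc.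
apply Rmult_le_compat_r; [apply Rabs_pos |].
apply Rle_trans with ((Rabs K + 1) * Rabs h); [apply Rmult_le_compat_r; [apply Rabs_pos | pose proof (Rle_abs K); lra] |].
apply Rle_trans with ((Rabs K + 1) * (eps / (Rabs K + 1))); [apply Rmult_le_compat_l; lra | right; field; lra].
Qed.

(** Differentiation under the integral sign: a pointwise remainder quadratic in [h t] integrates to
    h^2 times a second moment, whose kernel has exponent [b + 2]. *)
Lemma rint_quadratic_remainder b s (f : R -> R) l h : 0 < b -> 0 < s -> rint f l ->
  (forall t, 0 < t -> Rabs (f t) <= gkernel b s t * (h * t) ^ 2) -> Rabs l <= gint (b + 2) s * h ^ 2.
Proof.
intros Hb Hs I B; apply (rint_abs_le f (fun t => h ^ 2 * gkernel (b + 2) s t)); auto.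
- intros t Ht; eapply Rle_trans; [apply B; auto |]; right.
  replace (b + 2) with (b + 1 + 1) by ring; rewrite !gkernel_S by auto; ring.
- rewrite Rmult_comm; apply rint_scal, gint_spec; lra.
Qed.

Lemma cosint_derive b s tau : 0 < b -> 0 < s -> is_derive (cosint b s) tau (- sinint (b + 1) s tau).
Proof.
intros Hb Hs; apply is_derive_of_quadratic with 1 (gint (b + 2) s); [lra |]; intros h _.
assert (Hb1 : 0 < b + 1) by lra.
eapply rint_quadratic_remainder; auto.
{ apply rint_minus; [apply rint_minus; apply cosint_spec; auto |].
  replace (h * - sinint (b + 1) s tau) with ((- h) * sinint (b + 1) s tau) by ring.
  apply rint_scal, sinint_spec; auto. }
intros t Ht; cbv beta; rewrite gkernel_S by auto.
replace (gkernel b s t * cos ((tau + h) * t) - gkernel b s t * cos (tau * t) - - h * (t * gkernel b s t * sin (tau * t)))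
  with (gkernel b s t * (cos (tau * t + h * t) - cos (tau * t) + h * t * sin (tau * t)))
  by (replace ((tau + h) * t) with (tau * t + h * t) by ring; ring).
rewrite Rabs_mult, Rabs_pos_eq by (left; apply gkernel_pos).
apply Rmult_le_compat_l; [left; apply gkernel_pos | apply cos_taylor].
Qed.

Lemma sinint_derive b s tau : 0 < b -> 0 < s -> is_derive (sinint b s) tau (cosint (b + 1) s tau).
Proof.
intros Hb Hs; apply is_derive_of_quadratic with 1 (gint (b + 2) s); [lra |]; intros h _.
assert (Hb1 : 0 < b + 1) by lra.
eapply rint_quadratic_remainder; auto.
{ apply rint_minus; [apply rint_minus; apply sinint_spec; auto |].
  apply rint_scal, cosint_spec; auto. }
intros t Ht; cbv beta; rewrite gkernel_S by auto.
replace (gkernel b s t * sin ((tau + h) * t) - gkernel b s t * sin (tau * t) - h * (t * gkernel b s t * cos (tau * t)))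
  with (gkernel b s t * (sin (tau * t + h * t) - sin (tau * t) - h * t * cos (tau * t)))
  by (replace ((tau + h) * t) with (tau * t + h * t) by ring; ring).
rewrite Rabs_mult, Rabs_pos_eq by (left; apply gkernel_pos).
apply Rmult_le_compat_l; [left; apply gkernel_pos | apply sin_taylor].
Qed.

Lemma gkernel_shift b s h t : gkernel b (s + h) t = gkernel b s t * exp (- (h * t)).
Proof. unfold gkernel; rewrite Rmult_assoc, <- exp_plus; do 2 f_equal; ring. Qed.

(** Unlike the trigonometric remainders, the remainder of the exponential may grow with [t]. Half of
    the decay rate is sacrificed to absorb it, whence the restriction to |h| < s/2 and the moment
    taken at [s / 2]. *)
Lemma gint_derive b s : 0 < b -> 0 < s -> is_derive (gint b) s (- gint (b + 1) s).
Proof.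
intros Hb Hs; apply is_derive_of_quadratic with (s / 2) (gint (b + 2) (s / 2)); [lra |]; intros h Hh.
assert (Hb1 : 0 < b + 1) by lra.
assert (Hsh : 0 < s + h) by (apply Rabs_def2 in Hh; lra).
eapply rint_quadratic_remainder; auto; [lra | |].
{ apply rint_minus; [apply rint_minus; apply gint_spec; auto |].
  replace (h * - gint (b + 1) s) with ((- h) * gint (b + 1) s) by ring.
  apply rint_scal, gint_spec; auto. }
intros t Ht; cbv beta; rewrite gkernel_S, gkernel_shift by auto.
replace (gkernel b s t * exp (- (h * t)) - gkernel b s t - - h * (t * gkernel b s t))
  with (gkernel b s t * (exp (- (h * t)) - 1 - - (h * t))) by ring.
rewrite Rabs_mult, Rabs_pos_eq by (left; apply gkernel_pos).
apply Rle_trans with (gkernel b s t * (exp (Rabs (- (h * t))) * (- (h * t)) ^ 2)).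
{ apply Rmult_le_compat_l; [left; apply gkernel_pos | apply exp_taylor]. }
replace (gkernel b (s / 2) t) with (gkernel b s t * exp (s / 2 * t)).
2: { replace (s / 2) with (s + - (s / 2)) at 2 by field; rewrite gkernel_shift; do 2 f_equal; ring. }
replace ((h * t) ^ 2) with ((- (h * t)) ^ 2) by ring.
rewrite <- Rmult_assoc; apply Rmult_le_compat_r; [apply pow2_ge_0 |].
apply Rmult_le_compat_l; [left; apply gkernel_pos |].
rewrite Rabs_Ropp, Rabs_mult, (Rabs_pos_eq t) by lra.
left; apply exp_increasing; apply Rmult_lt_compat_r; auto.
Qed.

Lemma derive_zero_const (f : R -> R) (a b : R) :
  (forall t, Rmin a b <= t <= Rmax a b -> is_derive f t 0) -> f a = f b.
Proof.
intros D; destruct (Rtotal_order a b) as [L | [-> | L]]; auto.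
- apply (eq_is_derive (V := R_NormedModule) f a b); auto; intros t Ht; apply D.
  rewrite Rmin_left, Rmax_right; lra.
- symmetry; apply (eq_is_derive (V := R_NormedModule) f b a); auto; intros t Ht; apply D.
  rewrite Rmin_right, Rmax_left; lra.
Qed.

(** The derivative of the left-hand side in [s] vanishes by [gint_derive] and [gint_parts], so the
    value at [s = 1] propagates; no substitution in the integral is made. *)
Lemma gint_scaling b s : 0 < b -> 0 < s -> gint b s * Rpower s b = Gamma b.
Proof.
intros Hb Hs; rewrite <- gint_Gamma by auto.
replace (gint b 1) with (gint b 1 * Rpower 1 b).
2: { unfold Rpower; rewrite ln_1, Rmult_0_r, exp_0; ring. }
apply (derive_zero_const (fun s => gint b s * Rpower s b)); intros t [Ht _].
assert (Pt : 0 < t) by (apply Rlt_le_trans with (2 := Ht); apply Rmin_pos; lra).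
replace 0 with (- gint (b + 1) t * Rpower t b + gint b t * (b * Rpower t (b - 1))).
- apply (is_derive_Rmult (gint b) (fun r => Rpower r b)); [apply gint_derive | apply is_derive_Rpower]; auto.
- rewrite (Rpower_S t b) by auto; pose proof (gint_parts b t Hb Pt).
  replace (- gint (b + 1) t * (Rpower t (b - 1) * t) + gint b t * (b * Rpower t (b - 1)))
    with (Rpower t (b - 1) * (b * gint b t - t * gint (b + 1) t)) by ring.
  rewrite H; ring.
Qed.

Lemma is_derive_pow2 (f : R -> R) t d : is_derive f t d -> is_derive (fun r => f r ^ 2) t (2 * f t * d).
Proof.
intros D; replace (2 * f t * d) with (d * f t + f t * d) by ring.
apply is_derive_ext with (fun r => f r * f r); [intros; simpl; ring | apply (is_derive_Rmult f f); auto].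
Qed.

(* For int_0^oo t^(b-1) e^(-(s + i tau) t) dt, up to conjugation: the left-hand side is constant in tau. *)
Lemma gamma_modulus b s tau : 0 < b -> 0 < s ->
  (cosint b s tau ^ 2 + sinint b s tau ^ 2) * Rpower (s ^ 2 + tau ^ 2) b = Gamma b ^ 2.
Proof.
intros Hb Hs; transitivity ((cosint b s 0 ^ 2 + sinint b s 0 ^ 2) * Rpower (s ^ 2 + 0 ^ 2) b).
- apply (derive_zero_const (fun tau => (cosint b s tau ^ 2 + sinint b s tau ^ 2) * Rpower (s ^ 2 + tau ^ 2) b)).
  intros t _; set (c := cosint b s t); set (d := sinint b s t).
  set (c1 := cosint (b + 1) s t); set (d1 := sinint (b + 1) s t).
  assert (Pq : 0 < s ^ 2 + t ^ 2) by nra.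
  replace 0 with ((2 * c * (- d1) + 2 * d * c1) * Rpower (s ^ 2 + t ^ 2) b +
    (c ^ 2 + d ^ 2) * (2 * t * (b * Rpower (s ^ 2 + t ^ 2) (b - 1)))).
  + apply is_derive_Rmult with (f := fun r => cosint b s r ^ 2 + sinint b s r ^ 2) (g := fun r => Rpower (s ^ 2 + r ^ 2) b).
    * apply (is_derive_plus (V := R_NormedModule) (fun r => cosint b s r ^ 2) (fun r => sinint b s r ^ 2));
        apply is_derive_pow2; [apply cosint_derive | apply sinint_derive]; auto.
    * apply (is_derive_comp (fun q => Rpower q b) (fun r => s ^ 2 + r ^ 2) t); [apply is_derive_Rpower; auto |].
      auto_derive; auto; ring.
  + pose proof (cosint_parts b s t Hb Hs) as E1; pose proof (sinint_parts b s t Hb Hs) as E2.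
    fold c d c1 d1 in E1, E2; rewrite (Rpower_S _ b) by auto.
    replace ((2 * c * - d1 + 2 * d * c1) * (Rpower (s ^ 2 + t ^ 2) (b - 1) * (s ^ 2 + t ^ 2)) +
      (c ^ 2 + d ^ 2) * (2 * t * (b * Rpower (s ^ 2 + t ^ 2) (b - 1))))
      with (2 * Rpower (s ^ 2 + t ^ 2) (b - 1) * ((d * c1 - c * d1) * (s ^ 2 + t ^ 2) + (c ^ 2 + d ^ 2) * t * b)) by ring.
    (* After multiplication by [b], the recursions turn [b (d c1 - c d1)] into [- t (c1^2 + d1^2)]
       and [(b c)^2 + (b d)^2] into [(s^2 + t^2)(c1^2 + d1^2)], and the terms cancel. *)
    replace ((d * c1 - c * d1) * (s ^ 2 + t ^ 2) + (c ^ 2 + d ^ 2) * t * b) with 0; [ring |].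
    apply Rmult_eq_reg_l with b; [| lra].
    replace (b * ((d * c1 - c * d1) * (s ^ 2 + t ^ 2) + (c ^ 2 + d ^ 2) * t * b))
      with ((b * d * c1 - b * c * d1) * (s ^ 2 + t ^ 2) + ((b * c) ^ 2 + (b * d) ^ 2) * t) by ring.
    rewrite E1, E2; ring.
- replace (sinint b s 0) with 0.
  + replace (s ^ 2 + 0 ^ 2) with (s * s) by ring.
    rewrite <- Rpower_mult_distr by auto; rewrite <- (gint_scaling b s) by auto; unfold gint; ring.
  + apply (rint_unique (fun t => gkernel b s t * sin (0 * t))); [| apply sinint_spec; auto].
    apply rint_ext with (fun t => 0 * gkernel b s t).
    * intros; rewrite (Rmult_0_l t), sin_0; ring.
    * pose proof (rint_scal 0 _ _ (gint_spec b s Hb Hs)) as E.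
      replace (0 * gint b s) with 0 in E by ring; exact E.
Qed.

(** * Negative fractional powers *)

Section OpNorm.
Context {H : Hilbert}.

Lemma opnorm_le (T : op H) (K : R) :
  (forall x y, T x y -> norm x <= 1 -> norm y <= K) -> Rbar_le (opnorm T) K.
Proof.
intros B; unfold opnorm; apply (proj2 (Lub_Rbar_correct _)).
intros r [x [y [Txy [Nx ->]]]]; apply (B x y Txy Nx).
Qed.

Lemma opnorm_ge (T : op H) x y : T x y -> norm x <= 1 -> Rbar_le (norm y) (opnorm T).
Proof. intros Txy Nx; unfold opnorm; apply (proj1 (Lub_Rbar_correct _)); eauto. Qed.

Lemma opnorm_graph_finite (f : H -> H) : is_linear f -> exists m, opnorm (graph f) = Finite m /\ 0 <= m.
Proof.
intros Lf; destruct (linear_norm f Lf) as [M [PM HM]].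
assert (U : Rbar_le (opnorm (graph f)) M).
{ apply opnorm_le; intros x y -> Nx; specialize (HM x); nra. }
assert (L : Rbar_le 0 (opnorm (graph f))).
{ rewrite <- (norm_zero_eq (H := H)); apply opnorm_ge with (0h : H).
  - unfold graph; rewrite (lin_zero Lf); auto.
  - rewrite norm_zero_eq; lra. }
destruct (opnorm (graph f)) as [m | |]; simpl in *; try contradiction; eauto.
Qed.

Lemma opnorm_graph_ge (f : H -> H) m x : is_linear f -> opnorm (graph f) = Finite m -> norm (f x) <= m * norm x.
Proof.
intros Lf E; destruct (norm_nonneg x) as [P | Z].
- pose proof (opnorm_ge (graph f) (RtoC (/ norm x) *h x) (f (RtoC (/ norm x) *h x)) eq_refl) as G.
  rewrite E, (lin_scal Lf), !norm_scal_R_eq, Rabs_pos_eq in G by (left; apply Rinv_0_lt_compat; auto).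
  rewrite Rinv_l in G by lra; specialize (G (Rle_refl 1)); simpl in G.
  apply Rmult_le_compat_r with (r := norm x) in G; [| lra].
  replace (/ norm x * norm (f x) * norm x) with (norm (f x)) in G by (field; lra); auto.
- symmetry in Z; rewrite Z, (h_norm_eq_zero _ Z), (lin_zero Lf), norm_zero_eq; lra.
Qed.
End OpNorm.

Lemma hint_ext {H : Hilbert} (f g : R -> H) v : (forall t, 0 < t -> f t = g t) -> hint f v -> hint g v.
Proof.
intros E; apply (@is_RInt_gen_ext (real_space H) (at_right 0) (Rbar_locally p_infty) _ _ f g v).
apply improper_filter_intro with 1 1; [lra |].
simpl; intros a b Ha Hb x Hx; apply E; rewrite Rmin_left in Hx by lra; lra.
Qed.

Lemma rip_scal_adj {H : Hilbert} (a : C) (x y : H) : rip (a *h x) y = rip x (Cconj a *h y).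
Proof.
unfold rip; inner_expand; f_equal; unfold Cconj, Cmult; simpl; f_equal; ring.
Qed.

Lemma rip_scal_complex {H : Hilbert} (a : C) (x y : H) : rip (a *h x) y = fst a * rip x y + snd a * rip (Ci *h x) y.
Proof. unfold rip; inner_expand; unfold Re, Cmult, Ci; simpl; ring. Qed.

Record good {H : Hilbert} (s : R) (T : op H) : Prop := {
  good_pos : 0 < s;
  good_acc : m_accretive T;
  good_strong : strongly_accretive s T
}.

Section NegPow.
Context {H : Hilbert} {T : op H} {s : R} (G : good s T).
Implicit Types x y z w : H.
Let Hs := good_pos s T G.
Let MA := good_acc s T G.
Let SA := good_strong s T G.
Notation U := (hy_semigroup T).
Let HU : C0_semigroup U := hy_C0 MA.
Let HG : op_eq (generator U) (op_opp T) := hy_generator MA.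

Lemma U_decay t x : 0 <= t -> norm (U t x) <= exp (- (s * t)) * norm x.
Proof. apply (semigroup_decay HU HG SA); lra. Qed.

Lemma U_orbit_continuous x t : 0 < t -> forall eps, 0 < eps ->
  exists d, 0 < d /\ forall r, Rabs (r - t) < d -> norm (U r x -h U t x) <= eps.
Proof.
intros Ht eps He; destruct (C0_cont_eps HU x eps He) as [d [Hd L]].
assert (B : forall a h, 0 <= a -> 0 < h < d -> norm (U (a + h) x -h U a x) <= eps).
{ intros a h Ha Hh; rewrite (C0_plus U HU), <- (lin_minus (C0_linear U HU a Ha)) by lra.
  eapply Rle_trans; [apply (hy_contr MA); auto | apply L; auto]. }
exists (Rmin d t); split; [apply Rmin_pos; auto |]; intros r Hr.
pose proof (Rmin_l d t); pose proof (Rmin_r d t); apply Rabs_def2 in Hr.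
destruct (Rtotal_order r t) as [N | [-> | P]].
- rewrite norm_minus_sym; replace t with (r + (t - r)) by ring; apply B; lra.
- replace (U t x -h U t x) with (0h : H) by vec; rewrite norm_zero_eq; lra.
- replace r with (t + (r - t)) by ring; apply B; lra.
Qed.

Lemma U_rip_continuous x y t : 0 < t -> continuous (fun r => rip (U r x) y) t.
Proof.
intros Ht; apply filterlim_locally; intros eps.
assert (P : 0 < norm y + 1) by (pose proof (norm_nonneg y); lra).
pose proof (cond_pos eps) as Pe.
destruct (U_orbit_continuous x t Ht (eps / (2 * (norm y + 1)))) as [d [Hd L]]; [apply Rdiv_lt_0_compat; lra |].
exists (mkposreal d Hd); intros r Hr; specialize (L r Hr).
change (Rabs (rip (U r x) y - rip (U t x) y) < eps); rewrite <- rip_minus_l.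
eapply Rle_lt_trans; [apply rip_abs_le |].
apply Rle_lt_trans with (eps / (2 * (norm y + 1)) * (norm y + 1)).
- apply Rmult_le_compat; auto using norm_nonneg; lra.
- replace (eps / (2 * (norm y + 1)) * (norm y + 1)) with (eps / 2) by (field; lra); lra.
Qed.

Lemma good_exp_stable : exp_stable U.
Proof.
(* Half of the decay rate as exponent leaves a norm of at most e^(-st/2), which tends to 0. *)
exists (s / 2); split; [lra |].
apply (is_lim_le_le_loc (fun _ => 0) (fun t => exp (- (s / 2 * t)))).
- exists 0; intros t Ht.
  pose proof (exp_pos (s / 2 * t)) as Pe.
  assert (B : Rbar_le (opnorm (op_scal (RtoC (exp (s / 2 * t))) (graph (U t)))) (exp (- (s / 2 * t)))).
  { apply opnorm_le; intros x y [u [-> ->]] Nx.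
    change (norm (RtoC (exp (s / 2 * t)) *h U t x) <= exp (- (s / 2 * t))).
    rewrite norm_scal_R_eq, Rabs_pos_eq by lra.
    pose proof (U_decay t x ltac:(lra)) as D; pose proof (exp_pos (- (s * t))).
    apply Rle_trans with (exp (s / 2 * t) * exp (- (s * t))).
    - apply Rmult_le_compat_l; [lra |]; nra.
    - right; rewrite <- exp_plus; f_equal; field. }
  assert (A : Rbar_le 0 (opnorm (op_scal (RtoC (exp (s / 2 * t))) (graph (U t))))).
  { rewrite <- (norm_zero_eq (H := H)); apply opnorm_ge with (0h : H).
    - exists (0h : H); split; [unfold graph; symmetry; apply (lin_zero (C0_linear U HU t ltac:(lra))) |].
      symmetry; exact (@scal_zero_r C_AbsRing (carrier H) _).
    - rewrite norm_zero_eq; lra. }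
  destruct (opnorm _) as [m | |]; simpl in *; try contradiction; lra.
- apply is_lim_const.
- apply filterlim_locally; intros eps; exists (Rmax 0 (/ (s / 2 * eps))); intros t Ht.
  pose proof (Rmax_l 0 (/ (s / 2 * eps))); pose proof (Rmax_r 0 (/ (s / 2 * eps))); pose proof (cond_pos eps) as Pe.
  change (Rabs (exp (- (s / 2 * t)) - 0) < eps); rewrite Rminus_0_r, Rabs_pos_eq by (left; apply exp_pos).
  rewrite exp_Ropp, <- (Rinv_inv eps); apply Rinv_lt_contravar.
  + apply Rmult_lt_0_compat; [apply Rinv_0_lt_compat; auto | apply exp_pos].
  + pose proof (exp_ineq1_le (s / 2 * t)).
    assert (L : / (s / 2 * eps) < t) by lra.
    apply Rmult_lt_compat_l with (r := s / 2) in L; [| lra].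
    replace (s / 2 * / (s / 2 * eps)) with (/ eps) in L by (field; lra); lra.
Qed.

Lemma good_generates : generates_exp_stable (op_opp T).
Proof. exists U; split; [exact HU | split; [exact HG | exact good_exp_stable]]. Qed.

Definition npow (b : R) (x : H) : H :=
  epsilon (inhabits (0h : H))
    (fun y => hint (fun t => RtoC (Rpower t (b - 1)) *h U t x) (RtoC (Gamma b) *h y)).

Lemma npow_hint b x : 0 < b -> hint (fun t => RtoC (Rpower t (b - 1)) *h U t x) (RtoC (Gamma b) *h npow b x).
Proof.
intros Hb; unfold npow; apply epsilon_spec.
destruct (hint_exists b s (fun t => RtoC (Rpower t (b - 1)) *h U t x) (norm x)) as [v Hv]; auto using norm_nonneg.
- intros t Ht eps He.
  set (a := Rpower t (b - 1)); assert (Pa : 0 < a) by apply Rpower_pos.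
  assert (Pn : 0 < norm x + 1) by (pose proof (norm_nonneg x); lra).
  assert (He1 : 0 < eps / 2 / (norm x + 1)) by (apply Rdiv_lt_0_compat; lra).
  assert (He2 : 0 < eps / 2 / a) by (apply Rdiv_lt_0_compat; lra).
  pose proof (proj1 (filterlim_locally _ _) (Rpower_continuous t (b - 1) Ht) (mkposreal _ He1)) as [d1 L1].
  destruct (U_orbit_continuous x t Ht _ He2) as [d2 [Hd2 L2]].
  exists (Rmin t (Rmin d1 d2)); split; [repeat apply Rmin_pos; auto; apply cond_pos |]; intros r Hr.
  pose proof (Rmin_l t (Rmin d1 d2)); pose proof (Rmin_r t (Rmin d1 d2)).
  pose proof (Rmin_l d1 d2); pose proof (Rmin_r d1 d2).
  assert (Pr : 0 < r) by (apply Rabs_def2 in Hr; lra).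
  assert (L1' : Rabs (Rpower r (b - 1) - a) < eps / 2 / (norm x + 1)).
  { apply L1; change (Rabs (r - t) < d1); lra. }
  specialize (L2 r ltac:(lra)).
  replace (RtoC (Rpower r (b - 1)) *h U r x -h RtoC a *h U t x)
    with (RtoC (Rpower r (b - 1) - a) *h U r x +h RtoC a *h (U r x -h U t x)) by vec.
  eapply Rle_trans; [apply h_triangle |]; rewrite !norm_scal_R_eq, (Rabs_pos_eq a) by lra.
  assert (a * norm (U r x -h U t x) <= eps / 2).
  { apply Rmult_le_compat_l with (r := a) in L2; [| lra].
    replace (a * (eps / 2 / a)) with (eps / 2) in L2 by (field; lra); auto. }
  assert (Rabs (Rpower r (b - 1) - a) * norm (U r x) <= eps / 2).
  { apply Rle_trans with (eps / 2 / (norm x + 1) * (norm x + 1)); [| right; field; lra].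
    apply Rmult_le_compat; auto using Rabs_pos, norm_nonneg; [lra |].
    pose proof (hy_contr MA r x ltac:(lra)); lra. }
  lra.
- intros t Ht; rewrite norm_scal_R_eq, Rabs_pos_eq by (left; apply Rpower_pos).
  unfold gkernel; rewrite (Rmult_comm (norm x)), Rmult_assoc.
  apply Rmult_le_compat_l; [left; apply Rpower_pos | apply U_decay; lra].
- pose proof (Gamma_pos b Hb) as Pg.
  exists (RtoC (/ Gamma b) *h v).
  replace (RtoC (Gamma b) *h (RtoC (/ Gamma b) *h v)) with v; auto.
  vec; lra.
Qed.

(** The existentially quantified semigroup agrees with the constructed one by uniqueness, and
    dividing by the positive number [Gamma b] determines [y]. *)
Lemma neg_pow_iff b x y : 0 < b -> neg_pow b T x y <-> y = npow b x.
Proof.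
intros Hb; split.
- intros [V [HV [GV [_ I]]]].
  assert (SA0 : strongly_accretive 0 T).
  { destruct SA as [L [D A]]; split; [auto | split; auto]; intros u v Tuv.
    rewrite Rmult_0_l; apply (acc_nonneg T MA); auto. }
  assert (E : RtoC (Gamma b) *h y = RtoC (Gamma b) *h npow b x).
  { apply (hint_unique (fun t => RtoC (Rpower t (b - 1)) *h U t x)); [| apply npow_hint; auto].
    apply hint_ext with (fun t => RtoC (Rpower t (b - 1)) *h V t x); [| exact I].
    intros t Ht; rewrite (semigroup_unique V U T SA0 HV GV HU HG t x); auto; lra. }
  pose proof (Gamma_pos b Hb).
  replace y with (RtoC (/ Gamma b) *h (RtoC (Gamma b) *h y)) by (vec; lra).
  rewrite E; vec; lra.
- intros ->; exists U; split; [exact HU | split; [exact HG | split; [exact good_exp_stable |]]].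
  exact (npow_hint b x Hb).
Qed.

Lemma neg_pow_graph b : 0 < b -> neg_pow b T = graph (npow b).
Proof. intros Hb; apply op_ext; intros x y; apply neg_pow_iff; auto. Qed.

Lemma npow_rint b x y : 0 < b -> rint (fun t => Rpower t (b - 1) * rip (U t x) y) (Gamma b * rip (npow b x) y).
Proof.
intros Hb; pose proof (hint_rip _ _ y (npow_hint b x Hb)) as I; rewrite rip_scal_l in I.
revert I; apply rint_ext; intros t Ht; apply rip_scal_l.
Qed.

(** Weak characterization by real integrals; linearity and commutation of fractional powers are
    obtained by rewriting under these integrals. *)
Lemma npow_char b x v : 0 < b ->
  (forall y, rint (fun t => Rpower t (b - 1) * rip (U t x) y) (Gamma b * rip v y)) -> npow b x = v.
Proof.
intros Hb E; apply rip_ext; intros y; pose proof (Gamma_pos b Hb).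
apply Rmult_eq_reg_l with (Gamma b); [| lra].
apply (rint_unique _ _ _ (npow_rint b x y Hb) (E y)).
Qed.

Lemma npow_linear b : 0 < b -> is_linear (npow b).
Proof.
intros Hb; pose proof (Gamma_pos b Hb) as Pg; constructor.
- intros x y; apply npow_char; auto; intros z.
  change (rint (fun t => Rpower t (b - 1) * rip (U t (x +h y)) z) (Gamma b * rip (npow b x +h npow b y) z)).
  rewrite rip_plus_l, Rmult_plus_distr_l.
  eapply rint_ext; [| apply rint_plus; apply npow_rint; auto].
  intros t Ht; cbv beta; rewrite (lin_plus (C0_linear U HU t ltac:(lra))), rip_plus_l; ring.
- intros a x; apply npow_char; auto; intros z.
  change (rint (fun t => Rpower t (b - 1) * rip (U t ((a : C) *h x)) z) (Gamma b * rip ((a : C) *h npow b x) z)).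
  rewrite rip_scal_adj.
  eapply rint_ext; [| apply npow_rint; auto].
  intros t Ht; cbv beta; rewrite (lin_scal (C0_linear U HU t ltac:(lra))), rip_scal_adj; auto.
(* By [gint_scaling] this bound equals s^(-b). *)
- exists (gint b s / Gamma b); split; [apply Rdiv_lt_0_compat; auto |].
  { pose proof (gint_scaling b s Hb Hs); pose proof (Rpower_pos s b); nra. }
  intros x.
  assert (Pgi : 0 < gint b s) by (pose proof (gint_scaling b s Hb Hs); pose proof (Rpower_pos s b); nra).
  apply norm_le_of_rip; [apply Rmult_le_pos; [left; apply Rdiv_lt_0_compat; auto | apply norm_nonneg] |].
  intros y; apply Rmult_le_reg_l with (Gamma b); auto.
  replace (Gamma b * (gint b s / Gamma b * norm x * norm y)) with (norm x * norm y * gint b s) by (field; lra).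
  eapply Rle_trans; [apply Rle_abs |].
  apply (rint_abs_le _ (fun t => norm x * norm y * gkernel b s t) _ _) with (2 := npow_rint b x y Hb).
  + intros t Ht; rewrite Rabs_mult, Rabs_pos_eq by (left; apply Rpower_pos); unfold gkernel.
    replace (norm x * norm y * (Rpower t (b - 1) * exp (- (s * t))))
      with (Rpower t (b - 1) * (exp (- (s * t)) * norm x * norm y)) by ring.
    apply Rmult_le_compat_l; [left; apply Rpower_pos |].
    eapply Rle_trans; [apply rip_abs_le |]; apply Rmult_le_compat_r; [apply norm_nonneg | apply U_decay; lra].
  + apply rint_scal, gint_spec; auto.
Qed.

Lemma Gamma_S b : 0 < b -> Gamma (b + 1) = b * Gamma b.
Proof. intros Hb; rewrite <- !gint_Gamma by lra; rewrite gint_parts by lra; ring. Qed.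

Lemma orbit_rip_derive w x y t : T w x -> 0 < t -> is_derive (fun r => rip (U r w) y) t (- rip (U t x) y).
Proof.
intros Tw Ht; rewrite <- rip_opp_l; apply (vder_rip (fun r => U r w)).
apply (orbit_derive HU HG); auto.
Qed.

(** As [w] is T^(-1) x, this is T^(-(b+1)) = T^(-b) T^(-1). It follows by parts, because the
    derivative of [U t w] is [- U t x]; iterated, it accounts for the integer part of an
    exponent. *)
Lemma npow_S b w x : 0 < b -> T w x -> npow (b + 1) x = npow b w.
Proof.
intros Hb Tw; apply rip_ext; intros y.
pose proof (npow_rint (b + 1) x y ltac:(lra)) as I1; pose proof (npow_rint b w y Hb) as I2.
assert (P : rint (fun t => b * Rpower t (b - 1) * rip (U t w) y + Rpower t b * - rip (U t x) y) 0).
{ apply rint_parts with b s 1 (norm w * norm y + 1); auto; try lra.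
  - pose proof (norm_nonneg w); pose proof (norm_nonneg y); nra.
  - intros t Ht; apply is_derive_Rpower; auto.
  - intros t Ht; apply orbit_rip_derive; auto.
  - intros t Ht; apply continuous_Rmult; [apply continuous_const | apply Rpower_continuous; auto].
  - intros t Ht; exact (continuous_opp (fun r => rip (U r x) y) t (U_rip_continuous x y t Ht)).
  - intros t Ht; rewrite Rabs_pos_eq; [lra | left; apply Rpower_pos].
  - intros t Ht; eapply Rle_trans; [apply rip_abs_le |].
    pose proof (U_decay t w ltac:(lra)); pose proof (norm_nonneg y); pose proof (exp_pos (- (s * t))).
    apply Rle_trans with (exp (- (s * t)) * norm w * norm y); [apply Rmult_le_compat_r; auto | nra]. }
assert (Q : rint (fun t => b * Rpower t (b - 1) * rip (U t w) y + Rpower t b * - rip (U t x) y)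
  (b * (Gamma b * rip (npow b w) y) - Gamma (b + 1) * rip (npow (b + 1) x) y)).
{ eapply rint_ext; [| apply rint_minus; [apply rint_scal, I2 | apply I1]].
  intros t Ht; cbv beta; replace (b + 1 - 1) with b by ring; ring. }
pose proof (rint_unique _ _ _ P Q) as E; rewrite Gamma_S in E by auto.
pose proof (Gamma_pos b Hb) as Pg.
assert (Pbg : 0 < b * Gamma b) by nra.
apply Rmult_eq_reg_l with (b * Gamma b); lra.
Qed.

(** Split 1 = (1 - e^(-kt)) + e^(-kt) under the integral. The second part is at most
    [gint b (s + k) * norm x], small for large [k]. In the first, [U t x] is minus the derivative of
    [U t w], and parts shift the derivative to the weight. So the fractional power of [x] is small
    when [w], the inverse applied to [x], is small. *)
Lemma npow_small b k w x : 0 < b -> 0 < k -> T w x ->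
  Gamma b * norm (npow b x) <= k * (Rabs (b - 1) + 1) * gint b s * norm w + gint b (s + k) * norm x.
Proof.
intros Hb Hk Tw; pose proof (Gamma_pos b Hb) as Pg.
assert (Gp : forall r, 0 < r -> 0 < gint b r).
{ intros r Hr; pose proof (gint_scaling b r Hb Hr); pose proof (Rpower_pos r b); nra. }
set (A := k * (Rabs (b - 1) + 1)); assert (PA : 0 < A).
{ apply Rmult_lt_0_compat; auto; pose proof (Rabs_pos (b - 1)); lra. }
pose proof (Gp s Hs) as Gs; pose proof (Gp (s + k) ltac:(lra)) as Gsk.
replace (Gamma b * norm (npow b x)) with (norm (RtoC (Gamma b) *h npow b x)) by (rewrite norm_scal_R_eq, Rabs_pos_eq; lra).
pose proof (norm_nonneg w) as Nw; pose proof (norm_nonneg x) as Nx.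
apply norm_le_of_rip.
{ assert (0 <= A * gint b s * norm w) by (apply Rmult_le_pos; [apply Rmult_le_pos |]; lra); assert (0 <= gint b (s + k) * norm x) by nra; lra. }
intros y; rewrite rip_scal_l; pose proof (norm_nonneg y) as Ny.
pose proof (npow_rint b x y Hb) as I.
set (dphi := fun t => (b - 1) * Rpower t (b - 1 - 1) * (1 - exp (- (k * t))) + Rpower t (b - 1) * (k * exp (- (k * t)))).
assert (P : rint (fun t => dphi t * rip (U t w) y + Rpower t (b - 1) * (1 - exp (- (k * t))) * - rip (U t x) y) 0).
{ apply (rint_parts (fun t => Rpower t (b - 1) * (1 - exp (- (k * t)))) dphi) with b s k (norm w * norm y + 1); auto; try nra.
  - intros t Ht; apply (is_derive_Rmult (fun t => Rpower t (b - 1)) (fun t => 1 - exp (- (k * t)))).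
    + apply is_derive_Rpower; auto.
    + auto_derive; auto; ring.
  - intros t Ht; apply orbit_rip_derive; auto.
  - intros t Ht; apply (@ex_derive_continuous R_AbsRing R_NormedModule); unfold dphi, Rpower; auto_derive; auto.
  - intros t Ht; exact (continuous_opp (fun r => rip (U r x) y) t (U_rip_continuous x y t Ht)).
  - intros t Ht; pose proof (exp_ineq1_le (- (k * t))).
    assert (exp (- (k * t)) < 1) by (rewrite <- exp_0; apply exp_increasing; nra).
    rewrite Rabs_mult, !Rabs_pos_eq by (try lra; left; apply Rpower_pos).
    rewrite (Rpower_S t b) by auto; pose proof (Rpower_pos t (b - 1)); nra.
  - intros t Ht; eapply Rle_trans; [apply rip_abs_le |].
    pose proof (U_decay t w ltac:(lra)); pose proof (exp_pos (- (s * t))).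
    apply Rle_trans with (exp (- (s * t)) * norm w * norm y); [apply Rmult_le_compat_r; auto | nra]. }
assert (Q : rint (fun t => dphi t * rip (U t w) y + Rpower t (b - 1) * exp (- (k * t)) * rip (U t x) y)
  (Gamma b * rip (npow b x) y)).
{ replace (Gamma b * rip (npow b x) y) with (Gamma b * rip (npow b x) y + 0) by ring.
  eapply rint_ext; [| apply rint_plus; [exact I | exact P]].
  intros t Ht; cbv beta; ring. }
replace ((A * gint b s * norm w + gint b (s + k) * norm x) * norm y)
  with (A * norm w * norm y * gint b s + norm x * norm y * gint b (s + k)) by ring.
eapply Rle_trans; [apply Rle_abs |].
apply (rint_abs_le _ (fun t => A * norm w * norm y * gkernel b s t + norm x * norm y * gkernel b (s + k) t) _ _) with (2 := Q).
2: { apply rint_plus; apply rint_scal, gint_spec; lra. }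
intros t Ht; pose proof (Rpower_pos t (b - 1)) as Pr; pose proof (exp_pos (- (k * t))) as Pk.
pose proof (exp_ineq1_le (- (k * t))) as Ek.
assert (Ek1 : exp (- (k * t)) < 1) by (rewrite <- exp_0; apply exp_increasing; nra).
pose proof (exp_pos (- (s * t))) as Pse.
eapply Rle_trans; [apply Rabs_triang |]; apply Rplus_le_compat.
- rewrite Rabs_mult.
  (* By 1 - e^(-kt) <= k t, which compensates the singular power t^(b-2). *)
  assert (D : Rabs (dphi t) <= A * Rpower t (b - 1)).
  { unfold dphi; eapply Rle_trans; [apply Rabs_triang |].
    rewrite !Rabs_mult, (Rabs_pos_eq (Rpower t (b - 1))), (Rabs_pos_eq (Rpower t (b - 1 - 1))),
      (Rabs_pos_eq (1 - _)), (Rabs_pos_eq k), (Rabs_pos_eq (exp _)) by (try lra; left; apply Rpower_pos).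
    rewrite (Rpower_S t (b - 1)) in * by auto.
    pose proof (Rpower_pos t (b - 1 - 1)) as Pr2; pose proof (Rabs_pos (b - 1)) as Pb.
    assert (Rabs (b - 1) * Rpower t (b - 1 - 1) * (1 - exp (- (k * t))) <= Rabs (b - 1) * Rpower t (b - 1 - 1) * (k * t)).
    { apply Rmult_le_compat_l; [apply Rmult_le_pos; lra | lra]. }
    assert (Rpower t (b - 1 - 1) * t * (k * exp (- (k * t))) <= Rpower t (b - 1 - 1) * t * (k * 1)).
    { apply Rmult_le_compat_l; [lra |]; apply Rmult_le_compat_l; lra. }
    unfold A; lra. }
  replace (A * norm w * norm y * gkernel b s t) with (A * Rpower t (b - 1) * (exp (- (s * t)) * norm w * norm y))
    by (unfold gkernel; ring).
  apply Rmult_le_compat; auto using Rabs_pos.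
  eapply Rle_trans; [apply rip_abs_le |]; apply Rmult_le_compat_r; auto; apply U_decay; lra.
- rewrite gkernel_shift; rewrite !Rabs_mult, !(Rabs_pos_eq (Rpower _ _)), !(Rabs_pos_eq (exp _)) by lra.
  replace (norm x * norm y * (gkernel b s t * exp (- (k * t))))
    with (Rpower t (b - 1) * exp (- (k * t)) * (exp (- (s * t)) * norm x * norm y)) by (unfold gkernel; ring).
  apply Rmult_le_compat_l; [nra |].
  eapply Rle_trans; [apply rip_abs_le |]; apply Rmult_le_compat_r; auto; apply U_decay; lra.
Qed.

Lemma exp_spiral_lim (l1 l2 : R) eps : 0 < eps -> exists d, 0 < d /\ forall t, 0 < t < d ->
  Cmod (exp (l1 * t) * cos (l2 * t) - 1, exp (l1 * t) * sin (l2 * t)) <= eps.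
Proof.
intros He.
assert (C1 : continuity_pt (fun t => exp (l1 * t) * cos (l2 * t)) 0).
{ apply continuity_pt_filterlim, (@ex_derive_continuous R_AbsRing R_NormedModule (fun t => exp (l1 * t) * cos (l2 * t)) 0); auto_derive; auto. }
assert (C2 : continuity_pt (fun t => exp (l1 * t) * sin (l2 * t)) 0).
{ apply continuity_pt_filterlim, (@ex_derive_continuous R_AbsRing R_NormedModule (fun t => exp (l1 * t) * sin (l2 * t)) 0); auto_derive; auto. }
destruct (C1 (eps / 2)) as [d1 [Hd1 L1]]; [lra |]; destruct (C2 (eps / 2)) as [d2 [Hd2 L2]]; [lra |].
exists (Rmin d1 d2); split; [apply Rmin_pos; auto |]; intros t Ht.
pose proof (Rmin_l d1 d2); pose proof (Rmin_r d1 d2).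
specialize (L1 t); specialize (L2 t); simpl in L1, L2; unfold R_dist, D_x, no_cond in L1, L2.
rewrite !Rmult_0_r, exp_0, cos_0, Rminus_0_r, Rmult_1_l in L1.
rewrite !Rmult_0_r, exp_0, sin_0, !Rminus_0_r, Rmult_0_r, Rminus_0_r in L2.
assert (A1 : Rabs (exp (l1 * t) * cos (l2 * t) - 1) < eps / 2) by (apply L1; split; [split; auto; lra | rewrite Rabs_pos_eq; lra]).
assert (A2 : Rabs (exp (l1 * t) * sin (l2 * t)) < eps / 2) by (apply L2; split; [split; auto; lra | rewrite Rabs_pos_eq; lra]).
set (p := exp (l1 * t) * cos (l2 * t) - 1) in *; set (q := exp (l1 * t) * sin (l2 * t)) in *.
replace (p, q) with (Cplus (RtoC p) (Cmult Ci (RtoC q))) by (unfold Cplus, Cmult, RtoC, Ci; simpl; f_equal; ring).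
eapply Rle_trans; [apply Cmod_triangle |]; rewrite Cmod_mult, !Cmod_R, Cmod_Ci; lra.
Qed.

(** The curve e^(lr) U(r) x has derivative - e^(lr) U(r)(Tx - l x), of norm at most e^((Re l - s) t)
    times the residual for [r <= t]. Integrating from 0 and multiplying by e^(-lt) gives the
    estimate. *)
Lemma U_approx (l : C) x y t : s <= fst l -> T x y -> 0 < t ->
  norm (U t x -h (exp (- (fst l * t)) * cos (snd l * t), - (exp (- (fst l * t)) * sin (snd l * t))) *h x)
    <= t * exp (- (s * t)) * norm (y -h l *h x).
Proof.
destruct l as [l1 l2]; simpl; intros Hl Txy Ht.
set (q := y -h (l1, l2) *h x).
set (g := fun r => (exp (l1 * r) * cos (l2 * r), exp (l1 * r) * sin (l2 * r)) *h U r x).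
set (M := exp ((l1 - s) * t) * norm q).
assert (PM : 0 <= M) by (apply Rmult_le_pos; [left; apply exp_pos | apply norm_nonneg]).
(* The derivative is available at positive times only, so the mean value theorem is applied on
   [[a, t]], to the pairing with a fixed [z]; [a] tends to 0 afterwards. *)
assert (Step : forall a, 0 < a < t -> norm (g t -h g a) <= t * M).
{ intros a Ha; apply norm_le_of_rip; [nra |]; intros z; rewrite rip_minus_l.
  assert (Eg : forall r, rip (g r) z = exp (l1 * r) * (cos (l2 * r) * rip (U r x) z - sin (l2 * r) * rip (U r x) (Ci *h z))).
  { intros r; unfold g; rewrite rip_scal_complex; simpl fst; simpl snd.
    replace (rip (Ci *h U r x) z) with (- rip (U r x) (Ci *h z)); [ring |].
    rewrite rip_scal_adj; replace (Cconj Ci *h z) with (RtoC (-1) *h (Ci *h z)) by vec.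
    rewrite rip_scal_r; ring. }
  assert (Ed : forall r, 0 < r -> is_derive (fun r => rip (g r) z) r
    (- (exp (l1 * r) * rip (U r q) (RtoC (cos (l2 * r)) *h z -h RtoC (sin (l2 * r)) *h (Ci *h z))))).
  { intros r Hr; apply is_derive_ext with (fun r => exp (l1 * r) * (cos (l2 * r) * rip (U r x) z - sin (l2 * r) * rip (U r x) (Ci *h z))).
    { intros; symmetry; apply Eg. }
    pose proof (orbit_rip_derive x y z r Txy Hr) as D1; pose proof (orbit_rip_derive x y (Ci *h z) r Txy Hr) as D2.
    replace (- (exp (l1 * r) * rip (U r q) (RtoC (cos (l2 * r)) *h z -h RtoC (sin (l2 * r)) *h (Ci *h z)))) with
      (l1 * exp (l1 * r) * (cos (l2 * r) * rip (U r x) z - sin (l2 * r) * rip (U r x) (Ci *h z)) +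
       exp (l1 * r) * ((- l2 * sin (l2 * r) * rip (U r x) z + cos (l2 * r) * - rip (U r y) z) -
         (l2 * cos (l2 * r) * rip (U r x) (Ci *h z) + sin (l2 * r) * - rip (U r y) (Ci *h z)))).
    - apply (is_derive_Rmult (fun r => exp (l1 * r)) (fun r => cos (l2 * r) * rip (U r x) z - sin (l2 * r) * rip (U r x) (Ci *h z))).
      { auto_derive; auto; ring. }
      apply (is_derive_minus (V := R_NormedModule) (fun r => cos (l2 * r) * rip (U r x) z) (fun r => sin (l2 * r) * rip (U r x) (Ci *h z))).
      + apply (is_derive_Rmult (fun r => cos (l2 * r))); auto; auto_derive; auto; ring.
      + apply (is_derive_Rmult (fun r => sin (l2 * r))); auto; auto_derive; auto; ring.
    - pose proof (C0_linear U HU r ltac:(lra)) as LU.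
      unfold q; rewrite (lin_minus LU), (lin_scal LU), rip_minus_r, !rip_scal_r, !rip_minus_l, !(rip_scal_complex (l1, l2)).
      simpl fst; simpl snd.
      replace (rip (Ci *h U r x) z) with (- rip (U r x) (Ci *h z)).
      2: { rewrite rip_scal_adj; replace (Cconj Ci *h z) with (RtoC (-1) *h (Ci *h z)) by vec; rewrite rip_scal_r; ring. }
      replace (rip (Ci *h U r x) (Ci *h z)) with (rip (U r x) z).
      2: { rewrite rip_scal_adj; f_equal; vec. }
      ring. }
  eapply Rle_trans; [apply Rle_abs |].
  destruct (MVT_gen (fun r => rip (g r) z) a t
    (fun r => - (exp (l1 * r) * rip (U r q) (RtoC (cos (l2 * r)) *h z -h RtoC (sin (l2 * r)) *h (Ci *h z))))) as [r [Hr E]].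
  - rewrite Rmin_left by lra; intros r Hr; apply Ed; lra.
  - rewrite Rmin_left by lra; intros r Hr; apply continuity_pt_filterlim; eapply derive_continuous; apply Ed; lra.
  - rewrite Rmin_left, Rmax_right in Hr by lra.
    rewrite E, Rabs_mult, (Rabs_pos_eq (t - a)), Rabs_Ropp, Rabs_mult, Rabs_pos_eq by (try lra; left; apply exp_pos).
    (* The rotation has been moved onto the test vector, whose norm it preserves. *)
    assert (Nz : norm (RtoC (cos (l2 * r)) *h z -h RtoC (sin (l2 * r)) *h (Ci *h z)) = norm z).
    { replace (RtoC (cos (l2 * r)) *h z -h RtoC (sin (l2 * r)) *h (Ci *h z)) with ((cos (l2 * r), - sin (l2 * r)) *h z) by vec.
      rewrite norm_scal_eq; unfold Cmod; simpl fst; simpl snd.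
      replace (cos (l2 * r) ^ 2 + (- sin (l2 * r)) ^ 2) with 1; [rewrite sqrt_1; ring |].
      pose proof (sin2_cos2 (l2 * r)) as S2; unfold Rsqr in S2; nra. }
    assert (B : exp (l1 * r) * Rabs (rip (U r q) (RtoC (cos (l2 * r)) *h z -h RtoC (sin (l2 * r)) *h (Ci *h z))) <= M * norm z).
    { apply Rle_trans with (exp (l1 * r) * (exp (- (s * r)) * norm q * norm z)).
      - apply Rmult_le_compat_l; [left; apply exp_pos |]; eapply Rle_trans; [apply rip_abs_le |]; rewrite Nz.
        apply Rmult_le_compat_r; [apply norm_nonneg | apply U_decay; lra].
      - replace (exp (l1 * r) * (exp (- (s * r)) * norm q * norm z)) with (exp (l1 * r) * exp (- (s * r)) * (norm q * norm z)) by ring.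
        rewrite <- exp_plus; unfold M; rewrite Rmult_assoc; apply Rmult_le_compat_r.
        + apply Rmult_le_pos; apply norm_nonneg.
        + assert (L : l1 * r + - (s * r) <= (l1 - s) * t) by nra.
          destruct L as [L | L]; [left; apply exp_increasing; auto | right; rewrite L; auto]. }
    apply Rle_trans with (M * norm z * t); [| right; ring].
    pose proof (norm_nonneg z); apply Rmult_le_compat; try lra.
    apply Rmult_le_pos; [left; apply exp_pos | apply Rabs_pos]. }
assert (Main : norm (g t -h x) <= t * M).
{ apply le_epsilon; intros eps He.
  assert (Pn : 0 < norm x + 1) by (pose proof (norm_nonneg x); lra).
  destruct (exp_spiral_lim l1 l2 (eps / 2 / (norm x + 1))) as [d1 [Hd1 L1]]; [apply Rdiv_lt_0_compat; lra |].
  destruct (C0_cont_eps HU x (eps / 2)) as [d2 [Hd2 L2]]; [lra |].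
  set (a := Rmin t (Rmin d1 d2) / 2).
  assert (0 < Rmin t (Rmin d1 d2)) by (repeat apply Rmin_pos; auto).
  pose proof (Rmin_l t (Rmin d1 d2)); pose proof (Rmin_r t (Rmin d1 d2)).
  pose proof (Rmin_l d1 d2); pose proof (Rmin_r d1 d2).
  specialize (L1 a ltac:(unfold a; lra)); specialize (L2 a ltac:(unfold a; lra)).
  specialize (Step a ltac:(unfold a; lra)).
  pose proof (norm_tri (g t) (g a) x).
  assert (norm (g a -h x) <= eps); [| lra].
  replace (g a -h x) with ((exp (l1 * a) * cos (l2 * a) - 1, exp (l1 * a) * sin (l2 * a)) *h U a x +h (U a x -h x))
    by (unfold g; vec).
  eapply Rle_trans; [apply h_triangle |]; rewrite norm_scal_eq.
  pose proof (hy_contr MA a x ltac:(unfold a; lra)).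
  assert (Cmod (exp (l1 * a) * cos (l2 * a) - 1, exp (l1 * a) * sin (l2 * a)) * norm (U a x) <= eps / 2 / (norm x + 1) * (norm x + 1)).
  { apply Rmult_le_compat; auto using Cmod_ge_0, norm_nonneg; lra. }
  replace (eps / 2 / (norm x + 1) * (norm x + 1)) with (eps / 2) in * by (field; lra); lra. }
replace (U t x -h (exp (- (l1 * t)) * cos (l2 * t), - (exp (- (l1 * t)) * sin (l2 * t))) *h x)
  with ((exp (- (l1 * t)) * cos (l2 * t), - (exp (- (l1 * t)) * sin (l2 * t))) *h (g t -h x)).
2: { assert (Sq : cos (l2 * t) ^ 2 + sin (l2 * t) ^ 2 = 1).
     { pose proof (sin2_cos2 (l2 * t)) as S2; unfold Rsqr in S2; nra. }
     assert (Ee : exp (- (l1 * t)) * exp (l1 * t) = 1) by (rewrite <- exp_plus, Rplus_opp_l, exp_0; auto).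
     unfold g; vec_z; cpair.
     set (e1 := exp (- (l1 * t))) in *; set (e2 := exp (l1 * t)) in *.
     set (co := cos (l2 * t)) in *; set (si := sin (l2 * t)) in *.
     f_equal.
     - transitivity (e1 * e2 * (co ^ 2 + si ^ 2) * u - (e1 * co * u0 + e1 * si * v0)); [ring |].
       rewrite Ee, Sq; ring.
     - transitivity (e1 * e2 * (co ^ 2 + si ^ 2) * v - (e1 * co * v0 - e1 * si * u0)); [ring |].
       rewrite Ee, Sq; ring. }
rewrite norm_scal_eq.
replace (Cmod (exp (- (l1 * t)) * cos (l2 * t), - (exp (- (l1 * t)) * sin (l2 * t)))) with (exp (- (l1 * t))).
2: { unfold Cmod; simpl fst; simpl snd.
     replace ((exp (- (l1 * t)) * cos (l2 * t)) ^ 2 + (- (exp (- (l1 * t)) * sin (l2 * t))) ^ 2) with (exp (- (l1 * t)) ^ 2).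
     - symmetry; apply sqrt_pow2; left; apply exp_pos.
     - pose proof (sin2_cos2 (l2 * t)) as S2; unfold Rsqr in S2.
       replace ((exp (- (l1 * t)) * cos (l2 * t)) ^ 2 + (- (exp (- (l1 * t)) * sin (l2 * t))) ^ 2)
         with (exp (- (l1 * t)) ^ 2 * (sin (l2 * t) * sin (l2 * t) + cos (l2 * t) * cos (l2 * t))) by ring.
       rewrite S2; ring. }
apply Rle_trans with (exp (- (l1 * t)) * (t * M)).
- apply Rmult_le_compat_l; [left; apply exp_pos | exact Main].
- right; unfold M.
  replace (exp (- (l1 * t)) * (t * (exp ((l1 - s) * t) * norm q)))
    with (t * (exp (- (l1 * t)) * exp ((l1 - s) * t)) * norm q) by ring.
  rewrite <- exp_plus; do 3 f_equal; ring.
Qed.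

(** The estimate for the semigroup integrated against t^(b-1); its factor [t] raises the exponent of
    the moment from [b] to [b + 1]. *)
Lemma npow_approx b (l : C) x y : 0 < b -> s <= fst l -> T x y ->
  norm (RtoC (Gamma b) *h npow b x -h (cosint b (fst l) (snd l), - sinint b (fst l) (snd l)) *h x)
    <= gint (b + 1) s * norm (y -h l *h x).
Proof.
intros Hb Hl Txy; set (d := norm (y -h l *h x)).
assert (Hl0 : 0 < fst l) by lra.
assert (Pgi : 0 < gint (b + 1) s).
{ pose proof (gint_scaling (b + 1) s ltac:(lra) Hs); pose proof (Gamma_pos (b + 1) ltac:(lra)); pose proof (Rpower_pos s (b + 1)); nra. }
apply norm_le_of_rip; [apply Rmult_le_pos; [lra | apply norm_nonneg] |]; intros z.
eapply Rle_trans; [apply Rle_abs |].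
replace (gint (b + 1) s * d * norm z) with (d * norm z * gint (b + 1) s) by ring.
rewrite rip_minus_l, rip_scal_l, rip_scal_complex; simpl fst; simpl snd.
set (p := rip x z); set (j := rip (Ci *h x) z).
apply (rint_abs_le (fun t => Rpower t (b - 1) * rip (U t x) z -
  (p * (gkernel b (fst l) t * cos (snd l * t)) + (- j) * (gkernel b (fst l) t * sin (snd l * t))))
  (fun t => d * norm z * gkernel (b + 1) s t)).
- intros t Ht.
  set (w := U t x -h (exp (- (fst l * t)) * cos (snd l * t), - (exp (- (fst l * t)) * sin (snd l * t))) *h x).
  replace (Rpower t (b - 1) * rip (U t x) z -
    (p * (gkernel b (fst l) t * cos (snd l * t)) + - j * (gkernel b (fst l) t * sin (snd l * t))))
    with (Rpower t (b - 1) * rip w z).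
  2: { unfold w, gkernel; rewrite rip_minus_l, rip_scal_complex; simpl fst; simpl snd; fold p j; ring. }
  rewrite Rabs_mult, Rabs_pos_eq, gkernel_S by (auto; left; apply Rpower_pos); unfold gkernel.
  replace (d * norm z * (t * (Rpower t (b - 1) * exp (- (s * t)))))
    with (Rpower t (b - 1) * (t * exp (- (s * t)) * d * norm z)) by ring.
  apply Rmult_le_compat_l; [left; apply Rpower_pos |].
  eapply Rle_trans; [apply rip_abs_le |]; apply Rmult_le_compat_r; [apply norm_nonneg | apply U_approx; auto].
- replace (Gamma b * rip (npow b x) z - (cosint b (fst l) (snd l) * p + - sinint b (fst l) (snd l) * j))
    with (Gamma b * rip (npow b x) z - (p * cosint b (fst l) (snd l) + (- j) * sinint b (fst l) (snd l))) by ring.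
  apply rint_minus; [apply npow_rint; auto | apply rint_plus; apply rint_scal; [apply cosint_spec | apply sinint_spec]; auto].
- apply rint_scal, gint_spec; lra.
Qed.

(* The value of l^(-b) given by the Gamma integral; only its modulus is ever needed, so no branch of the power appears. *)
Definition cpow_neg (b : R) (l : C) : C := (cosint b (fst l) (snd l) / Gamma b, - sinint b (fst l) (snd l) / Gamma b).

Lemma cpow_neg_mod b (l : C) : 0 < b -> 0 < fst l -> Cmod (cpow_neg b l) = / Rpower (Cmod l) b.
Proof.
intros Hb Hl; pose proof (gamma_modulus b (fst l) (snd l) Hb Hl) as E; pose proof (Gamma_pos b Hb) as Pg.
assert (Pm : 0 < fst l ^ 2 + snd l ^ 2) by nra.
assert (Er : Rpower (fst l ^ 2 + snd l ^ 2) b = Rpower (Cmod l) b ^ 2).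
{ unfold Cmod; set (m := fst l ^ 2 + snd l ^ 2) in *.
  assert (0 < sqrt m) by (apply sqrt_lt_R0; auto).
  rewrite <- (sqrt_sqrt m) at 1 by lra; rewrite <- Rpower_mult_distr by auto; ring. }
rewrite Er in E; pose proof (Rpower_pos (Cmod l) b) as Pr.
set (r := Rpower (Cmod l) b) in *.
unfold Cmod at 1, cpow_neg; simpl fst; simpl snd.
replace ((cosint b (fst l) (snd l) / Gamma b) ^ 2 + (- sinint b (fst l) (snd l) / Gamma b) ^ 2) with ((/ r) ^ 2).
- apply sqrt_pow2; left; apply Rinv_0_lt_compat; auto.
- set (c := cosint b (fst l) (snd l)) in *; set (d := sinint b (fst l) (snd l)) in *.
  apply Rmult_eq_reg_r with ((r * Gamma b) ^ 2); [| apply pow_nonzero; nra].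
  replace ((/ r) ^ 2 * (r * Gamma b) ^ 2) with (Gamma b ^ 2) by (field; lra).
  rewrite <- E; field; lra.
Qed.

Lemma npow_approx_eigen b (l : C) x y : 0 < b -> s <= fst l -> T x y ->
  norm (npow b x -h cpow_neg b l *h x) <= gint (b + 1) s / Gamma b * norm (y -h l *h x).
Proof.
intros Hb Hl Txy; pose proof (npow_approx b l x y Hb Hl Txy) as B; pose proof (Gamma_pos b Hb) as Pg.
apply Rmult_le_reg_l with (Gamma b); auto.
replace (Gamma b * norm (npow b x -h cpow_neg b l *h x))
  with (norm (RtoC (Gamma b) *h npow b x -h (cosint b (fst l) (snd l), - sinint b (fst l) (snd l)) *h x)).
- eapply Rle_trans; [exact B |]; right; field; lra.
- rewrite <- (Rabs_pos_eq (Gamma b)) at 2 by lra; rewrite <- norm_scal_R_eq; f_equal.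
  unfold cpow_neg; vec; lra.
Qed.

(** The adjoint [K'] carries [K] to the test vector, so it never has to be pulled out of a
    vector-valued integral. *)
Lemma npow_commute (K K' : H -> H) b x : 0 < b ->
  (forall x y, rip (K x) y = rip x (K' y)) -> (forall t x, 0 <= t -> K (U t x) = U t (K x)) ->
  K (npow b x) = npow b (K x).
Proof.
intros Hb Adj C; symmetry; apply npow_char; auto; intros y; rewrite Adj.
eapply rint_ext; [| apply npow_rint; auto].
intros t Ht; cbv beta; rewrite <- C by lra; rewrite Adj; auto.
Qed.
End NegPow.
Arguments npow {H} T b x.

(** Adjointness of single Euler steps passes to their powers, taken with the same step count on both
    sides, and then to the limits. *)
Lemma hy_adjoint {H : Hilbert} {T T' : op H} (MA : m_accretive T) (MA' : m_accretive T') :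
  (forall h x y, 0 < h -> rip (resolvent T h x) y = rip x (resolvent T' h y)) ->
  forall t (x y : H), 0 <= t -> rip (hy_semigroup T t x) y = rip x (hy_semigroup T' t y).
Proof.
intros A t x y Ht.
assert (E : forall h n u v, 0 < h -> rip (euler T h n u) v = rip u (euler T' h n v)).
{ intros h n u v Hh; revert u v; induction n as [| n IH]; intros u v; auto.
  rewrite (euler_S (T := T')); simpl; rewrite A by auto; apply IH. }
apply Rminus_diag_uniq; apply cond_eq; intros eps He; rewrite Rminus_0_r.
pose proof (norm_nonneg x) as Nx; pose proof (norm_nonneg y) as Ny.
set (e := eps / (2 * (norm x + norm y + 1))).
assert (Pe : 0 < e) by (apply Rdiv_lt_0_compat; lra).
destruct (hy_lim MA t x Ht e Pe) as [K1 L1]; destruct (hy_lim MA' t y Ht e Pe) as [K2 L2].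
specialize (L1 (K1 + K2)%nat ltac:(lia)); specialize (L2 (K1 + K2)%nat ltac:(lia)).
set (k := (K1 + K2)%nat) in *.
set (u := hy_semigroup T t x) in *; set (v := hy_semigroup T' t y) in *.
assert (Ek : rip (euler_t T t k x) y = rip x (euler_t T' t k y)) by (apply E, step_pos).
replace (rip u y - rip x v) with (rip x (euler_t T' t k y -h v) - rip (euler_t T t k x -h u) y)
  by (rewrite rip_minus_l, rip_minus_r, Ek; ring).
eapply Rle_lt_trans; [apply Rabs_triang |]; rewrite Rabs_Ropp.
pose proof (rip_abs_le x (euler_t T' t k y -h v)); pose proof (rip_abs_le (euler_t T t k x -h u) y).
assert (norm x * norm (euler_t T' t k y -h v) <= norm x * e) by (apply Rmult_le_compat_l; auto).
assert (norm (euler_t T t k x -h u) * norm y <= e * norm y) by (apply Rmult_le_compat_r; auto).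
assert (e * (2 * (norm x + norm y + 1)) = eps) by (unfold e; field; lra).
nra.
Qed.

Lemma npow_adjoint {H : Hilbert} {T T' : op H} {s : R} (G : good s T) (G' : good s T') b :
  0 < b -> (forall h x y, 0 < h -> rip (resolvent T h x) y = rip x (resolvent T' h y)) ->
  forall x y : H, rip (npow T b x) y = rip x (npow T' b y).
Proof.
intros Hb A x y; pose proof (Gamma_pos b Hb).
apply Rmult_eq_reg_l with (Gamma b); [| lra].
apply (rint_unique _ _ _ (npow_rint G b x y Hb)).
rewrite (rip_sym x); eapply rint_ext; [| apply (npow_rint G' b y x Hb)].
intros t Ht; cbv beta; rewrite (hy_adjoint (good_acc s T G) (good_acc s T' G') A t x y) by lra; rewrite (rip_sym x); auto.
Qed.

(** * Self-adjoint operators *)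

Lemma vlim_inner_eq {H : Hilbert} (u v : nat -> H) x y a b :
  vlim u x -> vlim v y -> (forall k, inner (u k) a = inner (v k) b) -> inner x a = inner y b.
Proof.
intros Lu Lv E.
assert (Re1 : forall (u v : nat -> H) x y a b, vlim u x -> vlim v y ->
  (forall k, rip (u k) a = rip (v k) b) -> rip x a = rip y b).
{ clear; intros u v x y a b Lu Lv E; apply Rminus_diag_uniq, cond_eq; intros eps He; rewrite Rminus_0_r.
  pose proof (norm_nonneg a) as Na; pose proof (norm_nonneg b) as Nb.
  set (e := eps / (2 * (norm a + norm b + 1))).
  assert (Pe : 0 < e) by (apply Rdiv_lt_0_compat; lra).
  destruct (Lu e Pe) as [K1 L1]; destruct (Lv e Pe) as [K2 L2].
  specialize (L1 (K1 + K2)%nat ltac:(lia)); specialize (L2 (K1 + K2)%nat ltac:(lia)).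
  set (k := (K1 + K2)%nat) in *.
  replace (rip x a - rip y b) with (rip (v k -h y) b - rip (u k -h x) a) by (rewrite !rip_minus_l, E; ring).
  eapply Rle_lt_trans; [apply Rabs_triang |]; rewrite Rabs_Ropp.
  pose proof (rip_abs_le (v k -h y) b); pose proof (rip_abs_le (u k -h x) a).
  assert (norm (v k -h y) * norm b <= e * norm b) by (apply Rmult_le_compat_r; auto).
  assert (norm (u k -h x) * norm a <= e * norm a) by (apply Rmult_le_compat_r; auto).
  assert (e * (2 * (norm a + norm b + 1)) = eps) by (unfold e; field; lra).
  nra. }
apply injective_projections.
- apply (Re1 u v); auto; intros k; unfold rip; rewrite E; auto.
- pose proof (Re1 (fun k => Ci *h u k) (fun k => Ci *h v k) _ _ a b (vlim_scal Ci u x Lu) (vlim_scal Ci v y Lv)) as I.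
  pose proof (im_inner_rip x a) as I1; pose proof (im_inner_rip y b) as I2.
  unfold Im in *; rewrite I1, I2, I; auto.
  intros k; pose proof (im_inner_rip (u k) a) as J1; pose proof (im_inner_rip (v k) b) as J2.
  rewrite E in J1; lra.
Qed.

Section SelfAdjoint.
Context {H : Hilbert} {B : op H} (SB : self_adjoint B).
Implicit Types x y z u v w : H.
Let LB : linear_op B := proj1 SB.

Lemma sa_iff y v : B y v <-> forall x u, B x u -> inner u y = inner x v.
Proof. symmetry; apply (proj2 (proj2 SB) y v). Qed.

Lemma sa_sym x u y v : B x u -> B y v -> inner u y = inner x v.
Proof. intros Bx By; apply (proj1 (sa_iff y v) By); auto. Qed.

Lemma sa_real x u : B x u -> rip (Ci *h u) x = 0.
Proof.
intros Bx; pose proof (sa_sym x u x u Bx Bx) as E; rewrite (inner_conj _ u x) in E.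
unfold rip; inner_expand; destruct (inner u x) as [p q]; unfold Cconj in E; simpl in *.
apply (f_equal snd) in E; simpl in E; unfold Re; simpl; lra.
Qed.

(** An adjoint is closed, and [B] equals its adjoint. *)
Lemma sa_closed (x u : nat -> H) a b : (forall k, B (x k) (u k)) -> vlim x a -> vlim u b -> B a b.
Proof.
intros Bk La Lb; apply sa_iff; intros y v By.
rewrite (inner_conj _ a v), (inner_conj _ b y).
f_equal; apply (vlim_inner_eq x u a b v y La Lb).
intros k; rewrite (sa_sym _ _ _ _ (Bk k) By); auto.
Qed.

(** With l = a + ib, the vectors i (B + b) x and a x are orthogonal for the real inner product,
    since the quadratic form of B + b is real. *)
Lemma shift_norm_sq (l : C) x u : B x u ->
  norm (Ci *h u +h l *h x) ^ 2 = norm (u +h RtoC (snd l) *h x) ^ 2 + fst l ^ 2 * norm x ^ 2.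
Proof.
intros Bx; destruct l as [a b]; simpl fst; simpl snd.
set (w := u +h RtoC b *h x).
replace (Ci *h u +h (a, b) *h x) with (Ci *h w +h RtoC a *h x) by (unfold w; vec).
rewrite norm_sq_plus, !norm_scal_eq, rip_scal_r, Cmod_Ci, Cmod_R.
assert (Z : rip (Ci *h w) x = 0).
{ replace (Ci *h w) with (Ci *h u +h Ci *h (RtoC b *h x)) by (unfold w; vec).
  rewrite rip_plus_l, sa_real by auto.
  unfold rip; inner_expand; rewrite inner_norm; unfold Re; simpl; ring. }
rewrite Z, Rmult_0_r, Rmult_0_r, Rplus_0_r, Rmult_1_l, Rpow_mult_distr, pow2_abs; auto.
Qed.

(** A condition on iB + l that holds off the imaginary axis and may also hold at imaginary [l]; the
    latter case is what describes the spectrum. *)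
Definition bounded_below (l : C) (d : R) : Prop :=
  0 < d /\ forall x u, B x u -> d * norm x <= norm (Ci *h u +h l *h x).

Lemma bounded_below_Re (l : C) : fst l <> 0 -> bounded_below l (Rabs (fst l)).
Proof.
intros N; split; [apply Rabs_pos_lt; auto |]; intros x u Bx.
apply sq_le_le; [apply norm_nonneg |].
rewrite (shift_norm_sq l x u Bx), Rpow_mult_distr, pow2_abs.
pose proof (pow2_ge_0 (norm (u +h RtoC (snd l) *h x))); lra.
Qed.

(** The range is closed because [B] is closed and the lower bound makes preimages Cauchy. A vector
    orthogonal to the range is an eigenvector of [B]; realness of its eigenvalue forces Re l = 0
    unless it vanishes, and then iB + l annihilates it, against the lower bound. *)
Lemma shift_surjective (l : C) d : bounded_below l d -> forall z, exists x u, B x u /\ z = Ci *h u +h l *h x.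
Proof.
intros [Pd BB].
apply (closed_subspace_full (fun z => exists x u, B x u /\ z = Ci *h u +h l *h x)).
- exists 0h, 0h; split; [apply (lop_zero LB) | vec].
- intros p q [x [u [Bx ->]]] [y [v [By ->]]]; exists (x +h y), (u +h v); split; [apply (lop_plus LB); auto | vec].
- intros a p [x [u [Bx ->]]]; exists (a *h x), (a *h u); split; [apply (lop_scal LB); auto | vec].
- intros z l0 Mz Lz; destruct (choice _ Mz) as [x Hx]; destruct (choice _ Hx) as [u Hu].
  assert (Lip : forall k m, norm (x k -h x m) <= / d * norm (z k -h z m)).
  { intros k m; destruct (Hu k) as [Bk Ek]; destruct (Hu m) as [Bm Em].
    apply Rmult_le_reg_l with d; auto; rewrite <- Rmult_assoc, Rinv_r, Rmult_1_l by lra.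
    eapply Rle_trans; [apply BB with (u := u k -h u m); apply (lop_minus LB); auto |].
    rewrite Ek, Em; right; f_equal; vec. }
  destruct (cauchy_vlim x) as [a La].
  { intros eps He; destruct (Lz (eps * d / 2)) as [K HK]; [nra |].
    exists K; intros k m Hk Hm; eapply Rle_trans; [apply Lip |].
    pose proof (HK k Hk) as A1; pose proof (HK m Hm) as A2.
    pose proof (norm_tri (z k) l0 (z m)) as A3; rewrite (norm_minus_sym l0) in A3.
    apply Rmult_le_reg_l with d; auto; rewrite <- Rmult_assoc, Rinv_r, Rmult_1_l by lra; lra. }
  set (b := Copp Ci *h (l0 -h l *h a)).
  exists a, b; split.
  + apply sa_closed with x u; auto; [intros k; apply Hu |].
    apply vlim_ext with (fun k => Copp Ci *h (z k +h Copp l *h x k)).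
    * intros k; destruct (Hu k) as [_ ->]; vec.
    * replace b with (Copp Ci *h (l0 +h Copp l *h a)) by (unfold b; vec).
      apply vlim_scal, vlim_plus; auto; apply vlim_scal; auto.
  + unfold b; vec.
- intros z0 Orth.
  assert (Bz : B z0 (Cconj (Cmult Ci l) *h z0)).
  { apply sa_iff; intros x u Bx.
    pose proof (Orth _ (ex_intro _ x (ex_intro _ u (conj Bx eq_refl)))) as E; revert E; inner_expand.
    destruct l as [l1 l2]; destruct (inner u z0) as [p q]; destruct (inner x z0) as [p' q'].
    unfold Cconj, Cmult, Cplus, Ci, RtoC; simpl; intros E.
    pose proof (f_equal fst E) as E1; pose proof (f_equal snd E) as E2; simpl in E1, E2; f_equal; lra. }
  pose proof (sa_real _ _ Bz) as Rl.
  unfold rip in Rl; revert Rl; inner_expand; rewrite inner_norm; destruct l as [l1 l2].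
  unfold Re, Cconj, Cmult, Ci, RtoC; simpl; intros Rl.
  destruct (Req_dec (norm z0) 0) as [N | N]; [apply h_norm_eq_zero; auto |].
  assert (Z : l1 = 0).
  { apply Rmult_eq_reg_r with (norm z0 * norm z0); [| nra]; lra. }
  pose proof (BB _ _ Bz) as L; apply h_norm_eq_zero.
  replace (Ci *h (Cconj (Cmult Ci (l1, l2)) *h z0) +h (l1, l2) *h z0) with (0h : H) in L.
  + rewrite norm_zero_eq in L; pose proof (norm_nonneg z0); nra.
  + subst l1; vec.
Qed.

(** This is (iB + l)^(-1), so the sign of [l] is opposite to that of the usual resolvent
    parameter. *)
Definition Res (l : C) (z : H) : H :=
  epsilon (inhabits (0h : H)) (fun x => exists u, B x u /\ z = Ci *h u +h l *h x).

Lemma Res_spec l d z : bounded_below l d -> exists u, B (Res l z) u /\ z = Ci *h u +h l *h Res l z.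
Proof. intros BB; unfold Res; apply epsilon_spec, (shift_surjective l d BB). Qed.

Lemma Res_eq l d x u z : bounded_below l d -> B x u -> z = Ci *h u +h l *h x -> Res l z = x.
Proof.
intros BB Bx ->; destruct (Res_spec l d (Ci *h u +h l *h x) BB) as [v [Bv E]].
set (w := Res l (Ci *h u +h l *h x)) in *.
apply minus_zero_eq; destruct BB as [Pd BB].
pose proof (BB _ _ (lop_minus LB _ _ _ _ Bv Bx)) as L.
replace (Ci *h (v -h u) +h l *h (w -h x)) with ((Ci *h v +h l *h w) -h (Ci *h u +h l *h x)) in L by vec.
rewrite <- E in L; replace (Ci *h u +h l *h x -h (Ci *h u +h l *h x)) with (0h : H) in L by vec.
rewrite norm_zero_eq in L; pose proof (norm_nonneg (w -h x)); nra.
Qed.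

Lemma Res_bound l d z : bounded_below l d -> norm (Res l z) <= / d * norm z.
Proof.
intros BB; destruct (Res_spec l d z BB) as [u [Bu E]]; destruct BB as [Pd BB].
pose proof (BB _ _ Bu) as L; rewrite <- E in L.
apply Rmult_le_reg_l with d; auto; rewrite <- Rmult_assoc, Rinv_r, Rmult_1_l by lra; lra.
Qed.

Lemma Res_linear l d : bounded_below l d -> is_linear (Res l).
Proof.
intros BB; constructor.
- intros x y; destruct (Res_spec l d x BB) as [u [Bu E]]; destruct (Res_spec l d y BB) as [v [Bv F]].
  apply Res_eq with d (u +h v); auto; [apply (lop_plus LB); auto |].
  change (x +h y = Ci *h (u +h v) +h l *h (Res l x +h Res l y)); rewrite E at 1; rewrite F at 1; vec.
- intros a x; destruct (Res_spec l d x BB) as [u [Bu E]].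
  apply Res_eq with d ((a : C) *h u); auto; [apply (lop_scal LB); auto |].
  change ((a : C) *h x = Ci *h ((a : C) *h u) +h l *h ((a : C) *h Res l x)); rewrite E at 1; vec.
- exists (/ d); split; [apply Rinv_0_lt_compat, BB |]; intros x; apply Res_bound; auto.
Qed.

Lemma Res_commute l d m e z : bounded_below l d -> bounded_below m e -> Res l (Res m z) = Res m (Res l z).
Proof.
intros BL BM; destruct (Res_spec m e z BM) as [u [Bu E]]; destruct (Res_spec l d (Res m z) BL) as [v [Bv F]].
set (p := Res m z) in *; set (q := Res l p) in *.
(* This is (iB + m) q. It lies in the domain of [B] and solves (iB + l) y = z, so it is [Res l z],
   while [q] is [Res m y]. *)
set (y := Ci *h v +h m *h q).
assert (By : B y (Copp Ci *h (z -h l *h y))).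
{ replace (Copp Ci *h (z -h l *h y)) with
    (Ci *h (Copp Ci *h (u -h l *h v)) +h m *h v).
  - replace y with (Ci *h v +h m *h q) by auto.
    apply (lop_plus LB); apply (lop_scal LB); auto.
    replace v with (Copp Ci *h (p -h l *h q)) at 1 by (rewrite F; vec).
    apply (lop_scal LB), (lop_minus LB); auto; apply (lop_scal LB); auto.
  - unfold y; rewrite E; rewrite F; vec. }
rewrite (Res_eq l d y _ z BL By) by vec.
symmetry; apply Res_eq with e v; auto.
Qed.

(** The adjoint of iB + l is - iB + conj(l), that is, minus iB - conj(l); this explains both
    signs. *)
Lemma Res_adjoint l d e x y : bounded_below l d -> bounded_below (Copp (Cconj l)) e ->
  rip (Res l x) y = rip x (~h Res (Copp (Cconj l)) y).
Proof.
intros BL BM; destruct (Res_spec l d x BL) as [u [Bu E]]; destruct (Res_spec _ e y BM) as [v [Bv F]].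
set (p := Res l x) in *; set (q := Res (Copp (Cconj l)) y) in *.
rewrite E, F, rip_opp_r; pose proof (sa_sym _ _ _ _ Bu Bv) as S.
unfold rip; inner_expand; rewrite S; destruct l as [l1 l2].
destruct (inner p v), (inner p q); unfold Re, Cplus, Cmult, Copp, Cconj, Ci; simpl; ring.
Qed.

(** The operator e iB + sg. Only [e = 1] and its adjoint case [e = -1] are used; a real factor [e]
    treats both at once. *)
Definition shift_op (e sg : R) : op H := fun x y => exists u, B x u /\ y = (0, e) *h u +h RtoC sg *h x.

Lemma shift_op_rip e sg x y : shift_op e sg x y -> rip y x = sg * norm x ^ 2.
Proof.
intros [u [Bu ->]]; rewrite rip_plus_l, rip_scal_l, norm_sq_rip, (rip_scal_complex (0, e)); simpl fst; simpl snd.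
rewrite (sa_real _ _ Bu); ring.
Qed.

Lemma shift_op_linear e sg : linear_op (shift_op e sg).
Proof.
split; [| split; [| split]].
- intros x y z [u [Bu ->]] [v [Bv ->]]; rewrite (lop_fun LB _ _ _ Bu Bv); auto.
- exists 0h; split; [apply (lop_zero LB) |].
  change ((0h : H) = (0, e) *h 0h +h RtoC sg *h 0h); vec.
- intros x y p q [u [Bu ->]] [v [Bv ->]]; exists (u +h v); split; [apply (lop_plus LB); auto |].
  change (((0, e) *h u +h RtoC sg *h x) +h ((0, e) *h v +h RtoC sg *h y) = (0, e) *h (u +h v) +h RtoC sg *h (x +h y)); vec.
- intros a x p [u [Bu ->]]; exists (a *h u); split; [apply (lop_scal LB); auto |].
  change (a *h ((0, e) *h u +h RtoC sg *h x) = (0, e) *h (a *h u) +h RtoC sg *h (a *h x)); vec.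
Qed.

Lemma shift_op_dense e sg : densely_defined (shift_op e sg).
Proof.
intros x eps; destruct (proj1 (proj2 SB) x eps) as [y [[u Bu] L]].
exists y; split; auto; eexists; exists u; split; eauto.
Qed.

(** The equation x + h (e iB + sg) x = z, divided by [h e], is (iB + (1 + h sg)/(h e)) x = z/(h e),
    with a nonzero real shift. *)
Lemma shift_resolvent e sg h z : e <> 0 -> 0 < h -> 0 < sg ->
  exists u, B (Res (RtoC ((1 + h * sg) / (h * e))) (RtoC (/ (h * e)) *h z)) u /\
    z = Res (RtoC ((1 + h * sg) / (h * e))) (RtoC (/ (h * e)) *h z) +h
        RtoC h *h ((0, e) *h u +h RtoC sg *h Res (RtoC ((1 + h * sg) / (h * e))) (RtoC (/ (h * e)) *h z)).
Proof.
intros He Hh Hs; set (l := RtoC ((1 + h * sg) / (h * e))).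
assert (N : fst l <> 0).
{ unfold l; simpl; apply Rmult_integral_contrapositive_currified; [nra | apply Rinv_neq_0_compat; nra]. }
destruct (Res_spec l _ (RtoC (/ (h * e)) *h z) (bounded_below_Re l N)) as [u [Bu E]].
exists u; split; auto; set (x := Res l (RtoC (/ (h * e)) *h z)) in *.
replace z with (RtoC (h * e) *h (RtoC (/ (h * e)) *h z)) at 1 by (vec; lra).
rewrite E; unfold l; vec; lra.
Qed.

Lemma shift_op_good e sg : e <> 0 -> 0 < sg -> good sg (shift_op e sg).
Proof.
intros He Hs; constructor; auto; [constructor |].
- apply shift_op_linear.
- apply shift_op_dense.
- intros x y S; rewrite (shift_op_rip e sg x y S); apply Rmult_le_pos; [lra | apply pow2_ge_0].
- intros h Hh z; destruct (shift_resolvent e sg h z He Hh Hs) as [u [Bu E]].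
  eexists; eexists; split; [exists u; split; [exact Bu | reflexivity] | exact E].
- split; [apply shift_op_linear | split; [apply shift_op_dense |]].
  intros x y S; rewrite (shift_op_rip e sg x y S); lra.
Qed.

Lemma shift_op_resolvent_eq e sg h z : e <> 0 -> 0 < h -> 0 < sg ->
  resolvent (shift_op e sg) h z = Res (RtoC ((1 + h * sg) / (h * e))) (RtoC (/ (h * e)) *h z).
Proof.
intros He Hh Hs; destruct (shift_resolvent e sg h z He Hh Hs) as [u [Bu E]].
eapply (resolvent_eq (good_acc _ _ (shift_op_good e sg He Hs))); [auto | exists u; split; [exact Bu | reflexivity] | exact E].
Qed.

Lemma shift_op_adjoint sg h x y : 0 < h -> 0 < sg ->
  rip (resolvent (shift_op 1 sg) h x) y = rip x (resolvent (shift_op (-1) sg) h y).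
Proof.
intros Hh Hs.
destruct (resolvent_spec (good_acc _ _ (shift_op_good 1 sg ltac:(lra) Hs)) h x Hh) as [p [[u [Bu ->]] E]].
destruct (resolvent_spec (good_acc _ _ (shift_op_good (-1) sg ltac:(lra) Hs)) h y Hh) as [q [[v [Bv ->]] F]].
set (a := resolvent (shift_op 1 sg) h x) in *; set (b := resolvent (shift_op (-1) sg) h y) in *.
rewrite E, F; pose proof (sa_sym _ _ _ _ Bu Bv) as S.
unfold rip; inner_expand; rewrite S.
destruct (inner a v), (inner a b); unfold Re, Cplus, Cmult, Copp, Cconj, Ci, RtoC; simpl; ring.
Qed.

Lemma Res_commute_resolvent m d e sg h z : bounded_below m d -> e <> 0 -> 0 < h -> 0 < sg ->
  Res m (resolvent (shift_op e sg) h z) = resolvent (shift_op e sg) h (Res m z).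
Proof.
intros BM He Hh Hs; rewrite !shift_op_resolvent_eq by auto.
assert (N : fst (RtoC ((1 + h * sg) / (h * e))) <> 0).
{ simpl; apply Rmult_integral_contrapositive_currified; [nra | apply Rinv_neq_0_compat; nra]. }
rewrite (Res_commute m d _ _ _ BM (bounded_below_Re _ N)), (lin_scal (Res_linear m d BM)); auto.
Qed.

Lemma npow_Res_commute m e sg b x : fst m <> 0 -> e <> 0 -> 0 < sg -> 0 < b ->
  Res m (npow (shift_op e sg) b x) = npow (shift_op e sg) b (Res m x).
Proof.
intros Hm He Hs Hb; pose proof (bounded_below_Re m Hm) as BM.
assert (Hm' : fst (Copp (Cconj m)) <> 0) by (simpl; lra).
pose proof (bounded_below_Re _ Hm') as BM'.
apply (npow_commute (shift_op_good e sg He Hs) (Res m) (fun y => ~h Res (Copp (Cconj m)) y)); auto.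
- intros; eapply Res_adjoint; eauto.
- intros t y Ht; apply (hy_commute (good_acc _ _ (shift_op_good e sg He Hs))); auto.
  + eapply Res_linear; eauto.
  + intros h z Hh; eapply Res_commute_resolvent; eauto.
Qed.

Definition approx_eigenvalue (lam : R) : Prop :=
  forall eps, 0 < eps -> exists x u, B x u /\ norm x = 1 /\ norm (u -h RtoC lam *h x) <= eps.

Lemma not_bounded_below (l : C) : ~ (exists d, bounded_below (Copp l) d) -> fst l = 0 /\ approx_eigenvalue (snd l).
Proof.
intros N; assert (Z : fst l = 0).
{ destruct (Req_dec (fst l) 0) as [Z | Z]; auto; exfalso; apply N.
  exists (Rabs (fst (Copp l))); apply bounded_below_Re; simpl; lra. }
split; auto; intros eps He; apply NNPP; intros N2; apply N; exists eps; split; auto.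
intros x u Bx; destruct (norm_nonneg x) as [P | P].
2: { rewrite <- P, Rmult_0_r; apply norm_nonneg. }
apply Rnot_lt_le; intros L; apply N2.
exists (RtoC (/ norm x) *h x), (RtoC (/ norm x) *h u); split; [apply (lop_scal LB); auto |].
assert (Pi : 0 < / norm x) by (apply Rinv_0_lt_compat; auto).
split; [rewrite norm_scal_R_eq, Rabs_pos_eq by lra; field; lra |].
replace (RtoC (/ norm x) *h u -h RtoC (snd l) *h (RtoC (/ norm x) *h x))
  with ((Copp Ci) *h (RtoC (/ norm x) *h (Ci *h u +h Copp l *h x))).
- rewrite norm_scal_eq, Cmod_opp, Cmod_Ci, norm_scal_R_eq, Rabs_pos_eq, Rmult_1_l by lra.
  apply Rmult_le_reg_l with (norm x); auto; rewrite <- Rmult_assoc, Rinv_r, Rmult_1_l by lra; lra.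
- destruct l as [l1 l2]; simpl in Z |- *; subst l1; vec; lra.
Qed.

(** By contraposition: if iB - l is bounded below, then [- Res (Copp l)] is a bounded inverse of l -
    iB. *)
Lemma spectrum_iB_inv (l : C) : spectrum (op_scal Ci B) l -> fst l = 0 /\ approx_eigenvalue (snd l).
Proof.
intros Sp; apply not_bounded_below; intros [d BB]; apply Sp.
pose proof (Res_linear _ d BB) as LR.
exists (fun z => (RtoC (-1)) *h Res (Copp l) z); split.
- constructor.
  + intros x y; change (RtoC (-1) *h Res (Copp l) (x +h y) = RtoC (-1) *h Res (Copp l) x +h RtoC (-1) *h Res (Copp l) y).
    rewrite (lin_plus LR); vec.
  + intros a x; change (RtoC (-1) *h Res (Copp l) ((a : C) *h x) = (a : C) *h (RtoC (-1) *h Res (Copp l) x)).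
    rewrite (lin_scal LR); vec.
  + exists (/ d); split; [apply Rinv_0_lt_compat, BB |]; intros x.
    change (norm (RtoC (-1) *h Res (Copp l) x) <= / d * norm x).
    rewrite norm_scal_R_eq, Rabs_left by lra; pose proof (Res_bound _ d x BB); lra.
- intros z x; unfold op_inv, graph; split.
  + intros [p [q [[x' [Ex ->]] [[w [[u [Bu ->]] ->]] ->]]]]; unfold op_id, graph in Ex; subst x'.
    assert (E : Res (Copp l) (RtoC (-1) *h (l *h x +h RtoC (-1) *h (Ci *h u))) = x) by (apply Res_eq with d u; auto; vec).
    rewrite (lin_scal LR) in E; symmetry; exact E.
  + intros ->; destruct (Res_spec _ d z BB) as [u [Bu E]].
    exists (l *h (RtoC (-1) *h Res (Copp l) z)), (RtoC (-1) *h (Ci *h (RtoC (-1) *h u))); split; [| split].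
    * exists (RtoC (-1) *h Res (Copp l) z); split; reflexivity.
    * exists (Ci *h (RtoC (-1) *h u)); split; [| reflexivity].
      exists (RtoC (-1) *h u); split; [apply (lop_scal LB); auto | reflexivity].
    * change (z = l *h (RtoC (-1) *h Res (Copp l) z) +h (RtoC (-1) *h (Ci *h (RtoC (-1) *h u)))).
      rewrite E at 1; vec.
Qed.

Lemma spectrum_iB_intro (lam : R) : approx_eigenvalue lam -> spectrum (op_scal Ci B) (0, lam).
Proof.
intros A [f [Lf E]]; destruct (linear_norm f Lf) as [M [PM HM]].
(* With this residual, an inverse of norm at most [M] would give the unit vector [x] norm at most
   1/2. *)
destruct (A (/ (2 * M))) as [x [u [Bu [Nx L]]]]; [apply Rinv_0_lt_compat; lra |].
set (z := (0, lam) *h x +h RtoC (-1) *h (Ci *h u)).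
assert (Ez : x = f z).
{ apply (E z x); exists ((0, lam) *h x), (RtoC (-1) *h (Ci *h u)); split; [| split]; auto.
  - exists x; split; reflexivity.
  - exists (Ci *h u); split; [| reflexivity]; exists u; split; auto. }
pose proof (HM z) as Bz; rewrite <- Ez in Bz; rewrite Nx in Bz.
assert (Nz : norm z = norm (u -h RtoC lam *h x)).
{ replace z with (Copp Ci *h (u -h RtoC lam *h x)) by (unfold z; vec).
  rewrite norm_scal_eq, Cmod_opp, Cmod_Ci; ring. }
rewrite Nz in Bz.
assert (M * norm (u -h RtoC lam *h x) <= M * / (2 * M)) by (apply Rmult_le_compat_l; lra).
replace (M * / (2 * M)) with (/ 2) in * by (field; lra); lra.
Qed.

Lemma spectrum_B_inv (lam : R) : spectrum B (RtoC lam) -> approx_eigenvalue lam.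
Proof.
intros Sp; apply (not_bounded_below (0, lam)); intros [d BB]; apply Sp.
pose proof (Res_linear _ d BB) as LR; set (l := Copp (0, lam)) in *.
exists (fun z => Res l (Copp Ci *h z)); split.
- constructor.
  + intros x y; change (Res l (Copp Ci *h (x +h y)) = Res l (Copp Ci *h x) +h Res l (Copp Ci *h y)).
    rewrite <- (lin_plus LR); f_equal; vec.
  + intros a x; change (Res l (Copp Ci *h ((a : C) *h x)) = (a : C) *h Res l (Copp Ci *h x)).
    rewrite <- (lin_scal LR); f_equal; vec.
  + exists (/ d); split; [apply Rinv_0_lt_compat, BB |]; intros x.
    eapply Rle_trans; [apply (Res_bound _ d); auto |].
    rewrite norm_scal_eq, Cmod_opp, Cmod_Ci; lra.
- intros z x; unfold op_inv, graph; split.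
  + intros [p [q [[x' [Ex ->]] [[u [Bu ->]] ->]]]]; unfold op_id, graph in Ex; subst x'.
    symmetry; apply Res_eq with d u; auto.
    change (Copp Ci *h (RtoC lam *h x +h RtoC (-1) *h u) = Ci *h u +h l *h x); unfold l; vec.
  + intros ->; destruct (Res_spec _ d (Copp Ci *h z) BB) as [u [Bu E]].
    exists (RtoC lam *h Res l (Copp Ci *h z)), (RtoC (-1) *h u); split; [| split].
    * exists (Res l (Copp Ci *h z)); split; reflexivity.
    * exists u; split; auto; reflexivity.
    * change (z = RtoC lam *h Res l (Copp Ci *h z) +h RtoC (-1) *h u).
      transitivity (Ci *h (Copp Ci *h z)); [vec |]; rewrite E at 1; unfold l; vec.
Qed.
End SelfAdjoint.
Arguments Res {H} B l z.
Arguments shift_op {H} B e sg.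
Arguments approx_eigenvalue {H} B lam.

(** * Functions of a self-adjoint operator *)

Section Joint.
Context {H : Hilbert}.
Variables (p : H -> R) (Y : H -> H) (L : R).
Hypotheses (LY : is_linear Y) (SY : forall x y, rip (Y x) y = rip x (Y y)) (HL : 0 <= L)
  (BY : forall x, norm (Y x) <= L * norm x).
Hypotheses (p_minus : forall x y, p (x -h y) <= p x + p y)
  (p_scal : forall (t : R) x, p (RtoC t *h x) = Rabs t * p x) (p_Y : forall x, p (Y x) <= L * p x).

(* Among the vectors with [p] small, maximize the numerical range of [Y]: the
   maximizers are approximate eigenvectors of [Y], since [y - Y] is
   nonnegative up to small errors there and Cauchy-Schwarz applies to it. *)
Lemma joint_approx_eigenvalue :
  (forall eps, 0 < eps -> exists x, norm x = 1 /\ p x <= eps) ->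
  exists y : R, forall eps, 0 < eps -> exists x, norm x = 1 /\ p x <= eps /\ norm (Y x -h RtoC y *h x) <= eps.
Proof.
intros Ex.
assert (p_nonneg : forall x, 0 <= p x).
{ intros x; pose proof (p_minus x x) as A; replace (x -h x) with (RtoC 0 *h x) in A by vec.
  rewrite p_scal, Rabs_R0 in A; lra. }
set (S := fun r => forall eps, 0 < eps -> exists x, norm x = 1 /\ p x <= eps /\ r <= rip (Y x) x).
assert (Rng : forall x, norm x = 1 -> - L <= rip (Y x) x <= L).
{ intros x Nx; pose proof (rip_abs_le (Y x) x) as A; pose proof (BY x) as A2; rewrite Nx in A, A2.
  assert (A3 : Rabs (rip (Y x) x) <= L) by lra; apply Rabs_le_between in A3; lra. }
destruct (completeness S) as [y [Ub Lb]].
{ exists L; intros r Sr; destruct (Sr 1 Rlt_0_1) as [x [Nx [_ R1]]]; pose proof (Rng x Nx); lra. }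
{ exists (- L); intros eps He; destruct (Ex eps He) as [x [Nx Px]]; exists x; split; auto; split; auto; apply Rng; auto. }
assert (Hy : - L <= y <= L).
{ split.
  - apply Ub; intros eps He; destruct (Ex eps He) as [x [Nx Px]]; exists x; split; auto; split; auto; apply Rng; auto.
  - apply Lb; intros r Sr; destruct (Sr 1 Rlt_0_1) as [x [Nx [_ R1]]]; pose proof (Rng x Nx); lra. }
exists y; intros eps He.
set (C := 2 * L + 1); assert (PC : 0 < C) by (unfold C; lra).
(* The bound [eps ^ 2 / (16 * C)] makes [4 * C * eta], the final bound for the square of [norm v],
   at most [(eps / 2) ^ 2]. *)
set (eta := Rmin 1 (Rmin (eps / 2) (eps ^ 2 / (16 * C)))).
assert (P2 : 0 < eps ^ 2 / (16 * C)) by (apply Rdiv_lt_0_compat; nra).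
assert (Peta : 0 < eta) by (repeat apply Rmin_pos; lra).
assert (E1 : eta <= 1) by apply Rmin_l.
assert (E23 : eta <= Rmin (eps / 2) (eps ^ 2 / (16 * C))) by apply Rmin_r.
pose proof (Rmin_l (eps / 2) (eps ^ 2 / (16 * C))); pose proof (Rmin_r (eps / 2) (eps ^ 2 / (16 * C))).
assert (E3 : 4 * C * eta <= eps ^ 2 / 4).
{ apply Rle_trans with (4 * C * (eps ^ 2 / (16 * C))); [apply Rmult_le_compat_l; lra | right; field; lra]. }
assert (N : exists e0, 0 < e0 /\ forall x, norm x = 1 -> p x <= e0 -> rip (Y x) x <= y + eta).
{ apply NNPP; intros N; assert (y + eta <= y); [| lra].
  apply Ub; intros e1 He1; apply NNPP; intros N2; apply N; exists e1; split; auto.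
  intros x Nx Px; apply Rnot_lt_le; intros Lt; apply N2; exists x; split; auto; split; auto; lra. }
destruct N as [e0 [He0 N]].
assert (Sr : exists r, S r /\ y - eta < r).
{ apply NNPP; intros N2; assert (y <= y - eta); [| lra].
  apply Lb; intros r Sr; apply Rnot_lt_le; intros Lt; apply N2; exists r; auto. }
destruct Sr as [r [Sr Hr]].
destruct (Sr (Rmin eps (e0 / 3))) as [x [Nx [Px Rx]]]; [apply Rmin_pos; lra |].
pose proof (Rmin_l eps (e0 / 3)); pose proof (Rmin_r eps (e0 / 3)).
exists x; split; auto; split; [lra |].
set (v := RtoC (y + eta) *h x -h Y x).
set (t := / (2 * C)); assert (Pt : 0 < t) by (apply Rinv_0_lt_compat; lra).
assert (tC : t * C = / 2) by (unfold t; field; lra).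
assert (Zb : forall z, norm (RtoC (y + eta) *h z -h Y z) <= C * norm z).
{ intros z; eapply Rle_trans; [apply norm_minus_le |]; rewrite norm_scal_R_eq.
  pose proof (BY z); pose proof (norm_nonneg z).
  assert (Rabs (y + eta) <= L + 1) by (apply Rabs_le; lra).
  unfold C; nra. }
assert (Pv : p v <= C * p x).
{ unfold v; eapply Rle_trans; [apply p_minus |]; rewrite p_scal.
  pose proof (p_Y x); pose proof (p_nonneg x).
  assert (Rabs (y + eta) <= L + 1) by (apply Rabs_le; lra).
  unfold C; nra. }
assert (Nv : norm v <= C) by (unfold v; pose proof (Zb x) as A; rewrite Nx in A; lra).
set (w := x -h RtoC t *h v).
assert (Nw : / 2 <= norm w).
{ pose proof (norm_le_minus x w) as A.
  replace (x -h w) with (RtoC t *h v) in A by (unfold w; vec).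
  rewrite Nx, norm_scal_R_eq, Rabs_pos_eq in A by lra; nra. }
assert (Pw : p w <= 3 / 2 * p x).
{ unfold w; eapply Rle_trans; [apply p_minus |]; rewrite p_scal, Rabs_pos_eq by lra.
  assert (t * p v <= t * (C * p x)) by (apply Rmult_le_compat_l; lra).
  rewrite <- Rmult_assoc, tC in *; lra. }
assert (Qw : rip (Y w) w <= (y + eta) * norm w ^ 2).
{ assert (Pi : 0 < / norm w) by (apply Rinv_0_lt_compat; lra).
  pose proof (N (RtoC (/ norm w) *h w)) as A.
  rewrite norm_scal_R_eq, p_scal, (lin_scal LY), rip_scal_l, rip_scal_r, Rabs_pos_eq in A by lra.
  assert (A1 : / norm w * (/ norm w * rip (Y w) w) <= y + eta).
  { apply A; [field; lra |].
    apply Rmult_le_reg_l with (norm w); [lra |]; rewrite <- Rmult_assoc, Rinv_r, Rmult_1_l by lra.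
    pose proof (p_nonneg x); nra. }
  apply Rmult_le_compat_r with (r := norm w ^ 2) in A1; [| apply pow2_ge_0].
  replace (/ norm w * (/ norm w * rip (Y w) w) * norm w ^ 2) with (rip (Y w) w) in A1 by (field; lra); exact A1. }
set (Z := fun z => RtoC (y + eta) *h z -h Y z).
assert (SZ : forall a b, rip (Z a) b = rip a (Z b)).
{ intros a b; unfold Z; rewrite rip_minus_l, rip_minus_r, rip_scal_l, rip_scal_r, SY; auto. }
assert (Q : 0 <= rip (Z w) w).
{ unfold Z; rewrite rip_minus_l, rip_scal_l, <- norm_sq_rip; lra. }
assert (Zw : Z w = v -h RtoC t *h Z v).
{ unfold w; change v with (Z x); unfold Z; rewrite !(lin_minus LY), !(lin_scal LY), !(lin_minus LY), ?(lin_scal LY); vec. }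
assert (Ew : rip (Z w) w = rip v x - 2 * t * norm v ^ 2 + t ^ 2 * rip (Z v) v).
{ rewrite Zw; unfold w; rewrite rip_minus_l, !rip_minus_r, !rip_scal_l, !rip_scal_r.
  rewrite (SZ v x); change (Z x) with v; rewrite <- norm_sq_rip; ring. }
assert (Bv : rip (Z v) v <= C * norm v ^ 2).
{ eapply Rle_trans; [apply rip_le |]; pose proof (Zb v); pose proof (norm_nonneg v); unfold Z; nra. }
assert (Ev : rip v x <= 2 * eta).
{ unfold v; rewrite rip_minus_l, rip_scal_l, <- norm_sq_rip, Nx; lra. }
assert (Sv : norm v ^ 2 <= (eps / 2) ^ 2).
{ assert (t * (C * norm v ^ 2) = / 2 * norm v ^ 2) by (rewrite <- Rmult_assoc, tC; auto).
  assert (t * norm v ^ 2 <= 2 * eta).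
  { assert (t ^ 2 * rip (Z v) v <= t * (/ 2 * norm v ^ 2)).
    { replace (t ^ 2 * rip (Z v) v) with (t * (t * rip (Z v) v)) by ring.
      apply Rmult_le_compat_l; [lra |].
      apply Rle_trans with (t * (C * norm v ^ 2)); [apply Rmult_le_compat_l; lra | lra]. }
    assert (0 <= t * norm v ^ 2) by (apply Rmult_le_pos; [lra | apply pow2_ge_0]); lra. }
  apply Rmult_le_compat_l with (r := 2 * C) in H5; [| lra].
  replace (2 * C * (t * norm v ^ 2)) with (norm v ^ 2) in H5 by (unfold t; field; lra).
  replace ((eps / 2) ^ 2) with (eps ^ 2 / 4) by field; lra. }
assert (Nv2 : norm v <= eps / 2) by (apply sq_le_le; [lra | auto]).
replace (Y x -h RtoC y *h x) with (RtoC eta *h x -h v) by (unfold v; vec).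
eapply Rle_trans; [apply norm_minus_le |]; rewrite norm_scal_R_eq, Nx, Rabs_pos_eq by lra; lra.
Qed.
End Joint.

Lemma linear_comp {H : Hilbert} (f g : H -> H) : is_linear f -> is_linear g -> is_linear (fun x => f (g x)).
Proof.
intros Lf Lg; constructor.
- intros x y; change (f (g (x +h y)) = f (g x) +h f (g y)); rewrite (lin_plus Lg); apply (lin_plus Lf).
- intros a x; change (f (g ((a : C) *h x)) = (a : C) *h f (g x)); rewrite (lin_scal Lg); apply (lin_scal Lf).
- destruct (linear_norm f Lf) as [M [PM HM]]; destruct (linear_norm g Lg) as [N [PN HN]].
  exists (M * N); split; [nra |]; intros x; eapply Rle_trans; [apply HM |].
  rewrite Rmult_assoc; apply Rmult_le_compat_l; [lra | apply HN].
Qed.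

Lemma linear_id {H : Hilbert} : is_linear (fun x : H => x).
Proof. constructor; auto; exists 1; split; [lra |]; intros; lra. Qed.

Lemma linear_iter {H : Hilbert} (f : H -> H) n : is_linear f -> is_linear (Nat.iter n f).
Proof.
intros Lf; induction n as [| n IH]; [apply linear_id |].
exact (linear_comp f (Nat.iter n f) Lf IH).
Qed.

Lemma linear_comb {H : Hilbert} (f g : H -> H) (a b : C) :
  is_linear f -> is_linear g -> is_linear (fun x => a *h f x +h b *h g x).
Proof.
intros Lf Lg; constructor.
- intros x y; change (a *h f (x +h y) +h b *h g (x +h y) = (a *h f x +h b *h g x) +h (a *h f y +h b *h g y)).
  rewrite (lin_plus Lf), (lin_plus Lg); vec.
- intros k x; change (a *h f ((k : C) *h x) +h b *h g ((k : C) *h x) = (k : C) *h (a *h f x +h b *h g x)).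
  rewrite (lin_scal Lf), (lin_scal Lg); vec.
- destruct (linear_norm f Lf) as [M [PM HM]]; destruct (linear_norm g Lg) as [N [PN HN]].
  pose proof (Cmod_ge_0 a) as Pa; pose proof (Cmod_ge_0 b) as Pb.
  exists (Cmod a * M + Cmod b * N + 1); split; [nra |]; intros x.
  change (norm (a *h f x +h b *h g x) <= (Cmod a * M + Cmod b * N + 1) * norm x).
  eapply Rle_trans; [apply h_triangle |]; rewrite !norm_scal_eq.
  pose proof (norm_nonneg x).
  assert (Cmod a * norm (f x) <= Cmod a * (M * norm x)) by (apply Rmult_le_compat_l; auto; apply HM).
  assert (Cmod b * norm (g x) <= Cmod b * (N * norm x)) by (apply Rmult_le_compat_l; auto; apply HN).
  lra.
Qed.

(** * Cayley transform and fractional powers of iB as commuting bounded maps *)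

Section Calculus.
Context {H : Hilbert} {B : op H} (SB : self_adjoint B).
Variable c : R.
Hypothesis Hc : 0 < c.
Implicit Types x y z u v w : H.
Let LB : linear_op B := proj1 SB.
Notation Rs := (Res B).

Definition commutes_Res (K : H -> H) : Prop := forall m, fst m <> 0 -> forall x, K (Rs m x) = Rs m (K x).

Lemma commutes_comp f g : commutes_Res f -> commutes_Res g -> commutes_Res (fun x => f (g x)).
Proof. intros Cf Cg m Hm x; rewrite Cg, Cf; auto. Qed.

Lemma commutes_iter f n : commutes_Res f -> commutes_Res (Nat.iter n f).
Proof. intros Cf; induction n as [| n IH]; intros m Hm x; simpl; auto; rewrite IH, Cf; auto. Qed.

Lemma commutes_Res_Res l : fst l <> 0 -> commutes_Res (Rs l).
Proof. intros Hl m Hm x; apply (Res_commute SB l _ m _ x (bounded_below_Re SB l Hl) (bounded_below_Re SB m Hm)). Qed.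

Lemma commutes_comb f g a b : commutes_Res f -> commutes_Res g -> commutes_Res (fun x => a *h f x +h b *h g x).
Proof.
intros Cf Cg m Hm x; pose proof (Res_linear SB m _ (bounded_below_Re SB m Hm)) as LR.
rewrite Cf, Cg, (lin_plus LR), !(lin_scal LR); auto.
Qed.

Lemma commutes_id : commutes_Res (fun x => x).
Proof. intros m Hm x; auto. Qed.

(** V(A) written as I - 2 (A + I)^(-1) with A + I = iB + (c + 1), which is manifestly bounded. The
    map [cay'] is its adjoint, with the sign flip of [Res_adjoint]. *)
Definition cay (x : H) : H := RtoC 1 *h x +h RtoC (-2) *h Rs (RtoC (c + 1)) x.
Definition cay' (x : H) : H := RtoC 1 *h x +h RtoC 2 *h Rs (Copp (Cconj (RtoC (c + 1)))) x.

Lemma c1_neq : fst (RtoC (c + 1)) <> 0. Proof. simpl; lra. Qed.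
Lemma c1_neq' : fst (Copp (Cconj (RtoC (c + 1)))) <> 0. Proof. simpl; lra. Qed.

Lemma cay_linear : is_linear cay.
Proof. apply linear_comb; [apply linear_id | exact (Res_linear SB _ _ (bounded_below_Re SB _ c1_neq))]. Qed.
Lemma cay'_linear : is_linear cay'.
Proof. apply linear_comb; [apply linear_id | exact (Res_linear SB _ _ (bounded_below_Re SB _ c1_neq'))]. Qed.
Lemma cay_commutes : commutes_Res cay.
Proof. apply commutes_comb; [apply commutes_id | apply commutes_Res_Res, c1_neq]. Qed.
Lemma cay'_commutes : commutes_Res cay'.
Proof. apply commutes_comb; [apply commutes_id | apply commutes_Res_Res, c1_neq']. Qed.

Lemma cay_adjoint x y : rip (cay x) y = rip x (cay' y).
Proof.
unfold cay, cay'; rewrite rip_plus_l, rip_plus_r, !rip_scal_l, !rip_scal_r.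
rewrite (Res_adjoint SB _ _ _ x y (bounded_below_Re SB _ c1_neq) (bounded_below_Re SB _ c1_neq')), rip_opp_r; ring.
Qed.

Lemma cay_iter_adjoint n x y : rip (Nat.iter n cay x) y = rip x (Nat.iter n cay' y).
Proof.
revert x y; induction n as [| n IH]; intros x y; auto.
simpl; rewrite cay_adjoint, IH; f_equal; rewrite <- Nat.iter_succ_r; auto.
Qed.

(** A substitute for functional calculus: [a] is the symbol of [K] at [lam], up to an error linear
    in the residual. Symbols of products multiply. *)
Definition acts (lam : R) (K : H -> H) (a : C) : Prop :=
  exists M, 0 <= M /\ forall x u, B x u -> norm (K x -h a *h x) <= M * norm (u -h RtoC lam *h x).

Lemma acts_comp lam f g a b : is_linear f -> acts lam f a -> acts lam g b -> acts lam (fun x => f (g x)) (Cmult b a).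
Proof.
intros Lf [M [PM HM]] [N [PN HN]]; destruct (linear_norm f Lf) as [K [PK HK]].
exists (K * N + Cmod b * M); split; [pose proof (Cmod_ge_0 b); nra |]; intros x u Bx.
replace (f (g x) -h Cmult b a *h x) with (f (g x -h b *h x) +h b *h (f x -h a *h x))
  by (rewrite (lin_minus Lf), (lin_scal Lf); vec).
eapply Rle_trans; [apply h_triangle |]; rewrite norm_scal_eq.
pose proof (HK (g x -h b *h x)); pose proof (HN x u Bx); pose proof (HM x u Bx).
assert (K * norm (g x -h b *h x) <= K * (N * norm (u -h RtoC lam *h x))) by (apply Rmult_le_compat_l; lra).
assert (Cmod b * norm (f x -h a *h x) <= Cmod b * (M * norm (u -h RtoC lam *h x))) by (apply Rmult_le_compat_l; auto; apply Cmod_ge_0).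
lra.
Qed.

Lemma acts_iter lam f a n : is_linear f -> acts lam f a -> acts lam (Nat.iter n f) (Cpow a n).
Proof.
intros Lf Af; induction n as [| n IH].
- exists 0; split; [lra |]; intros x u Bx; simpl; replace (x -h RtoC 1 *h x) with (0h : H) by vec; rewrite norm_zero_eq; lra.
- simpl; rewrite Cmult_comm; exact (acts_comp lam f (Nat.iter n f) a (Cpow a n) Lf Af IH).
Qed.

Lemma pair_neq_0 (a b : R) : a <> 0 -> (a, b) <> RtoC 0.
Proof. intros N E; apply N; apply (f_equal fst) in E; exact E. Qed.

Definition cay_val (lam : R) : C := Cdiv (c - 1, lam) (c + 1, lam).

Lemma acts_cay lam : acts lam cay (cay_val lam).
Proof.
set (m := (c + 1, lam) : C); assert (Nm : m <> RtoC 0) by (apply pair_neq_0; lra).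
pose proof (Res_linear SB _ _ (bounded_below_Re SB _ c1_neq)) as LR.
destruct (linear_norm _ LR) as [K [PK HK]].
exists (2 * (K * Cmod (Cinv m))); split; [pose proof (Cmod_ge_0 (Cinv m)); nra |].
intros x u Bx.
assert (E1 : Rs (RtoC (c + 1)) (Ci *h u +h RtoC (c + 1) *h x) = x)
  by (apply (Res_eq SB _ _ _ u _ (bounded_below_Re SB _ c1_neq)); auto).
replace (cay x -h cay_val lam *h x) with (RtoC (-2) *h Rs (RtoC (c + 1)) (Cmult (Copp Ci) (Cinv m) *h (u -h RtoC lam *h x))).
- rewrite norm_scal_R_eq, (Rabs_left (-2)) by lra.
  pose proof (HK (Cmult (Copp Ci) (Cinv m) *h (u -h RtoC lam *h x))) as L.
  rewrite norm_scal_eq, Cmod_mult, Cmod_opp, Cmod_Ci in L; lra.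
(* The resolvent applied to this identity measures how far it is from multiplication by 1/m, and the
   symbol of the Cayley transform is 1 - 2/m. *)
- assert (E2 : Cmult (Copp Ci) (Cinv m) *h (u -h RtoC lam *h x) = x -h Cinv m *h (Ci *h u +h RtoC (c + 1) *h x)).
  { replace x with (Cinv m *h (m *h x)) at 2.
    - unfold m; set (k := Cinv (c + 1, lam)); vec.
    - set (k := Cinv m); assert (Ek : Cmult k m = RtoC 1) by (apply Cinv_l; auto).
      transitivity (Cmult k m *h x); [vec | rewrite Ek; vec]. }
  rewrite E2, (lin_minus LR), (lin_scal LR), E1; unfold cay, cay_val.
  assert (E3 : Cdiv (c - 1, lam) (c + 1, lam) = Cminus (RtoC 1) (Cmult (RtoC 2) (Cinv m))).
  { replace ((c - 1, lam) : C) with (Cminus m (RtoC 2)) by (unfold m, Cminus, Cplus, Copp, RtoC; simpl; f_equal; ring).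
    fold m; field; auto. }
  rewrite E3; set (k := Cinv m); vec.
Qed.

Section Power.
Variables (sg b : R) (n : nat).
Hypotheses (Hsg : 0 < sg) (Hb : 0 < b).
Let G : good sg (shift_op B 1 sg) := shift_op_good SB 1 sg R1_neq_R0 Hsg.
Let G' : good sg (shift_op B (-1) sg) := shift_op_good SB (-1) sg (Rlt_not_eq (-1) 0 (Ropp_lt_gt_0_contravar 1 Rlt_0_1)) Hsg.

Definition Npow : H -> H := npow (shift_op B 1 sg) b.
Definition Npow' : H -> H := npow (shift_op B (-1) sg) b.
(** V(A)^n (iB + sg)^(-b). Keeping [sg] apart from [c] covers both uses: [sg = c + 1] gives f(iB),
    and [sg = c] gives V(A)^n A^(-alpha). In [Fop'] the order is reversed, as befits an adjoint. *)
Definition Fop (x : H) : H := Nat.iter n cay (Npow x).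
Definition Fop' (x : H) : H := Npow' (Nat.iter n cay' x).

Definition f_val (lam : R) : R := Cmod (cay_val lam) ^ n * / Rpower (Cmod (sg, lam)) b.

Lemma Fop_linear : is_linear Fop.
Proof. exact (linear_comp _ _ (linear_iter _ n cay_linear) (npow_linear G b Hb)). Qed.
Lemma Fop'_linear : is_linear Fop'.
Proof. exact (linear_comp _ _ (npow_linear G' b Hb) (linear_iter _ n cay'_linear)). Qed.

Lemma Fop_adjoint x y : rip (Fop x) y = rip x (Fop' y).
Proof.
unfold Fop, Fop'; rewrite cay_iter_adjoint.
apply (npow_adjoint G G' b Hb); intros; apply shift_op_adjoint; auto.
Qed.

Lemma Npow_commutes : commutes_Res Npow.
Proof. intros m Hm x; symmetry; apply (npow_Res_commute SB); auto; lra. Qed.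
Lemma Npow'_commutes : commutes_Res Npow'.
Proof. intros m Hm x; symmetry; apply (npow_Res_commute SB); auto; lra. Qed.

Lemma Fop_commutes : commutes_Res Fop.
Proof. apply (commutes_comp (Nat.iter n cay) Npow); [apply commutes_iter, cay_commutes | apply Npow_commutes]. Qed.
Lemma Fop'_commutes : commutes_Res Fop'.
Proof. apply (commutes_comp Npow' (Nat.iter n cay')); [apply Npow'_commutes | apply commutes_iter, cay'_commutes]. Qed.

Lemma acts_Npow lam : acts lam Npow (cpow_neg b (sg, lam)).
Proof.
pose proof (Gamma_pos b Hb) as Pg.
assert (Pgi : 0 < gint (b + 1) sg).
{ pose proof (gint_scaling (b + 1) sg ltac:(lra) Hsg); pose proof (Gamma_pos (b + 1) ltac:(lra)); pose proof (Rpower_pos sg (b + 1)); nra. }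
exists (gint (b + 1) sg / Gamma b); split; [left; apply Rdiv_lt_0_compat; auto |].
intros x u Bx.
pose proof (npow_approx_eigen G b (sg, lam) x ((0, 1) *h u +h RtoC sg *h x) Hb (Rle_refl sg)) as A.
replace ((0, 1) *h u +h RtoC sg *h x -h (sg, lam) *h x) with (Ci *h (u -h RtoC lam *h x)) in A by vec.
rewrite norm_scal_eq, Cmod_Ci, Rmult_1_l in A; apply A; exists u; auto.
Qed.

Lemma acts_Fop lam : exists a, Cmod a = f_val lam /\ acts lam Fop a.
Proof.
exists (Cmult (cpow_neg b (sg, lam)) (Cpow (cay_val lam) n)); split.
- rewrite Cmod_mult, Cmod_pow, cpow_neg_mod by auto; unfold f_val; ring.
- apply (acts_comp lam (Nat.iter n cay) Npow); [apply linear_iter, cay_linear | apply acts_iter; [apply cay_linear | apply acts_cay] | apply acts_Npow].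
Qed.

Lemma f_val_nonneg lam : 0 <= f_val lam.
Proof.
apply Rmult_le_pos; [apply pow_le, Cmod_ge_0 | left; apply Rinv_0_lt_compat, Rpower_pos].
Qed.

(** On unit vectors with vanishing residual, [K] acts like the scalar [a]. *)
Lemma acts_lower K a lam m : is_linear K -> opnorm (graph K) = Finite m -> acts lam K a ->
  approx_eigenvalue B lam -> Cmod a <= m.
Proof.
intros LK Em [M [PM HM]] Ap; apply le_epsilon; intros eps He.
destruct (Ap (eps / (M + 1))) as [x [u [Bx [Nx L]]]]; [apply Rdiv_lt_0_compat; lra |].
pose proof (HM x u Bx) as A; pose proof (opnorm_graph_ge K m x LK Em) as A2.
pose proof (norm_le_minus (a *h x) (K x)) as A3.
rewrite norm_minus_sym in A; rewrite Nx in A2; rewrite norm_scal_eq, Nx in A3.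
assert (M * norm (u -h RtoC lam *h x) <= eps).
{ apply Rle_trans with ((M + 1) * (eps / (M + 1))); [| right; field; lra].
  apply Rmult_le_compat; auto using norm_nonneg; lra. }
lra.
Qed.

(* The exceptional value 0 of the resolvent, i.e. lambda = oo: the fractional
   power is small where the resolvent is. *)
Lemma Fop_small eta : 0 < eta -> exists d, 0 < d /\ forall x, norm x = 1 -> norm (Rs (RtoC sg) x) <= d -> norm (Fop x) <= eta.
Proof.
intros Heta; destruct (linear_norm _ (linear_iter _ n cay_linear)) as [M [PM HM]].
pose proof (Gamma_pos b Hb) as Pg.
(* Both terms of [npow_small] will be at most [e]: the one with [gint b (sg + k)] by taking [k]
   large, the other by taking [d] small for that [k]. *)
set (e := Gamma b * eta / M / 2); assert (Pe : 0 < e).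
{ unfold e; repeat apply Rdiv_lt_0_compat; try lra; nra. }
destruct (Rpower_lim_infty b (Gamma b / e) Hb) as [k0 [Hk0 Lk]]; [apply Rdiv_lt_0_compat; auto |].
set (k := k0 + 1); assert (Pk : 0 < k) by (unfold k; lra).
assert (Gk : gint b (sg + k) <= e).
{ pose proof (gint_scaling b (sg + k) Hb ltac:(lra)) as E.
  pose proof (Lk (sg + k) ltac:(unfold k; lra)) as L; pose proof (Rpower_pos (sg + k) b) as Pr.
  apply Rmult_le_reg_r with (Rpower (sg + k) b); auto; rewrite E.
  apply Rmult_lt_compat_l with (r := e) in L; auto.
  replace (e * (Gamma b / e)) with (Gamma b) in L by (field; lra); lra. }
assert (Pgi : 0 < gint b sg).
{ pose proof (gint_scaling b sg Hb Hsg); pose proof (Rpower_pos sg b); nra. }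
set (A := k * (Rabs (b - 1) + 1) * gint b sg); assert (PA : 0 < A).
{ unfold A; pose proof (Rabs_pos (b - 1)); apply Rmult_lt_0_compat; auto; apply Rmult_lt_0_compat; lra. }
exists (e / A); split; [apply Rdiv_lt_0_compat; auto |]; intros x Nx Lx.
assert (Nz : fst (RtoC sg) <> 0) by (simpl; lra).
destruct (Res_spec SB _ _ x (bounded_below_Re SB _ Nz)) as [u [Bu E]].
pose proof (npow_small G b k (Rs (RtoC sg) x) x Hb Pk) as S.
assert (S' : Gamma b * norm (Npow x) <= A * norm (Rs (RtoC sg) x) + gint b (sg + k) * norm x).
{ apply S; exists u; split; auto. }
rewrite Nx, Rmult_1_r in S'.
assert (A * norm (Rs (RtoC sg) x) <= e).
{ apply Rle_trans with (A * (e / A)); [apply Rmult_le_compat_l; lra | right; field; lra]. }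
unfold Fop; eapply Rle_trans; [apply HM |].
assert (norm (Npow x) <= eta / M).
{ apply Rmult_le_reg_l with (Gamma b); auto.
  replace (Gamma b * (eta / M)) with (2 * e) by (unfold e; field; lra); lra. }
apply Rle_trans with (M * (eta / M)); [apply Rmult_le_compat_l; lra | right; field; lra].
Qed.

(** Since the symbol vanishes at infinity, a positive norm is attained at a finite point of the
    spectrum; positivity of [m] is what excludes escape to infinity. *)
Lemma Fop_norm_attained m : opnorm (graph Fop) = Finite m -> 0 < m ->
  exists lam, approx_eigenvalue B lam /\ f_val lam = m.
Proof.
intros Em Pm; pose proof Fop_linear as LF; pose proof Fop'_linear as LF'.
set (mu := m ^ 2); assert (Pmu : 0 < mu) by (unfold mu; nra).
set (X := fun x => Fop' (Fop x)).
assert (LX : is_linear X) by exact (linear_comp Fop' Fop LF' LF).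
assert (CX : commutes_Res X) by exact (commutes_comp Fop' Fop Fop'_commutes Fop_commutes).
assert (BF : forall x, norm (Fop x) <= m * norm x) by (intros; apply opnorm_graph_ge; auto).
assert (BF' : forall x, norm (Fop' x) <= m * norm x).
{ intros x; apply norm_le_of_rip; [apply Rmult_le_pos; [lra | apply norm_nonneg] |]; intros y.
  rewrite rip_sym, <- Fop_adjoint; eapply Rle_trans; [apply rip_le |].
  pose proof (BF y); pose proof (norm_nonneg x); nra. }
assert (XF : forall x, rip (X x) x = norm (Fop x) ^ 2).
{ intros x; unfold X; rewrite rip_sym, <- Fop_adjoint, norm_sq_rip; auto. }
set (nsg := Copp (Cconj (RtoC sg))).
assert (N1 : fst (RtoC sg) <> 0) by (simpl; lra).
assert (N2 : fst nsg <> 0) by (simpl; lra).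
set (R1 := Rs (RtoC sg)); set (R2 := fun x => RtoC (-1) *h Rs nsg x).
pose proof (Res_linear SB _ _ (bounded_below_Re SB _ N1)) as LR; fold R1 in LR.
pose proof (Res_linear SB _ _ (bounded_below_Re SB _ N2)) as LR0.
assert (R12 : forall x y, rip (R1 x) y = rip x (R2 y)).
{ intros x y; unfold R1, R2; rewrite (Res_adjoint SB _ _ _ x y (bounded_below_Re SB _ N1) (bounded_below_Re SB _ N2)).
  rewrite rip_opp_r, rip_scal_r; fold nsg; ring. }
(* With [R2] the adjoint of [R1], these are R1 + R2 and i (R1 - R2), both self-adjoint, and R1 = (Y1
   - i Y2)/2. *)
set (Y1 := fun x => RtoC 1 *h R1 x +h RtoC (-1) *h Rs nsg x).
set (Y2 := fun x => Ci *h R1 x +h Ci *h Rs nsg x).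
assert (LY1 : is_linear Y1) by (apply linear_comb; auto).
assert (LY2 : is_linear Y2) by (apply linear_comb; auto).
assert (CR1 : commutes_Res R1) by (apply commutes_Res_Res; auto).
assert (CR2 : commutes_Res (Rs nsg)) by (apply commutes_Res_Res; auto).
assert (CommY : forall K a d x, is_linear K -> commutes_Res K ->
  K (a *h R1 x +h d *h Rs nsg x) = a *h R1 (K x) +h d *h Rs nsg (K x)).
{ intros K a d x LK CK; rewrite (lin_plus LK), !(lin_scal LK); unfold R1; rewrite !CK; auto. }
assert (SY1 : forall x y, rip (Y1 x) y = rip x (Y1 y)).
{ intros x y; unfold Y1; rewrite rip_plus_l, rip_plus_r, !rip_scal_l, !rip_scal_r, R12.
  rewrite (rip_sym (Rs nsg x)), (rip_sym x (R1 y)), R12; unfold R2; rewrite !rip_scal_r, (rip_sym y); ring. }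
assert (SY2 : forall x y, rip (Y2 x) y = rip x (Y2 y)).
{ intros x y; unfold Y2; rewrite rip_plus_l, rip_plus_r.
  assert (A1 : rip (Ci *h R1 x) y = rip x (Ci *h Rs nsg y)).
  { rewrite rip_scal_adj, R12; unfold R2; rewrite (lin_scal LR0); f_equal; vec. }
  assert (A2 : rip (Ci *h Rs nsg x) y = rip x (Ci *h R1 y)).
  { rewrite (rip_sym x), (rip_scal_adj Ci (R1 y)), R12; unfold R2; rewrite (lin_scal LR0), rip_sym; f_equal; vec. }
  rewrite A1, A2; ring. }
destruct (linear_norm Y1 LY1) as [K1 [PK1 HK1]]; destruct (linear_norm Y2 LY2) as [K2 [PK2 HK2]].
set (p1 := fun x => norm (X x -h RtoC mu *h x)).
assert (Start : forall eps, 0 < eps -> exists x, norm x = 1 /\ p1 x <= eps).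
{ intros eps He.
  (* If the square of [norm (Fop x)] is at least [mu - d], expanding the square of
     [norm (X x - mu x)] and using [norm (X x) <= mu] bounds it by [2 * mu * d], hence by
     [eps ^ 2]. *)
  set (d := Rmin (mu / 2) (eps ^ 2 / (2 * mu))).
  assert (Pd : 0 < d) by (apply Rmin_pos; [lra | apply Rdiv_lt_0_compat; nra]).
  assert (D1 : d <= mu / 2) by apply Rmin_l; assert (D2 : d <= eps ^ 2 / (2 * mu)) by apply Rmin_r.
  assert (Ex : exists x, norm x = 1 /\ mu - d <= norm (Fop x) ^ 2).
  { apply NNPP; intros N.
    assert (B1 : forall x, norm (Fop x) ^ 2 <= (mu - d) * norm x ^ 2).
    { intros x; destruct (norm_nonneg x) as [P | P].
      - apply Rnot_lt_le; intros L; apply N; exists (RtoC (/ norm x) *h x).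
        assert (Pi : 0 < / norm x) by (apply Rinv_0_lt_compat; auto).
        rewrite (lin_scal LF), !norm_scal_R_eq, Rabs_pos_eq by lra; split; [field; lra |].
        rewrite Rpow_mult_distr.
        apply Rmult_le_reg_l with (norm x ^ 2); [apply pow_lt; auto |].
        replace (norm x ^ 2 * ((/ norm x) ^ 2 * norm (Fop x) ^ 2)) with (norm (Fop x) ^ 2) by (field; lra); lra.
      - assert (x = 0h) as -> by (apply h_norm_eq_zero; auto).
        rewrite (lin_zero LF), norm_zero_eq; simpl; lra. }
    assert (Sq : sqrt (mu - d) ^ 2 = mu - d) by (apply pow2_sqrt; lra).
    assert (U : Rbar_le (opnorm (graph Fop)) (sqrt (mu - d))).
    { apply opnorm_le; intros x y -> Nx; apply sq_le_le; [apply sqrt_pos |]; rewrite Sq.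
      eapply Rle_trans; [apply B1 |]; pose proof (norm_nonneg x); assert (norm x ^ 2 <= 1) by nra; nra. }
    rewrite Em in U; simpl in U; pose proof (sqrt_pos (mu - d)); unfold mu in *; nra. }
  destruct Ex as [x [Nx Lx]]; exists x; split; auto; unfold p1; apply sq_le_le; [lra |].
  rewrite norm_sq_minus, rip_scal_r, XF, norm_scal_R_eq, Nx, Rmult_1_r, pow2_abs.
  assert (norm (X x) <= mu).
  { unfold X; eapply Rle_trans; [apply BF' |]; pose proof (BF x) as A; rewrite Nx in A; unfold mu; nra. }
  assert (norm (X x) ^ 2 <= mu ^ 2) by (apply pow_incr; split; auto using norm_nonneg).
  assert (2 * mu * d <= eps ^ 2).
  { apply Rle_trans with (2 * mu * (eps ^ 2 / (2 * mu))); [apply Rmult_le_compat_l; lra | right; field; lra]. }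
  nra. }
assert (Gp : forall K a x y, is_linear K -> norm (K (x -h y) -h a *h (x -h y)) <= norm (K x -h a *h x) + norm (K y -h a *h y)).
{ intros K a x y LK; replace (K (x -h y) -h a *h (x -h y)) with ((K x -h a *h x) -h (K y -h a *h y))
    by (rewrite (lin_minus LK); vec); apply norm_minus_le. }
assert (Gs : forall K a (t : R) x, is_linear K -> norm (K (RtoC t *h x) -h a *h (RtoC t *h x)) = Rabs t * norm (K x -h a *h x)).
{ intros K a t x LK; rewrite <- norm_scal_R_eq; f_equal; rewrite (lin_scal LK); vec. }
assert (Gc : forall K Y a M x, is_linear Y -> (forall z, norm (Y z) <= M * norm z) -> K (Y x) = Y (K x) ->
  norm (K (Y x) -h a *h Y x) <= M * norm (K x -h a *h x)).
{ intros K Y a M x LY HY E; rewrite E, <- (lin_scal LY), <- (lin_minus LY); apply HY. }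
destruct (joint_approx_eigenvalue p1 Y1 K1 LY1 SY1 (Rlt_le _ _ PK1) HK1) as [y1 J1]; auto.
{ intros x y; apply Gp; auto. }
{ intros t x; apply Gs; auto. }
{ intros x; apply Gc; auto; apply CommY; auto. }
(* The second maximization is confined to vectors on which both [X] and [Y1] already act almost as
   scalars; commutation makes this class stable under [Y2]. *)
set (p2 := fun x => p1 x + norm (Y1 x -h RtoC y1 *h x)).
destruct (joint_approx_eigenvalue p2 Y2 K2 LY2 SY2 (Rlt_le _ _ PK2) HK2) as [y2 J2].
{ intros x y; unfold p2, p1; pose proof (Gp X (RtoC mu) x y LX); pose proof (Gp Y1 (RtoC y1) x y LY1); lra. }
{ intros t x; unfold p2, p1; rewrite (Gs X), (Gs Y1) by auto; ring. }
{ intros x; unfold p2, p1; rewrite Rmult_plus_distr_l; apply Rplus_le_compat; apply Gc; auto.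
  - apply CommY; auto.
  - apply CommY; auto; apply commutes_comb; auto. }
{ intros eps He; destruct (J1 (eps / 2)) as [x [Nx [P1 Q1]]]; [lra |]; exists x; split; auto; unfold p2; lra. }
set (rho := (y1 / 2, - (y2 / 2)) : C).
assert (J : forall eps, 0 < eps -> exists x, norm x = 1 /\ norm (X x -h RtoC mu *h x) <= eps /\ norm (R1 x -h rho *h x) <= eps).
{ intros eps He; destruct (J2 eps He) as [x [Nx [P2 Q2]]]; exists x; split; auto.
  unfold p2, p1 in P2.
  pose proof (norm_nonneg (X x -h RtoC mu *h x)); pose proof (norm_nonneg (Y1 x -h RtoC y1 *h x)).
  split; [lra |].
  replace (R1 x -h rho *h x) with (RtoC (/ 2) *h ((Y1 x -h RtoC y1 *h x) -h Ci *h (Y2 x -h RtoC y2 *h x))) by (unfold Y1, Y2, rho; vec).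
  rewrite norm_scal_R_eq, Rabs_pos_eq by lra.
  pose proof (norm_minus_le (Y1 x -h RtoC y1 *h x) (Ci *h (Y2 x -h RtoC y2 *h x))) as T.
  rewrite (norm_scal_eq Ci), Cmod_Ci in T; lra. }
(* If rho = 0, the resolvent and hence [Fop] are small at [x], so [norm (X x)] is at most mu/4,
   although [X x] is within mu/2 of [mu x]. *)
destruct (classic (rho = RtoC 0)) as [Z | NZ].
{ exfalso.
  destruct (Fop_small (mu / (4 * m))) as [d [Pd Sm]]; [apply Rdiv_lt_0_compat; lra |].
  destruct (J (Rmin d (mu / 2))) as [x [Nx [Q1 Q2]]]; [apply Rmin_pos; lra |].
  pose proof (Rmin_l d (mu / 2)); pose proof (Rmin_r d (mu / 2)).
  rewrite Z in Q2; replace (R1 x -h RtoC 0 *h x) with (R1 x) in Q2 by vec.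
  pose proof (Sm x Nx ltac:(unfold R1 in Q2; lra)) as S1.
  pose proof (norm_le_minus (RtoC mu *h x) (X x)) as T; rewrite norm_scal_R_eq, Nx, Rabs_pos_eq, norm_minus_sym in T by lra.
  pose proof (BF' (Fop x)) as S2.
  assert (m * norm (Fop x) <= m * (mu / (4 * m))) by (apply Rmult_le_compat_l; lra).
  replace (m * (mu / (4 * m))) with (mu / 4) in * by (field; lra).
  change (Fop' (Fop x)) with (X x) in S2; lra. }
assert (Prho : 0 < Cmod rho) by (apply Cmod_gt_0; auto).
set (l := Cminus (Cinv rho) (RtoC sg)).
destruct (linear_norm R1 LR) as [KR [PKR HKR]].
(* The vector [R1 x] lies in the domain of [B], has norm at least half of |rho|, and inherits both
   approximate eigenvalue relations; it is normalized and replaces [x]. *)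
assert (J3 : forall eta, 0 < eta -> exists x u, B x u /\ norm x = 1 /\
  norm (X x -h RtoC mu *h x) <= eta /\ norm (Ci *h u -h l *h x) <= eta).
{ intros eta Heta.
  set (W := KR + / Cmod rho + 1).
  assert (Pir : 0 < / Cmod rho) by (apply Rinv_0_lt_compat; auto).
  assert (PW : 0 < W) by (unfold W; lra).
  destruct (J (Rmin (Cmod rho / 2) (eta * (Cmod rho / 2) / W))) as [x [Nx [Q1 Q2]]].
  { apply Rmin_pos; [lra |]; apply Rdiv_lt_0_compat; nra. }
  set (e := Rmin (Cmod rho / 2) (eta * (Cmod rho / 2) / W)) in *.
  assert (e <= Cmod rho / 2) by apply Rmin_l.
  assert (He2 : W * e <= eta * (Cmod rho / 2)).
  { apply Rle_trans with (W * (eta * (Cmod rho / 2) / W)); [apply Rmult_le_compat_l; [lra | apply Rmin_r] | right; field; lra]. }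
  destruct (Res_spec SB _ _ x (bounded_below_Re SB _ N1)) as [u [Bu E]].
  change (Rs (RtoC sg) x) with (R1 x) in Bu, E.
  assert (Nz : Cmod rho / 2 <= norm (R1 x)).
  { pose proof (norm_le_minus (rho *h x) (R1 x)) as T; rewrite norm_scal_eq, Nx, norm_minus_sym in T; lra. }
  assert (Pe : 0 <= e) by (pose proof (norm_nonneg (X x -h RtoC mu *h x)); lra).
  assert (Pi : 0 < / norm (R1 x)) by (apply Rinv_0_lt_compat; lra).
  assert (Ub : forall a, a <= W * e -> / norm (R1 x) * a <= eta).
  { intros a Ha; apply Rmult_le_reg_l with (norm (R1 x)); [lra |]; rewrite <- Rmult_assoc, Rinv_r, Rmult_1_l by lra; nra. }
  exists (RtoC (/ norm (R1 x)) *h R1 x), (RtoC (/ norm (R1 x)) *h u); split; [apply (lop_scal LB); auto |].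
  split; [rewrite norm_scal_R_eq, Rabs_pos_eq by lra; field; lra |]; split.
  - rewrite (Gs X), Rabs_pos_eq by (auto; lra); apply Ub.
    assert (XR : X (R1 x) = R1 (X x)) by (apply CX; auto).
    rewrite XR, <- (lin_scal LR), <- (lin_minus LR).
    eapply Rle_trans; [apply HKR |]; unfold W; nra.
  - replace (Ci *h (RtoC (/ norm (R1 x)) *h u) -h l *h (RtoC (/ norm (R1 x)) *h R1 x))
      with (RtoC (/ norm (R1 x)) *h (Ci *h u -h l *h R1 x)) by vec.
    rewrite norm_scal_R_eq, Rabs_pos_eq by lra; apply Ub.
    replace (Ci *h u -h l *h R1 x) with (Copp (Cinv rho) *h (R1 x -h rho *h x)).
    + rewrite norm_scal_eq, Cmod_opp, Cmod_inv by auto; unfold W; nra.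
    + assert (Er : Cmult (Cinv rho) rho = RtoC 1) by (apply Cinv_l; auto).
      assert (Eu : Ci *h u = x -h RtoC sg *h R1 x) by (rewrite E at 1; vec).
      rewrite Eu; unfold l; set (k := Cinv rho) in *.
      transitivity (Cmult k rho *h x -h k *h R1 x); [vec | rewrite Er; vec]. }
(* Off the imaginary axis, iB - l is bounded below and has no approximate eigenvectors. *)
assert (Rl : fst l = 0).
{ apply NNPP; intros N; pose proof (Rabs_pos_lt _ N) as Pl.
  destruct (J3 (Rabs (fst l) / 2)) as [x [u [Bx [Nx [_ Q]]]]]; [lra |].
  assert (N' : fst (Copp l) <> 0) by (change (- fst l <> 0); lra).
  pose proof (proj2 (bounded_below_Re SB (Copp l) N') x u Bx) as L.
  replace (Ci *h u +h Copp l *h x) with (Ci *h u -h l *h x) in L by vec.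
  change (fst (Copp l)) with (- fst l) in L; rewrite Rabs_Ropp, Nx in L; lra. }
set (lam := snd l).
assert (J4 : forall eta, 0 < eta -> exists x u, B x u /\ norm x = 1 /\
  norm (X x -h RtoC mu *h x) <= eta /\ norm (u -h RtoC lam *h x) <= eta).
{ intros eta Heta; destruct (J3 eta Heta) as [x [u [Bx [Nx [Q1 Q2]]]]]; exists x, u; repeat split; auto.
  replace (u -h RtoC lam *h x) with (Copp Ci *h (Ci *h u -h l *h x)).
  - rewrite norm_scal_eq, Cmod_opp, Cmod_Ci; lra.
  - unfold lam; destruct l as [l1 l2]; simpl in Rl |- *; subst l1; vec. }
exists lam; split.
{ intros eps He; destruct (J4 eps He) as [x [u [Bx [Nx [_ Q]]]]]; eauto. }
destruct (acts_Fop lam) as [a [Ea [M [PM HM]]]].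
rewrite <- Ea; set (va := Cmod a) in *; assert (Pva : 0 <= va) by apply Cmod_ge_0.
(* The squared norm of [Fop x] is close to [mu] because [X x] is close to [mu x], and close to
   [va ^ 2] because [Fop] acts like [a] there. *)
assert (Esq : va ^ 2 = mu).
{ apply Rminus_diag_uniq, cond_eq; intros eps He; rewrite Rminus_0_r.
  set (eta := Rmin 1 (eps / (2 * (1 + M * (2 * va + M))))).
  assert (PQ : 0 < 2 * (1 + M * (2 * va + M))) by nra.
  assert (Pe : 0 < eta) by (apply Rmin_pos; [lra | apply Rdiv_lt_0_compat; auto]).
  assert (Pe1 : eta <= 1) by apply Rmin_l.
  assert (Pe2 : eta * (2 * (1 + M * (2 * va + M))) <= eps).
  { apply Rle_trans with (eps / (2 * (1 + M * (2 * va + M))) * (2 * (1 + M * (2 * va + M)))).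
    - apply Rmult_le_compat_r; [lra | apply Rmin_r].
    - right; field; lra. }
  destruct (J4 eta Pe) as [x [u [Bx [Nx [Q1 Q2]]]]].
  assert (A1 : Rabs (norm (Fop x) ^ 2 - mu) <= eta).
  { rewrite <- XF; replace (rip (X x) x - mu) with (rip (X x -h RtoC mu *h x) x)
      by (rewrite rip_minus_l, rip_scal_l, <- norm_sq_rip, Nx; ring).
    eapply Rle_trans; [apply rip_abs_le |]; rewrite Nx; lra. }
  assert (A2 : Rabs (norm (Fop x) - va) <= M * eta).
  { pose proof (HM x u Bx) as A; assert (M * norm (u -h RtoC lam *h x) <= M * eta) by (apply Rmult_le_compat_l; auto).
    pose proof (norm_le_minus (Fop x) (a *h x)) as T1; pose proof (norm_le_minus (a *h x) (Fop x)) as T2.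
    rewrite norm_scal_eq, Nx in T1, T2; rewrite (norm_minus_sym (a *h x)) in T2; fold va in T1, T2.
    apply Rabs_le; lra. }
  set (f := norm (Fop x)) in *; assert (Pf : 0 <= f) by apply norm_nonneg.
  assert (A3 : Rabs (f ^ 2 - va ^ 2) <= M * eta * (2 * va + M)).
  { replace (f ^ 2 - va ^ 2) with ((f - va) * (f + va)) by ring; rewrite Rabs_mult.
    apply Rabs_le_between in A2 as A4.
    assert (M * eta <= M) by nra.
    apply Rmult_le_compat; auto using Rabs_pos; rewrite Rabs_pos_eq; lra. }
  replace (va ^ 2 - mu) with ((f ^ 2 - mu) - (f ^ 2 - va ^ 2)) by ring.
  eapply Rle_lt_trans; [apply Rabs_triang |]; rewrite Rabs_Ropp; nra. }
apply Rsqr_inj; [auto | lra |]; rewrite !Rsqr_pow2; exact Esq.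
Qed.
End Power.
End Calculus.
Arguments acts {H} B lam K a.
Arguments cay {H} B c x.
Arguments Fop {H} B c sg b n x.

(** * Cayley transforms and fractional powers *)

Section OpIdentities.
Context {H : Hilbert}.
Implicit Types (f g : H -> H) (B : op H).

Lemma op_id_scal : @op_id H = op_scal (RtoC 1) op_id.
Proof.
apply op_ext; intros x y; unfold op_id, graph, op_scal; split.
- intros ->; exists x; split; auto; change (x = RtoC 1 *h x); vec.
- intros [u [-> ->]]; change (RtoC 1 *h x = x); vec.
Qed.

Lemma op_add_shift B e s r : op_add (shift_op B e s) (op_scal (RtoC r) op_id) = shift_op B e (s + r).
Proof.
apply op_ext; intros x y; split.
- intros [p [q [[u [Bu ->]] [[w [Ew ->]] ->]]]]; unfold op_id, graph in Ew; subst w.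
  exists u; split; auto; change ((0, e) *h u +h RtoC s *h x +h RtoC r *h x = (0, e) *h u +h RtoC (s + r) *h x); vec.
- intros [u [Bu ->]]; exists ((0, e) *h u +h RtoC s *h x), (RtoC r *h x); split; [| split].
  + exists u; auto.
  + exists x; split; reflexivity.
  + change ((0, e) *h u +h RtoC (s + r) *h x = (0, e) *h u +h RtoC s *h x +h RtoC r *h x); vec.
Qed.

Lemma op_scal_Ci_shift B : op_scal Ci B = shift_op B 1 0.
Proof.
apply op_ext; intros x y; split.
- intros [u [Bu ->]]; exists u; split; auto; change (Ci *h u = (0, 1) *h u +h RtoC 0 *h x); vec.
- intros [u [Bu ->]]; exists u; split; auto; change ((0, 1) *h u +h RtoC 0 *h x = Ci *h u); vec.
Qed.

Lemma op_comp_graph f g : op_comp (graph f) (graph g) = graph (fun x => f (g x)).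
Proof.
apply op_ext; intros x z; unfold op_comp, graph; split.
- intros [y [-> ->]]; auto.
- intros ->; exists (g x); auto.
Qed.

Lemma op_pow_graph f n : op_pow (graph f) n = graph (Nat.iter n f).
Proof. induction n as [| n IH]; auto; simpl; rewrite IH, op_comp_graph; auto. Qed.

Lemma bounded_graph f : is_linear f -> bounded_op (graph f).
Proof. intros Lf; exists f; split; auto; intros x y; tauto. Qed.
End OpIdentities.

Lemma Cmod_pair (a b : R) : Cmod (a, b) ^ 2 = a ^ 2 + b ^ 2.
Proof. unfold Cmod; simpl fst; simpl snd; apply pow2_sqrt; nra. Qed.

Lemma Cmod_pair_pos (a b : R) : a <> 0 -> 0 < Cmod (a, b).
Proof. intros N; apply Cmod_gt_0, pair_neq_0; auto. Qed.

Lemma Cmod_Crpow (z : C) b : Cmod (Crpow z b) = Rpower (Cmod z) b.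
Proof.
unfold Crpow; rewrite Cmod_mult, Cmod_R, Rabs_pos_eq by (left; apply Rpower_pos).
set (t := b * Carg z).
replace (Cmod (cos t, sin t)) with 1; [ring |].
unfold Cmod; simpl fst; simpl snd; pose proof (sin2_cos2 t) as S; unfold Rsqr in S.
replace (cos t ^ 2 + sin t ^ 2) with 1 by nra; rewrite sqrt_1; auto.
Qed.

(** In modulus, n of the n + alpha factors in the denominator pair with the numerator to form the
    Cayley symbol, and the argument in [Crpow] drops out. *)
Lemma f_na_val c alpha n lam : 0 < c -> Cmod (f_na c alpha n (0, lam)) = f_val c (c + 1) alpha n lam.
Proof.
intros Hc; unfold f_na, f_val, cay_val.
assert (E1 : Cplus (Cminus (0, lam) (RtoC 1)) (RtoC c) = (c - 1, lam))
  by (unfold Cplus, Cminus, Copp, RtoC; simpl; f_equal; ring).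
assert (E2 : Cplus (Cplus (0, lam) (RtoC 1)) (RtoC c) = (c + 1, lam))
  by (unfold Cplus, Cminus, Copp, RtoC; simpl; f_equal; ring).
rewrite E1, E2; pose proof (Cmod_pair_pos (c + 1) lam ltac:(lra)) as P.
pose proof (pair_neq_0 (c + 1) lam ltac:(lra)) as N.
assert (N2 : Crpow (c + 1, lam) (INR n + alpha) <> RtoC 0).
{ intros Z; pose proof (Cmod_Crpow (c + 1, lam) (INR n + alpha)) as E; rewrite Z, Cmod_0 in E.
  pose proof (Rpower_pos (Cmod (c + 1, lam)) (INR n + alpha)); lra. }
rewrite !Cmod_div, Cmod_pow, Cmod_Crpow by auto.
rewrite Rpower_plus, Rpower_pow by auto.
set (q := Cmod (c + 1, lam)) in *; set (p := Cmod (c - 1, lam)).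
pose proof (Rpower_pos q alpha); unfold Rdiv; rewrite Rpow_mult_distr, pow_inv, Rinv_mult; ring.
Qed.

Lemma Cmod_cay_val_sq c lam : 0 < c -> Cmod (cay_val c lam) ^ 2 = 1 - 4 * c / ((c + 1) ^ 2 + lam ^ 2).
Proof.
intros Hc; unfold cay_val; rewrite Cmod_div by (apply pair_neq_0; lra).
unfold Rdiv at 1; rewrite Rpow_mult_distr, pow_inv, !Cmod_pair; field; nra.
Qed.

Lemma Rpower_sq x b : Rpower x b ^ 2 = Rpower x (2 * b).
Proof. replace (2 * b) with (b + b) by ring; rewrite Rpower_plus; ring. Qed.

Lemma Rpower_base_sq x b : 0 < x -> Rpower x b ^ 2 = Rpower (x ^ 2) b.
Proof. intros Hx; simpl; rewrite !Rmult_1_r, Rpower_mult_distr; auto. Qed.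

Lemma exp_pow (x : R) n : exp x ^ n = exp (INR n * x).
Proof.
induction n as [| n IH]; [simpl; rewrite Rmult_0_l, exp_0; auto |].
rewrite S_INR; simpl; rewrite IH, <- exp_plus; f_equal; ring.
Qed.

Lemma exp_le x y : x <= y -> exp x <= exp y.
Proof. intros [L | ->]; [left; apply exp_increasing; auto | right; auto]. Qed.

(* |f(i lambda)|^2 <= k^(-a) n^(-a) u^a exp(-4cu) with u = n / ((c+1)^2 + lambda^2). *)
Lemma f_val_upper c alpha : 0 < c -> 0 < alpha ->
  exists M, 0 < M /\ forall n lam, (1 <= n)%nat -> f_val c c alpha n lam <= M * Rpower (INR n) (- (alpha / 2)).
Proof.
intros Hc Ha; destruct (Rpower_exp_bound alpha (4 * c) Ha) as [K [PK BK]]; [lra |].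
(* The power is taken at c + i lambda while the Cayley symbol involves c + 1; the factor [k]
   satisfies c^2 + lambda^2 >= k y. *)
set (k := c ^ 2 / (c + 1) ^ 2); assert (Pk : 0 < k) by (apply Rdiv_lt_0_compat; nra).
set (M := sqrt (Rpower k (- alpha) * K)).
assert (PM : 0 < M) by (apply sqrt_lt_R0, Rmult_lt_0_compat; auto; apply Rpower_pos).
exists M; split; auto; intros n lam Hn.
assert (Pn : 0 < INR n) by (apply lt_0_INR; lia).
set (y := (c + 1) ^ 2 + lam ^ 2); assert (Py : 0 < y) by (unfold y; nra).
pose proof (Cmod_pair_pos c lam ltac:(lra)) as Pc.
apply sq_le_le; [apply Rmult_le_pos; [lra | left; apply Rpower_pos] |].
unfold f_val; rewrite !Rpow_mult_distr, pow_inv, (Rpower_sq (INR n)).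
unfold M; rewrite pow2_sqrt by (apply Rmult_le_pos; [left; apply Rpower_pos | lra]).
replace (2 * - (alpha / 2)) with (- alpha) by field.
rewrite <- pow_mult, Nat.mul_comm, pow_mult, Cmod_cay_val_sq by auto; fold y.
rewrite Rpower_base_sq, Cmod_pair by auto.
assert (E1 : (1 - 4 * c / y) ^ n <= exp (- (4 * c * (INR n / y)))).
{ replace (- (4 * c * (INR n / y))) with (INR n * - (4 * c / y)) by (field; lra).
  rewrite <- exp_pow; apply pow_incr; split.
  - pose proof (Cmod_cay_val_sq c lam Hc) as E; fold y in E; rewrite <- E; apply pow2_ge_0.
  - pose proof (exp_ineq1_le (- (4 * c / y))); lra. }
assert (E2 : / Rpower (c ^ 2 + lam ^ 2) alpha <= Rpower k (- alpha) * Rpower y (- alpha)).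
{ rewrite Rpower_mult_distr, Rpower_Ropp by auto; apply Rinv_le_contravar; [apply Rpower_pos |].
  apply Rle_Rpower_l; [lra |]; split; [apply Rmult_lt_0_compat; auto |].
  unfold k, y; apply Rmult_le_reg_r with ((c + 1) ^ 2); [nra |].
  replace (c ^ 2 / (c + 1) ^ 2 * ((c + 1) ^ 2 + lam ^ 2) * (c + 1) ^ 2) with (c ^ 2 * ((c + 1) ^ 2 + lam ^ 2)) by (field; lra).
  assert (c ^ 2 <= (c + 1) ^ 2) by nra.
  pose proof (pow2_ge_0 lam); nra. }
assert (E3 : Rpower y (- alpha) = Rpower (INR n / y) alpha * Rpower (INR n) (- alpha)).
{ unfold Rdiv; rewrite <- Rpower_mult_distr by (auto; apply Rinv_0_lt_compat; auto).
  replace (/ y) with (Rpower y (Ropp 1)) by (rewrite Rpower_Ropp, Rpower_1; auto).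
  rewrite Rpower_mult, (Rpower_Ropp (INR n)); replace (Ropp 1 * alpha) with (- alpha) by ring.
  field; apply Rgt_not_eq, Rpower_pos. }
pose proof (BK (INR n / y) ltac:(apply Rdiv_lt_0_compat; auto)) as E4.
apply Rle_trans with (exp (- (4 * c * (INR n / y))) * (Rpower k (- alpha) * Rpower y (- alpha))).
{ apply Rmult_le_compat; auto.
  - apply pow_le; pose proof (Cmod_cay_val_sq c lam Hc) as E; fold y in E; rewrite <- E; apply pow2_ge_0.
  - left; apply Rinv_0_lt_compat, Rpower_pos. }
rewrite E3.
replace (exp (- (4 * c * (INR n / y))) * (Rpower k (- alpha) * (Rpower (INR n / y) alpha * Rpower (INR n) (- alpha))))
  with (Rpower (INR n / y) alpha * exp (- (4 * c * (INR n / y))) * (Rpower k (- alpha) * Rpower (INR n) (- alpha))) by ring.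
replace (Rpower k (- alpha) * K * Rpower (INR n) (- alpha)) with (K * (Rpower k (- alpha) * Rpower (INR n) (- alpha))) by ring.
apply Rmult_le_compat_r; auto; left; apply Rmult_lt_0_compat; apply Rpower_pos.
Qed.

(** At lambda^2 = n the Cayley factor is (1 - u)^n with u = 4c/y and n u <= 4c. From 1 - u >=
    e^(-2u) for u <= 1/2, it is at least e^(-8c); taking [n] above 8c ensures u <= 1/2. The power
    contributes y <= D n. All this concerns squared moduli, hence the e^(-4c) in the constant. *)
Lemma f_val_lower c alpha : 0 < c -> 0 < alpha ->
  exists (M1 : R) (n1 : nat), 0 < M1 /\ (1 <= n1)%nat /\
    forall n, (n1 <= n)%nat -> f_val c (c + 1) alpha n (sqrt (INR n)) >= M1 / Rpower (INR n) (alpha / 2).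
Proof.
intros Hc Ha; set (D := 1 + (c + 1) ^ 2); assert (PD : 0 < D) by (unfold D; nra).
destruct (nfloor_ex (8 * c)) as [n0 [_ Hn0]]; [lra |].
exists (exp (- (4 * c)) * Rpower D (- (alpha / 2))), (S n0); split; [| split; [lia |]].
{ apply Rmult_lt_0_compat; [apply exp_pos | apply Rpower_pos]. }
intros n Hn; apply Rle_ge.
assert (Nn : 8 * c < INR n).
{ apply Rlt_le_trans with (INR (S n0)); [rewrite S_INR; lra | apply le_INR; auto]. }
assert (N1 : 1 <= INR n) by (apply (le_INR 1); lia).
assert (Sq : sqrt (INR n) ^ 2 = INR n) by (apply pow2_sqrt; lra).
set (y := (c + 1) ^ 2 + INR n); assert (Py : 0 < y) by (unfold y; nra).
pose proof (Cmod_pair_pos (c + 1) (sqrt (INR n)) ltac:(lra)) as Pc.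
apply sq_le_le; [apply f_val_nonneg |].
unfold f_val, Rdiv; rewrite !Rpow_mult_distr, !pow_inv, (Rpower_sq D), (Rpower_sq (INR n)).
rewrite <- pow_mult, (Nat.mul_comm n), pow_mult, Cmod_cay_val_sq, Sq by auto; fold y.
rewrite (Rpower_base_sq (Cmod _)), Cmod_pair, Sq by auto; fold y.
replace (2 * (alpha * / 2)) with alpha by field; replace (2 * - (alpha * / 2)) with (- alpha) by field.
rewrite exp_pow; replace (INR 2 * - (4 * c)) with (- (8 * c)) by (simpl; ring).
assert (u1 : 4 * c / y <= / 2).
{ apply Rmult_le_reg_r with y; auto; unfold Rdiv; rewrite Rmult_assoc, Rinv_l by lra; unfold y; nra. }
assert (u0 : 0 < 4 * c / y) by (apply Rdiv_lt_0_compat; lra).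
assert (E1 : exp (- (8 * c)) <= (1 - 4 * c / y) ^ n).
{ set (u := 4 * c / y) in *.
  assert (F : exp (- (2 * u)) <= 1 - u).
  { rewrite exp_Ropp; pose proof (exp_ineq1_le (2 * u)).
    apply Rle_trans with (/ (1 + 2 * u)); [apply Rinv_le_contravar; lra |].
    apply Rmult_le_reg_r with (1 + 2 * u); [lra |]; rewrite Rinv_l by lra; nra. }
  apply Rle_trans with (exp (- (2 * u)) ^ n).
  - rewrite exp_pow; apply exp_le.
    assert (INR n * u <= 4 * c); [| lra].
    unfold u; apply Rmult_le_reg_r with y; auto.
    replace (INR n * (4 * c / y) * y) with (INR n * (4 * c)) by (field; lra).
    unfold y; nra.
  - apply pow_incr; split; auto; left; apply exp_pos. }
assert (E2 : Rpower D (- alpha) * / Rpower (INR n) alpha <= / Rpower y alpha).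
{ rewrite Rpower_Ropp, <- Rinv_mult, Rpower_mult_distr by lra.
  apply Rinv_le_contravar; [apply Rpower_pos |].
  apply Rle_Rpower_l; [lra |]; split; auto; unfold y, D; nra. }
rewrite Rmult_assoc; apply Rmult_le_compat; auto.
- left; apply exp_pos.
- left; apply Rmult_lt_0_compat; [apply Rpower_pos | apply Rinv_0_lt_compat, Rpower_pos].
Qed.

(** * The operators of the theorem as everywhere defined maps *)

Section Main.
Context {H : Hilbert} {B : op H} (SB : self_adjoint B).
Variables (c alpha : R).
Hypotheses (Hc : 0 < c) (Ha : 0 < alpha).
Implicit Types x y z u v w : H.
Let LB : linear_op B := proj1 SB.

Definition Aop : op H := op_add (op_scal Ci B) (op_scal (RtoC c) op_id).
Definition Vop : op H := op_comp (op_sub Aop op_id) (op_inv (op_add Aop op_id)).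

Lemma Aop_shift : Aop = shift_op B 1 c.
Proof. unfold Aop; rewrite op_scal_Ci_shift, op_add_shift; f_equal; ring. Qed.

Lemma Aop_plus_id : op_add Aop op_id = shift_op B 1 (c + 1).
Proof. rewrite Aop_shift, op_id_scal, op_add_shift; auto. Qed.

Lemma Aop_minus_id : op_sub Aop op_id = shift_op B 1 (c - 1).
Proof. rewrite Aop_shift; exact (op_add_shift B 1 c (-1)). Qed.

Lemma f_op_shift n : f_op c alpha n B =
  op_comp (op_pow (shift_op B 1 (c - 1)) n) (neg_pow (INR n + alpha) (shift_op B 1 (c + 1))).
Proof.
unfold f_op; rewrite op_scal_Ci_shift.
assert (E1 : op_sub (shift_op B 1 0) op_id = shift_op B 1 (0 + -1)) by exact (op_add_shift B 1 0 (-1)).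
assert (E2 : op_add (shift_op B 1 0) op_id = shift_op B 1 (0 + 1)) by (rewrite op_id_scal; apply op_add_shift).
rewrite E1, E2, !op_add_shift.
replace (0 + -1 + c) with (c - 1) by ring; replace (0 + 1 + c) with (c + 1) by ring; auto.
Qed.

Lemma shift_inv sg : 0 < sg -> op_inv (shift_op B 1 sg) = graph (Res B (RtoC sg)).
Proof.
intros Hs; assert (N : fst (RtoC sg) <> 0) by (simpl; lra).
apply op_ext; intros z w; unfold op_inv, graph; split.
- intros [u [Bu ->]]; symmetry; apply (Res_eq SB _ _ _ u _ (bounded_below_Re SB _ N)); auto.
- intros ->; destruct (Res_spec SB _ _ z (bounded_below_Re SB _ N)) as [u [Bu E]]; exists u; split; auto.
Qed.

Lemma shift_Res w z : shift_op B 1 (c - 1) (Res B (RtoC (c + 1)) w) z <-> z = cay B c w.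
Proof.
assert (N : fst (RtoC (c + 1)) <> 0) by (simpl; lra).
destruct (Res_spec SB _ _ w (bounded_below_Re SB _ N)) as [u [Bu E]].
assert (Ez : (0, 1) *h u +h RtoC (c - 1) *h Res B (RtoC (c + 1)) w = cay B c w).
{ unfold cay; rewrite E at 2; vec. }
split.
- intros [v [Bv ->]]; rewrite (lop_fun LB _ _ _ Bv Bu); auto.
- intros ->; exists u; auto.
Qed.

Lemma Vop_graph : Vop = graph (cay B c).
Proof.
unfold Vop; rewrite Aop_minus_id, Aop_plus_id, shift_inv by lra.
apply op_ext; intros x z; split.
- intros [y [-> S]]; apply shift_Res; auto.
- intros E; exists (Res B (RtoC (c + 1)) x); split; [reflexivity | apply shift_Res; auto].
Qed.

Let good_shift sg (Hs : 0 < sg) : good sg (shift_op B 1 sg) := shift_op_good SB 1 sg R1_neq_R0 Hs.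

Lemma V_neg_pow_graph n sg : 0 < sg ->
  op_comp (op_pow Vop n) (neg_pow alpha (shift_op B 1 sg)) = graph (Fop B c sg alpha n).
Proof.
intros Hs; rewrite Vop_graph, op_pow_graph, (neg_pow_graph (good_shift sg Hs)), op_comp_graph by auto; auto.
Qed.

(** The only additivity of exponents that is needed: splitting off an integer, by iterating [npow_S]
    with the resolvent in the role of T^(-1). *)
Lemma npow_add n x : npow (shift_op B 1 (c + 1)) (INR n + alpha) x =
  Nat.iter n (Res B (RtoC (c + 1))) (npow (shift_op B 1 (c + 1)) alpha x).
Proof.
assert (Hc1 : 0 < c + 1) by lra.
assert (N : fst (RtoC (c + 1)) <> 0) by (simpl; lra).
revert x; induction n as [| n IH]; intros x.
- simpl; rewrite Rplus_0_l; auto.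
- destruct (Res_spec SB _ _ x (bounded_below_Re SB _ N)) as [u [Bu E]].
  replace (INR (S n) + alpha) with (INR n + alpha + 1) by (rewrite S_INR; ring).
  rewrite (npow_S (good_shift (c + 1) Hc1) (INR n + alpha) (Res B (RtoC (c + 1)) x) x).
  + rewrite IH, <- (npow_Res_commute SB) by (auto; lra).
    rewrite <- Nat.iter_succ_r; reflexivity.
  + pose proof (pos_INR n); lra.
  + exists u; split; auto.
Qed.

(** The unbounded power is applied to a vector of the form (A + I)^(-n) w. As [cay] commutes with
    the resolvent, each factor A - I can be paired with one factor (A + I)^(-1). *)
Lemma pow_shift_Res n w y : op_pow (shift_op B 1 (c - 1)) n (Nat.iter n (Res B (RtoC (c + 1))) w) y
  <-> y = Nat.iter n (cay B c) w.
Proof.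
assert (N : fst (RtoC (c + 1)) <> 0) by (simpl; lra).
revert w y; induction n as [| n IH]; intros w y; [reflexivity |].
assert (E : Nat.iter n (cay B c) (Res B (RtoC (c + 1)) w) = Res B (RtoC (c + 1)) (Nat.iter n (cay B c) w)).
{ exact (commutes_iter _ n (cay_commutes SB c Hc) _ N w). }
change (op_pow (shift_op B 1 (c - 1)) (S n)) with (op_comp (shift_op B 1 (c - 1)) (op_pow (shift_op B 1 (c - 1)) n)).
rewrite Nat.iter_succ_r; unfold op_comp; split.
- intros [q [Q S]]; apply IH in Q; subst q; rewrite E in S; apply shift_Res in S; auto.
- intros ->; exists (Nat.iter n (cay B c) (Res B (RtoC (c + 1)) w)); split; [apply IH; auto |].
  rewrite E; apply shift_Res; auto.
Qed.

Lemma f_op_graph n : f_op c alpha n B = graph (Fop B c (c + 1) alpha n).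
Proof.
assert (Hc1 : 0 < c + 1) by lra; pose proof (pos_INR n).
rewrite f_op_shift, (neg_pow_graph (good_shift (c + 1) Hc1)) by lra.
apply op_ext; intros x z; unfold op_comp, graph; split.
- intros [y [-> P]]; rewrite npow_add in P; apply pow_shift_Res in P; auto.
- intros ->; eexists; split; [reflexivity |]; rewrite npow_add; apply pow_shift_Res; auto.
Qed.

Lemma Lub_spectrum_norm n : (exists lam, approx_eigenvalue B lam) ->
  opnorm (graph (Fop B c (c + 1) alpha n)) =
  Lub_Rbar (fun r => exists l : C, spectrum (op_scal Ci B) l /\ r = Cmod (f_na c alpha n l)).
Proof.
intros [lam0 A0]; assert (Hc1 : 0 < c + 1) by lra.
destruct (opnorm_graph_finite _ (Fop_linear SB c Hc (c + 1) alpha n Hc1 Ha)) as [m [Em Pm]].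
rewrite Em; symmetry; apply is_lub_Rbar_unique.
assert (Le : forall lam, approx_eigenvalue B lam -> f_val c (c + 1) alpha n lam <= m).
{ intros lam A; destruct (acts_Fop SB c Hc (c + 1) alpha n Hc1 Ha lam) as [a [<- Aa]].
  apply (acts_lower _ a lam m (Fop_linear SB c Hc (c + 1) alpha n Hc1 Ha) Em Aa A). }
split.
- intros r [l [Sl ->]]; destruct (spectrum_iB_inv SB l Sl) as [Z A]; destruct l as [l1 l2]; simpl in Z, A; subst l1.
  rewrite f_na_val by auto; apply Le; auto.
- intros b Ub.
  assert (Ub' : forall lam, approx_eigenvalue B lam -> Rbar_le (f_val c (c + 1) alpha n lam) b).
  { intros lam A; apply Ub; exists (0, lam); split; [apply spectrum_iB_intro; auto | symmetry; apply f_na_val; auto]. }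
  destruct Pm as [Pm | <-].
  + destruct (Fop_norm_attained SB c Hc (c + 1) alpha n Hc1 Ha m Em Pm) as [lam [A <-]]; auto.
  (* If the norm is 0, the nonnegative value at one spectral point suffices; over an empty spectrum
     the supremum would be minus infinity. *)
  + apply Rbar_le_trans with (2 := Ub' lam0 A0); simpl; apply f_val_nonneg.
Qed.

Definition Kop : op H := op_add op_id (op_inv Aop).

Lemma Kop_iff x y : Kop x y <-> y = x +h Res B (RtoC c) x.
Proof.
unfold Kop; rewrite Aop_shift, shift_inv by auto; split.
- intros [u [v [-> [-> ->]]]]; reflexivity.
- intros ->; exists x, (Res B (RtoC c) x); repeat split; reflexivity.
Qed.

Let c_neq : fst (RtoC c) <> 0. Proof. simpl; lra. Qed.
Let LK : is_linear (Res B (RtoC c)) := Res_linear SB _ _ (bounded_below_Re SB _ c_neq).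

Lemma Kop_linear : linear_op Kop.
Proof.
split; [| split; [| split]].
- intros x y z; rewrite !Kop_iff; intros -> ->; auto.
- apply Kop_iff; rewrite (lin_zero LK); change ((0h : H) = 0h +h 0h); vec.
- intros x y u v; rewrite !Kop_iff; intros -> ->.
  change (x +h Res B (RtoC c) x +h (y +h Res B (RtoC c) y) = x +h y +h Res B (RtoC c) (x +h y)).
  rewrite (lin_plus LK); vec.
- intros a x u; rewrite !Kop_iff; intros ->.
  change (a *h (x +h Res B (RtoC c) x) = a *h x +h Res B (RtoC c) (a *h x)).
  rewrite (lin_scal LK); vec.
Qed.

(** With w = A^(-1) x, the real part of the pairing of A^(-1) x with x is [c * norm w ^ 2], so I +
    A^(-1) is accretive with constant 1. *)
Lemma Kop_good : good 1 Kop.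
Proof.
assert (Acc : forall x y, Kop x y -> norm x ^ 2 <= rip y x).
{ intros x y K; apply Kop_iff in K; subst y; rewrite rip_plus_l, <- norm_sq_rip.
  destruct (Res_spec SB _ _ x (bounded_below_Re SB _ c_neq)) as [u [Bu E]].
  set (w := Res B (RtoC c) x) in *.
  assert (S : rip x w = c * norm w ^ 2) by (apply (shift_op_rip SB 1 c w x); exists u; auto).
  rewrite (rip_sym w), S; pose proof (pow2_ge_0 (norm w)); nra. }
assert (Dn : densely_defined Kop).
{ intros x eps; exists x; split.
  - exists (x +h Res B (RtoC c) x); apply Kop_iff; auto.
  - change (norm (x -h x) < eps); replace (x -h x) with (0h : H) by vec; rewrite norm_zero_eq; apply cond_pos. }
constructor; [lra | constructor; auto |].
- exact Kop_linear.
- intros x y K; pose proof (Acc x y K); pose proof (pow2_ge_0 (norm x)); lra.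
(* Substituting x = A w turns x + h (x + A^(-1) x) = z into (iB + d) w = z/(1 + h). *)
- intros h Hh z; set (d := c + h / (1 + h)).
  assert (Pd : 0 < d) by (unfold d; assert (0 < h / (1 + h)) by (apply Rdiv_lt_0_compat; lra); lra).
  assert (N : fst (RtoC d) <> 0) by (simpl; lra).
  destruct (Res_spec SB _ _ (RtoC (/ (1 + h)) *h z) (bounded_below_Re SB _ N)) as [u [Bu E]].
  set (w := Res B (RtoC d) (RtoC (/ (1 + h)) *h z)) in *.
  set (x := Ci *h u +h RtoC c *h w).
  assert (Ex : Res B (RtoC c) x = w) by (apply (Res_eq SB _ _ _ u _ (bounded_below_Re SB _ c_neq)); auto).
  exists x, (x +h w); split; [apply Kop_iff; rewrite Ex; auto |].
  transitivity (RtoC (1 + h) *h (RtoC (/ (1 + h)) *h z)); [vec; lra |].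
  rewrite E; unfold x, d; vec; lra.
- split; [exact Kop_linear | split; auto]; intros x y K; rewrite Rmult_1_l; auto.
Qed.

Definition NK : H -> H := npow Kop alpha.

Lemma neg_pow_Kop : neg_pow alpha Kop = graph NK.
Proof. apply (neg_pow_graph Kop_good); auto. Qed.

Lemma NK_linear : is_linear NK.
Proof. apply (npow_linear Kop_good); auto. Qed.

Lemma acts_Res sg lam : 0 < sg -> acts B lam (Res B (RtoC sg)) (Cinv (sg, lam)).
Proof.
intros Hs; assert (N : fst (RtoC sg) <> 0) by (simpl; lra).
assert (Nm : (sg, lam) <> RtoC 0) by (apply pair_neq_0; lra).
pose proof (Res_linear SB _ _ (bounded_below_Re SB _ N)) as LR; destruct (linear_norm _ LR) as [M [PM HM]].
exists (M * Cmod (Cinv (sg, lam))); split; [pose proof (Cmod_ge_0 (Cinv (sg, lam))); nra |].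
intros x u Bx.
assert (E1 : Res B (RtoC sg) (Ci *h u +h RtoC sg *h x) = x)
  by (apply (Res_eq SB _ _ _ u _ (bounded_below_Re SB _ N)); auto).
assert (Ek : Cmult (Cinv (sg, lam)) (sg, lam) = RtoC 1) by (apply Cinv_l; auto).
set (k := Cinv (sg, lam)) in *.
replace (Res B (RtoC sg) x -h k *h x) with (Res B (RtoC sg) (Cmult (Copp Ci) k *h (u -h RtoC lam *h x))).
- eapply Rle_trans; [apply HM |]; rewrite norm_scal_eq, Cmod_mult, Cmod_opp, Cmod_Ci; lra.
- transitivity (Res B (RtoC sg) x -h k *h Res B (RtoC sg) (Ci *h u +h RtoC sg *h x)); [| rewrite E1; auto].
  rewrite <- (lin_scal LR), <- (lin_minus LR); apply f_equal.
  transitivity (Cmult k (sg, lam) *h x -h k *h (Ci *h u +h RtoC sg *h x)); [vec | rewrite Ek; vec].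
Qed.

Lemma Cmod_one_plus_inv lam : Cmod (Cplus (RtoC 1) (Cinv (c, lam))) = Cmod (c + 1, lam) / Cmod (c, lam).
Proof.
assert (N : (c, lam) <> RtoC 0) by (apply pair_neq_0; lra).
rewrite <- Cmod_div by auto; f_equal.
replace ((c + 1, lam) : C) with (Cplus (c, lam) (RtoC 1)) by (unfold Cplus, RtoC; simpl; f_equal; ring).
field; auto.
Qed.

(** The symbol of I + A^(-1) is 1 + 1/(c + i lambda) = (c + 1 + i lambda)/(c + i lambda). Its real
    part is at least 1, as the approximation lemma requires for an operator with decay rate 1. *)
Lemma acts_NK lam : exists a, Cmod a = / Rpower (Cmod (c + 1, lam) / Cmod (c, lam)) alpha /\ acts B lam NK a.
Proof.
set (l := Cplus (RtoC 1) (Cinv (c, lam))).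
assert (Rl : 1 <= fst l).
{ unfold l; simpl.
  assert (0 <= c / (c * (c * 1) + lam * (lam * 1))).
  { left; apply Rdiv_lt_0_compat; auto; nra. }
  lra. }
exists (cpow_neg alpha l); split.
{ rewrite cpow_neg_mod by (auto; lra); unfold l; rewrite Cmod_one_plus_inv; auto. }
destruct (acts_Res c lam Hc) as [M [PM HM]].
assert (P : 0 <= gint (alpha + 1) 1 / Gamma alpha).
{ rewrite gint_Gamma by lra; left; apply Rdiv_lt_0_compat; apply Gamma_pos; lra. }
exists (gint (alpha + 1) 1 / Gamma alpha * M); split; [apply Rmult_le_pos; auto |].
intros x u Bx.
pose proof (npow_approx_eigen Kop_good alpha l x (x +h Res B (RtoC c) x) Ha Rl (proj2 (Kop_iff x _) eq_refl)) as A.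
replace (x +h Res B (RtoC c) x -h l *h x) with (Res B (RtoC c) x -h Cinv (c, lam) *h x) in A.
2: { unfold l; set (k := Cinv (c, lam)); vec. }
eapply Rle_trans; [apply A |]; rewrite Rmult_assoc; apply Rmult_le_compat_l; auto.
Qed.

(** The symbol moduli for shifts [c] and [c + 1] differ by the factor [q], and [/ q], the symbol
    modulus of [NK], is at most [m]. This is the origin of the division by a norm in M2. *)
Lemma NK_norm_pos m : opnorm (graph NK) = Finite m -> forall lam, approx_eigenvalue B lam ->
  0 < m /\ forall n, f_val c (c + 1) alpha n lam / m <= f_val c c alpha n lam.
Proof.
intros Em lam A; destruct (acts_NK lam) as [a [Ea Aa]].
pose proof (acts_lower NK a lam m NK_linear Em Aa A) as L; rewrite Ea in L.
pose proof (Cmod_pair_pos (c + 1) lam ltac:(lra)) as P1; pose proof (Cmod_pair_pos c lam ltac:(lra)) as P2.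
set (q := Rpower (Cmod (c + 1, lam) / Cmod (c, lam)) alpha) in *; assert (Pq : 0 < q) by apply Rpower_pos.
assert (Pm : 0 < m) by (pose proof (Rinv_0_lt_compat q Pq); lra).
split; auto; intros n.
assert (E : f_val c c alpha n lam = f_val c (c + 1) alpha n lam * q).
{ unfold f_val, q, Rdiv; rewrite <- Rpower_mult_distr by (auto; apply Rinv_0_lt_compat; auto).
  replace (Rpower (/ Cmod (c, lam)) alpha) with (/ Rpower (Cmod (c, lam)) alpha).
  2: { unfold Rpower; rewrite ln_Rinv by auto; rewrite <- exp_Ropp; f_equal; ring. }
  field; split; apply Rgt_not_eq, Rpower_pos. }
rewrite E; unfold Rdiv; apply Rmult_le_compat_l; [apply f_val_nonneg |].
rewrite <- (Rinv_inv q); apply Rinv_le_contravar; auto; apply Rinv_0_lt_compat; auto.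
Qed.
End Main.
Arguments Aop {H} B c.
Arguments Vop {H} B c.
Arguments Kop {H} B c.

(** * The Hilbert space of square-summable sequences *)

Lemma nonneg_series_bound (a : nat -> R) (M : R) :
  (forall n, 0 <= a n) -> (forall n, sum_f_R0 a n <= M) -> ex_series a /\ Series a <= M.
Proof.
intros Pa B.
assert (Ex : ex_series a).
{ destruct (ex_finite_lim_seq_incr (sum_n a) M) as [l Hl].
  - intros n; rewrite !sum_n_Reals; simpl; pose proof (Pa (S n)); lra.
  - intros n; rewrite sum_n_Reals; auto.
  - exists l; exact Hl. }
split; auto.
pose proof (Series_correct a Ex) as L.
apply (is_lim_seq_le (sum_n a) (fun _ => M) (Series a) M); [intros n; rewrite sum_n_Reals; auto | exact L | apply is_lim_seq_const].
Qed.

Lemma partial_le_series (a : nat -> R) n : (forall n, 0 <= a n) -> ex_series a -> sum_f_R0 a n <= Series a.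
Proof.
intros Pa Ex; pose proof (Series_correct a Ex) as L.
apply (is_lim_seq_le_loc (fun _ => sum_f_R0 a n) (sum_n a) (sum_f_R0 a n) (Series a)); [| apply is_lim_seq_const | exact L].
exists n; intros m Hm; rewrite sum_n_Reals.
induction Hm as [| m Hm IH]; [lra |]; simpl; pose proof (Pa (S m)); lra.
Qed.

Lemma term_le_series (a : nat -> R) n : (forall n, 0 <= a n) -> ex_series a -> a n <= Series a.
Proof.
intros Pa Ex; eapply Rle_trans; [| apply (partial_le_series a n); auto].
destruct n as [| n]; simpl; [lra |].
assert (0 <= sum_f_R0 a n) by (apply cond_pos_sum; auto); lra.
Qed.

Lemma ex_series_dominated (a b : nat -> R) : (forall n, Rabs (a n) <= b n) -> ex_series b -> ex_series a.
Proof. exact (ex_series_le (K := R_AbsRing) (V := R_CompleteNormedModule) a b). Qed.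

Lemma ex_series_Rplus (a b : nat -> R) : ex_series a -> ex_series b -> ex_series (fun n => a n + b n).
Proof. exact (ex_series_plus (K := R_AbsRing) (V := R_NormedModule) a b). Qed.

Lemma ex_series_Rscal (c : R) (a : nat -> R) : ex_series a -> ex_series (fun n => c * a n).
Proof. exact (ex_series_scal_l (K := R_AbsRing) (V := R_NormedModule) c a). Qed.

Definition csq (z : C) : R := fst z ^ 2 + snd z ^ 2.
Lemma csq_nonneg z : 0 <= csq z. Proof. unfold csq; nra. Qed.

Lemma csq_sub z w : csq (Cplus z (Cmult (RtoC (-1)) w)) = (fst z - fst w) ^ 2 + (snd z - snd w) ^ 2.
Proof. unfold csq, Cplus, Cmult, RtoC; simpl; ring. Qed.

Record l2 := mkl2 { coord : nat -> C; l2_summable : ex_series (fun k => csq (coord k)) }.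

Lemma l2_ext (x y : l2) : (forall k, coord x k = coord y k) -> x = y.
Proof.
destruct x as [x Hx], y as [y Hy]; simpl; intros E.
assert (x = y) as -> by (apply functional_extensionality; auto).
f_equal; apply proof_irrelevance.
Qed.

Lemma l2_plus_summable (x y : nat -> C) : ex_series (fun k => csq (x k)) -> ex_series (fun k => csq (y k)) ->
  ex_series (fun k => csq (Cplus (x k) (y k))).
Proof.
intros Hx Hy; apply ex_series_dominated with (fun k => 2 * csq (x k) + 2 * csq (y k)).
- intros k; rewrite Rabs_pos_eq by apply csq_nonneg; unfold csq, Cplus; simpl fst; simpl snd.
  pose proof (pow2_ge_0 (fst (x k) - fst (y k))); pose proof (pow2_ge_0 (snd (x k) - snd (y k))); nra.
- apply ex_series_Rplus; apply ex_series_Rscal; auto.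
Qed.

Lemma l2_scal_summable (a : C) (x : nat -> C) : ex_series (fun k => csq (x k)) -> ex_series (fun k => csq (Cmult a (x k))).
Proof.
intros Hx; apply ex_series_dominated with (fun k => csq a * csq (x k)); [| apply ex_series_Rscal; auto].
intros k; rewrite Rabs_pos_eq by apply csq_nonneg; unfold csq, Cmult; simpl; right; ring.
Qed.

Lemma l2_zero_summable : ex_series (fun k : nat => csq (RtoC 0)).
Proof.
destruct (nonneg_series_bound (fun _ => csq (RtoC 0)) 0) as [E _]; auto; intros n.
- apply csq_nonneg.
- induction n as [| n IH]; simpl in *; unfold csq, RtoC in *; simpl in *; lra.
Qed.

Definition l2_plus (x y : l2) : l2 := mkl2 _ (l2_plus_summable _ _ (l2_summable x) (l2_summable y)).
Definition l2_scal (a : C) (x : l2) : l2 := mkl2 _ (l2_scal_summable a _ (l2_summable x)).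
Definition l2_zero : l2 := mkl2 _ l2_zero_summable.
Definition l2_opp (x : l2) : l2 := l2_scal (RtoC (-1)) x.
Definition l2_minus (x y : l2) : l2 := l2_plus x (l2_opp y).

Ltac l2_eq := intros; apply l2_ext; intros k; simpl;
  unfold Cplus, Cmult, Copp, RtoC; simpl; try (destruct (coord _ k)); simpl; f_equal; ring.

Definition l2_rip (x y : l2) : R := Series (fun k => fst (coord x k) * fst (coord y k) + snd (coord x k) * snd (coord y k)).
Definition l2_iip (x y : l2) : R := Series (fun k => snd (coord x k) * fst (coord y k) - fst (coord x k) * snd (coord y k)).

Lemma l2_ex_rip x y : ex_series (fun k => fst (coord x k) * fst (coord y k) + snd (coord x k) * snd (coord y k)).
Proof.
apply ex_series_dominated with (fun k => csq (coord x k) + csq (coord y k)); [| apply ex_series_Rplus; apply l2_summable].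
intros k; unfold csq; set (a := fst (coord x k)); set (b := snd (coord x k)); set (a' := fst (coord y k)); set (b' := snd (coord y k)).
pose proof (pow2_ge_0 (a - a')); pose proof (pow2_ge_0 (b - b')); pose proof (pow2_ge_0 (a + a')); pose proof (pow2_ge_0 (b + b')).
apply Rabs_le; nra.
Qed.

Lemma l2_ex_iip x y : ex_series (fun k => snd (coord x k) * fst (coord y k) - fst (coord x k) * snd (coord y k)).
Proof.
apply ex_series_dominated with (fun k => csq (coord x k) + csq (coord y k)); [| apply ex_series_Rplus; apply l2_summable].
intros k; unfold csq; set (a := fst (coord x k)); set (b := snd (coord x k)); set (a' := fst (coord y k)); set (b' := snd (coord y k)).
pose proof (pow2_ge_0 (b - a')); pose proof (pow2_ge_0 (a - b')); pose proof (pow2_ge_0 (b + a')); pose proof (pow2_ge_0 (a + b')).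
apply Rabs_le; nra.
Qed.

Lemma l2_rip_plus x y z : l2_rip (l2_plus x y) z = l2_rip x z + l2_rip y z.
Proof. unfold l2_rip; rewrite <- Series_plus by apply l2_ex_rip; apply Series_ext; intros k; simpl; ring. Qed.

Lemma l2_iip_plus x y z : l2_iip (l2_plus x y) z = l2_iip x z + l2_iip y z.
Proof. unfold l2_iip; rewrite <- Series_plus by apply l2_ex_iip; apply Series_ext; intros k; simpl; ring. Qed.

Lemma l2_rip_scal a x z : l2_rip (l2_scal a x) z = fst a * l2_rip x z - snd a * l2_iip x z.
Proof.
unfold l2_rip, l2_iip, Rminus; rewrite Ropp_mult_distr_l, <- !Series_scal_l, <- Series_plus.
- apply Series_ext; intros k; simpl; ring.
- apply ex_series_Rscal, l2_ex_rip.
- apply ex_series_Rscal, l2_ex_iip.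
Qed.

Lemma l2_iip_scal a x z : l2_iip (l2_scal a x) z = fst a * l2_iip x z + snd a * l2_rip x z.
Proof.
unfold l2_rip, l2_iip; rewrite <- !Series_scal_l, <- Series_plus.
- apply Series_ext; intros k; simpl; ring.
- apply ex_series_Rscal, l2_ex_iip.
- apply ex_series_Rscal, l2_ex_rip.
Qed.

Lemma l2_rip_sym x y : l2_rip x y = l2_rip y x.
Proof. apply Series_ext; intros k; ring. Qed.

Lemma l2_iip_sym x y : l2_iip x y = - l2_iip y x.
Proof.
unfold l2_iip; replace (- Series (fun k => snd (coord y k) * fst (coord x k) - fst (coord y k) * snd (coord x k)))
  with (-1 * Series (fun k => snd (coord y k) * fst (coord x k) - fst (coord y k) * snd (coord x k))) by ring.
rewrite <- Series_scal_l; apply Series_ext; intros k; ring.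
Qed.

Lemma l2_rip_self x : l2_rip x x = Series (fun k => csq (coord x k)).
Proof. apply Series_ext; intros k; unfold csq; ring. Qed.

Lemma l2_rip_self_nonneg x : 0 <= l2_rip x x.
Proof.
rewrite l2_rip_self; eapply Rle_trans; [apply (csq_nonneg (coord x 0)) |].
apply (term_le_series (fun k => csq (coord x k)) 0); [intros; apply csq_nonneg | apply l2_summable].
Qed.

Definition l2_norm (x : l2) : R := sqrt (l2_rip x x).

Lemma l2_norm_sq x : l2_norm x ^ 2 = l2_rip x x.
Proof. apply pow2_sqrt, l2_rip_self_nonneg. Qed.

Lemma l2_norm_nonneg x : 0 <= l2_norm x.
Proof. apply sqrt_pos. Qed.

Lemma l2_coord_le x k : csq (coord x k) <= l2_norm x ^ 2.
Proof.
rewrite l2_norm_sq, l2_rip_self; apply (term_le_series (fun k => csq (coord x k)) k); [intros; apply csq_nonneg | apply l2_summable].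
Qed.

Lemma l2_norm_zero_inv x : l2_norm x = 0 -> x = l2_zero.
Proof.
intros N; apply l2_ext; intros k; pose proof (l2_coord_le x k) as L; rewrite N in L.
unfold csq in L; simpl; destruct (coord x k) as [a b]; simpl in L; unfold RtoC; f_equal; nra.
Qed.

Lemma l2_rip_quadratic (t : R) x y :
  l2_rip (l2_plus x (l2_scal (RtoC t) y)) (l2_plus x (l2_scal (RtoC t) y)) = l2_rip x x + 2 * t * l2_rip x y + t ^ 2 * l2_rip y y.
Proof.
rewrite l2_rip_plus, !(l2_rip_sym _ (l2_plus _ _)), !l2_rip_plus, !l2_rip_scal, !(l2_rip_sym _ (l2_scal _ _)), !l2_rip_scal.
simpl; rewrite (l2_rip_sym y x); ring.
Qed.

Lemma l2_cauchy_schwarz x y : l2_rip x y <= l2_norm x * l2_norm y.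
Proof.
pose proof (l2_norm_sq x) as Ex; pose proof (l2_norm_sq y) as Ey.
pose proof (l2_norm_nonneg x) as Px; pose proof (l2_norm_nonneg y) as Py.
assert (Q : forall t, 0 <= l2_rip x x + 2 * t * l2_rip x y + t ^ 2 * l2_rip y y).
{ intros t; rewrite <- l2_rip_quadratic; apply l2_rip_self_nonneg. }
rewrite <- Ex, <- Ey in Q; set (a := l2_norm x) in *; set (b := l2_norm y) in *; set (r := l2_rip x y) in *.
destruct Py as [Pb | Zb].
- pose proof (Q (- (r / b ^ 2))) as Q1.
  replace (a ^ 2 + 2 * - (r / b ^ 2) * r + (- (r / b ^ 2)) ^ 2 * b ^ 2) with (a ^ 2 - r ^ 2 / b ^ 2) in Q1 by (field; lra).
  apply sq_le_le; [nra |].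
  assert (r ^ 2 / b ^ 2 * b ^ 2 = r ^ 2) by (field; lra).
  assert (r ^ 2 / b ^ 2 * b ^ 2 <= a ^ 2 * b ^ 2) by (apply Rmult_le_compat_r; nra).
  nra.
- rewrite <- Zb in *; rewrite Rmult_0_r; apply Rnot_lt_le; intros L.
  (* With [b = 0] the quadratic is affine in the parameter, and this choice gives it the value
     -1. *)
  pose proof (Q (- (a ^ 2 + 1) / (2 * r))) as Q1.
  replace (a ^ 2 + 2 * (- (a ^ 2 + 1) / (2 * r)) * r + (- (a ^ 2 + 1) / (2 * r)) ^ 2 * 0 ^ 2) with (- (1)) in Q1 by (field; lra).
  lra.
Qed.

Lemma l2_norm_plus x y : l2_norm (l2_plus x y) <= l2_norm x + l2_norm y.
Proof.
pose proof (l2_norm_nonneg x); pose proof (l2_norm_nonneg y).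
apply sq_le_le; [lra |]; rewrite l2_norm_sq, l2_rip_plus, !(l2_rip_sym _ (l2_plus _ _)), !l2_rip_plus.
pose proof (l2_cauchy_schwarz x y); rewrite (l2_rip_sym y x).
pose proof (l2_norm_sq x); pose proof (l2_norm_sq y); nra.
Qed.

Lemma l2_norm_scal a x : l2_norm (l2_scal a x) = Cmod a * l2_norm x.
Proof.
assert (E : l2_rip (l2_scal a x) (l2_scal a x) = (Cmod a * l2_norm x) ^ 2).
{ rewrite Rpow_mult_distr, l2_norm_sq, l2_rip_scal, (l2_rip_sym x), l2_rip_scal, (l2_iip_sym x (l2_scal a x)), l2_iip_scal.
  assert (Z : l2_iip x x = 0) by (pose proof (l2_iip_sym x x); lra).
  rewrite Z; destruct a as [p q]; rewrite Cmod_pair; simpl; ring. }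
unfold l2_norm at 1; rewrite E; apply sqrt_pow2, Rmult_le_pos; [apply Cmod_ge_0 | apply l2_norm_nonneg].
Qed.

Lemma l2_minus_self x : l2_norm (l2_minus x x) = 0.
Proof.
replace (l2_minus x x) with (l2_scal (RtoC 0) x) by l2_eq; rewrite l2_norm_scal, Cmod_0; ring.
Qed.

Lemma l2_minus_sym x y : l2_norm (l2_minus x y) = l2_norm (l2_minus y x).
Proof.
replace (l2_minus x y) with (l2_scal (RtoC (-1)) (l2_minus y x)) by l2_eq.
rewrite l2_norm_scal, Cmod_R, Rabs_left by lra; ring.
Qed.

Lemma l2_minus_tri x y z : l2_norm (l2_minus z x) <= l2_norm (l2_minus y x) + l2_norm (l2_minus z y).
Proof.
replace (l2_minus z x) with (l2_plus (l2_minus y x) (l2_minus z y)) by l2_eq; apply l2_norm_plus.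
Qed.

(** Coordinates converge; the bound on finitely many of them survives the limit in [m], and letting
    their number grow gives the bound for the whole sequence. A geometric rate is enough, since such
    a sequence can be picked from any Cauchy filter. *)
Lemma l2_complete (u : nat -> l2) :
  (forall k m : nat, l2_norm (l2_minus (u k) (u m)) <= (/ 2) ^ k + (/ 2) ^ m) ->
  exists l, forall k, l2_norm (l2_minus (u k) l) <= (/ 2) ^ k.
Proof.
intros Hc.
assert (Ph : forall k, 0 < (/ 2) ^ k) by (intros; apply pow_lt; lra).
assert (Small : forall eps, 0 < eps -> exists K, forall k, (K <= k)%nat -> (/ 2) ^ k < eps).
{ intros eps He; destruct (pow_lt_1_zero (/ 2)) with (y := eps) as [K HK]; [rewrite Rabs_pos_eq; lra | auto |].
  exists K; intros k Hk; specialize (HK k Hk); rewrite Rabs_pos_eq in HK; [auto | left; auto]. }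
assert (Cc : forall (p : C -> R), (forall z w, Rabs (p z - p w) <= sqrt (csq (Cplus z (Cmult (RtoC (-1)) w)))) -> forall i,
  exists l, is_lim_seq (fun k => p (coord (u k) i)) (Finite l)).
{ intros p Hp i; assert (Cy : ex_lim_seq_cauchy (fun k => p (coord (u k) i))).
  { intros eps; destruct (Small (eps / 2)) as [K HK]; [pose proof (cond_pos eps); lra |].
    exists K; intros k m Hk Hm; pose proof (HK k Hk); pose proof (HK m Hm).
    eapply Rle_lt_trans; [apply Hp |].
    eapply Rle_lt_trans; [apply sqrt_le_1_alt, (l2_coord_le (l2_minus (u k) (u m)) i) |].
    rewrite sqrt_pow2 by apply l2_norm_nonneg; pose proof (Hc k m); lra. }
  apply ex_lim_seq_cauchy_corr in Cy; destruct Cy as [l Hl]; exists l; exact Hl. }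
destruct (choice _ (Cc fst ltac:(intros z w; rewrite <- sqrt_Rsqr_abs, csq_sub; apply sqrt_le_1_alt; rewrite Rsqr_pow2; pose proof (pow2_ge_0 (fst z - fst w)); pose proof (pow2_ge_0 (snd z - snd w)); lra))) as [lr Hlr].
destruct (choice _ (Cc snd ltac:(intros z w; rewrite <- sqrt_Rsqr_abs, csq_sub; apply sqrt_le_1_alt; rewrite Rsqr_pow2; pose proof (pow2_ge_0 (fst z - fst w)); pose proof (pow2_ge_0 (snd z - snd w)); lra))) as [li Hli].
set (d := fun k i => csq (Cplus (coord (u k) i) (Cmult (RtoC (-1)) (lr i, li i)))).
assert (Part : forall k n, sum_f_R0 (d k) n <= ((/ 2) ^ k) ^ 2).
{ intros k n.
  assert (Lm : is_lim_seq (fun m => sum_f_R0 (fun i => csq (coord (l2_minus (u k) (u m)) i)) n) (sum_f_R0 (d k) n)).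
  { assert (Lt : forall i, is_lim_seq (fun m => csq (coord (l2_minus (u k) (u m)) i)) (d k i)).
    { intros i; unfold d, csq; simpl.
      apply is_lim_seq_ext with (fun m => (fst (coord (u k) i) - fst (coord (u m) i)) ^ 2 + (snd (coord (u k) i) - snd (coord (u m) i)) ^ 2).
      { intros m; simpl; ring. }
      replace ((fst (coord (u k) i) + (-1 * lr i - 0 * li i)) * ((fst (coord (u k) i) + (-1 * lr i - 0 * li i)) * 1) +
        (snd (coord (u k) i) + (-1 * li i + 0 * lr i)) * ((snd (coord (u k) i) + (-1 * li i + 0 * lr i)) * 1))
        with ((fst (coord (u k) i) - lr i) * (fst (coord (u k) i) - lr i) + (snd (coord (u k) i) - li i) * (snd (coord (u k) i) - li i)) by ring.
      apply is_lim_seq_ext with (fun m => (fst (coord (u k) i) - fst (coord (u m) i)) * (fst (coord (u k) i) - fst (coord (u m) i)) +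
        (snd (coord (u k) i) - snd (coord (u m) i)) * (snd (coord (u k) i) - snd (coord (u m) i))); [intros; simpl; ring |].
      assert (L1 : is_lim_seq (fun m => fst (coord (u k) i) - fst (coord (u m) i)) (fst (coord (u k) i) - lr i))
        by (apply (is_lim_seq_minus' (fun _ => fst (coord (u k) i))); [apply is_lim_seq_const | apply Hlr]).
      assert (L2 : is_lim_seq (fun m => snd (coord (u k) i) - snd (coord (u m) i)) (snd (coord (u k) i) - li i))
        by (apply (is_lim_seq_minus' (fun _ => snd (coord (u k) i))); [apply is_lim_seq_const | apply Hli]).
      exact (is_lim_seq_plus' _ _ _ _ (is_lim_seq_mult' _ _ _ _ L1 L1) (is_lim_seq_mult' _ _ _ _ L2 L2)). }
    induction n as [| n IH]; [exact (Lt 0%nat) | exact (is_lim_seq_plus' _ _ _ _ IH (Lt (S n)))]. }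
  apply le_epsilon; intros eps He.
  destruct (Small (Rmin 1 (eps / 3))) as [K HK]; [apply Rmin_pos; lra |].
  apply (is_lim_seq_le_loc _ (fun _ => ((/ 2) ^ k) ^ 2 + eps) (sum_f_R0 (d k) n) (((/ 2) ^ k) ^ 2 + eps)) with (2 := Lm); [| apply is_lim_seq_const].
  exists K; intros m Hm; specialize (HK m Hm).
  pose proof (Rmin_l 1 (eps / 3)); pose proof (Rmin_r 1 (eps / 3)).
  eapply Rle_trans; [apply partial_le_series; [intros; apply csq_nonneg | apply l2_summable] |].
  rewrite <- l2_rip_self, <- l2_norm_sq.
  apply Rle_trans with (((/ 2) ^ k + (/ 2) ^ m) ^ 2); [apply pow_incr; split; [apply l2_norm_nonneg | apply Hc] |].
  assert ((/ 2) ^ k <= 1) by (rewrite <- (pow1 k); apply pow_incr; lra).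
  pose proof (Ph k); pose proof (Ph m); nra. }
assert (Sd : forall k, ex_series (d k) /\ Series (d k) <= ((/ 2) ^ k) ^ 2).
{ intros k; apply nonneg_series_bound; [intros; apply csq_nonneg | apply Part]. }
assert (Sl : ex_series (fun i => csq (lr i, li i))).
{ apply ex_series_dominated with (fun i => 2 * csq (coord (u 0%nat) i) + 2 * d 0%nat i).
  - intros i; rewrite Rabs_pos_eq by apply csq_nonneg; unfold d, csq; simpl.
    set (a := fst (coord (u 0%nat) i)); set (b := snd (coord (u 0%nat) i)).
    pose proof (pow2_ge_0 (2 * a - lr i)); pose proof (pow2_ge_0 (2 * b - li i)); nra.
  - apply ex_series_Rplus; apply ex_series_Rscal; [apply l2_summable | apply Sd]. }
exists (mkl2 _ Sl); intros k; apply sq_le_le; [left; auto |].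
rewrite l2_norm_sq, l2_rip_self; apply Sd.
Qed.

Definition l2_AbelianMonoid_mixin : AbelianMonoid.mixin_of l2.
Proof. apply (AbelianMonoid.Mixin l2 l2_plus l2_zero); l2_eq. Defined.

Definition l2_AbelianMonoid := AbelianMonoid.Pack l2 l2_AbelianMonoid_mixin l2.

Definition l2_AbelianGroup_mixin : AbelianGroup.mixin_of l2_AbelianMonoid.
Proof. apply (AbelianGroup.Mixin l2_AbelianMonoid l2_opp); l2_eq. Defined.

Definition l2_AbelianGroup := AbelianGroup.Pack l2 (AbelianGroup.Class l2 l2_AbelianMonoid_mixin l2_AbelianGroup_mixin) l2.

Definition l2_ModuleSpace_mixin : ModuleSpace.mixin_of C_Ring l2_AbelianGroup.
Proof. apply (ModuleSpace.Mixin C_Ring l2_AbelianGroup l2_scal); l2_eq. Defined.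

Definition l2_ball (x : l2) (e : R) (y : l2) : Prop := l2_norm (l2_minus y x) < e.

Definition l2_UniformSpace_mixin : UniformSpace.mixin_of l2.
Proof.
apply (UniformSpace.Mixin l2 l2_zero l2_ball); unfold l2_ball.
- intros x e; rewrite l2_minus_self; apply cond_pos.
- intros x y e; rewrite l2_minus_sym; auto.
- intros x y z e1 e2 A B; eapply Rle_lt_trans; [apply (l2_minus_tri x y z) | lra].
Defined.

Definition l2_UniformSpace := UniformSpace.Pack l2 l2_UniformSpace_mixin l2.

Definition l2_NormedModuleAux_class : NormedModuleAux.class_of C_AbsRing l2 :=
  NormedModuleAux.Class C_AbsRing l2 (ModuleSpace.Class C_Ring l2 _ l2_ModuleSpace_mixin) l2_UniformSpace_mixin.

Definition l2_NormedModule_mixin : NormedModule.mixin_of C_AbsRing (NormedModuleAux.Pack C_AbsRing l2 l2_NormedModuleAux_class l2).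
Proof.
apply (NormedModule.Mixin C_AbsRing (NormedModuleAux.Pack C_AbsRing l2 l2_NormedModuleAux_class l2) l2_norm 1).
- exact l2_norm_plus.
- intros a x; right; exact (l2_norm_scal a x).
- intros x y e L; exact L.
- intros x y e L; rewrite Rmult_1_l; exact L.
- exact l2_norm_zero_inv.
Defined.

Definition l2_lim (F : (l2 -> Prop) -> Prop) : l2 :=
  epsilon (inhabits l2_zero) (fun l => forall eps : posreal, F (l2_ball l eps)).

Definition l2_CompleteSpace_mixin : CompleteSpace.mixin_of l2_UniformSpace.
Proof.
apply (CompleteSpace.Mixin l2_UniformSpace l2_lim).
- intros F PF CF; unfold l2_lim; apply epsilon_spec.
  assert (Ph : forall k, 0 < (/ 2) ^ k) by (intros; apply pow_lt; lra).
  assert (Ex : forall k : nat, exists x : l2, F (l2_ball x ((/ 2) ^ k))).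
  { intros k; exact (CF (mkposreal _ (Ph k))). }
  destruct (choice _ Ex) as [u Hu].
  destruct (l2_complete u) as [l Hl].
  { intros k m; destruct (filter_ex _ (filter_and _ _ (Hu k) (Hu m))) as [z [Zk Zm]].
    unfold l2_ball in Zk, Zm; pose proof (l2_minus_tri (u m) z (u k)) as T; rewrite (l2_minus_sym (u k) z) in T; lra. }
  exists l; intros eps.
  destruct (pow_lt_1_zero (/ 2)) with (y := eps / 2) as [K HK]; [rewrite Rabs_pos_eq; lra | pose proof (cond_pos eps); lra |].
  specialize (HK K (le_n K)); rewrite Rabs_pos_eq in HK by (left; apply Ph).
  generalize (Hu K); apply filter_imp; intros z Zk; unfold l2_ball in *.
  pose proof (l2_minus_tri l (u K) z); pose proof (Hl K); lra.
(* Filters containing each other are equal as predicates, so the choice operator returns the same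
   limit. *)
- intros F1 F2 L1 L2; replace F2 with F1; [apply close_refl |].
  apply functional_extensionality; intros P; apply propositional_extensionality; split; auto.
Defined.

Definition l2_CompleteNormedModule : CompleteNormedModule C_AbsRing :=
  CompleteNormedModule.Pack C_AbsRing l2
    (CompleteNormedModule.Class C_AbsRing l2
      (NormedModule.Class C_AbsRing l2 l2_NormedModuleAux_class l2_NormedModule_mixin) l2_CompleteSpace_mixin) l2.

Definition l2_inner (x y : l2) : C := (l2_rip x y, l2_iip x y).

Definition l2_Hilbert : Hilbert.
Proof.
apply (mkHilbert l2_CompleteNormedModule l2_inner).
- intros x y z; unfold l2_inner, Cplus; simpl; f_equal; [apply l2_rip_plus | apply l2_iip_plus].
- intros a x y; unfold l2_inner, Cmult; simpl; f_equal; [apply l2_rip_scal | apply l2_iip_scal].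
- intros x y; unfold l2_inner, Cconj; simpl; f_equal; [apply l2_rip_sym | apply l2_iip_sym].
- intros x; unfold l2_inner, RtoC; f_equal; [symmetry; apply l2_norm_sq | pose proof (l2_iip_sym x x); lra].
Defined.

(** As both arguments are square-summable by type, this graph automatically has the maximal
    domain. *)
Definition diag_sqrt : op l2_Hilbert := fun x y => forall k, coord y k = Cmult (RtoC (sqrt (INR k))) (coord x k).

Definition unit_seq (j k : nat) : C := if Nat.eq_dec k j then RtoC 1 else RtoC 0.

Lemma finite_support_summable (x : nat -> C) n : (forall k, (n <= k)%nat -> x k = RtoC 0) -> ex_series (fun k => csq (x k)).
Proof.
intros Z; apply (ex_series_incr_n (K := R_AbsRing) (V := R_NormedModule) _ n).
destruct (nonneg_series_bound (fun k => csq (x (n + k)%nat)) 0) as [E _]; auto; intros m.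
- apply csq_nonneg.
- assert (E : forall k, csq (x (n + k)%nat) = 0) by (intros k; rewrite Z by lia; unfold csq, RtoC; simpl; ring).
  induction m as [| m IH]; simpl; rewrite E; lra.
Qed.

Lemma unit_summable j : ex_series (fun k => csq (unit_seq j k)).
Proof.
apply finite_support_summable with (S j); intros k Hk; unfold unit_seq; destruct (Nat.eq_dec k j); auto; lia.
Qed.

Definition unit_vec (j : nat) : l2 := mkl2 _ (unit_summable j).

Lemma sum_only (a : nat -> R) j : (forall k, k <> j -> a k = 0) -> Series a = a j.
Proof.
intros Z; apply is_series_unique.
apply (is_lim_seq_ext_loc (fun _ => a j) (sum_n a) (Finite (a j))); [| apply is_lim_seq_const].
exists j; intros m Hm; rewrite sum_n_Reals.
assert (E : forall m, (m < j)%nat -> sum_f_R0 a m = 0).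
{ induction m0 as [| m0 IH]; intros L; simpl; [apply Z; lia |]; rewrite IH, Z by lia; ring. }
induction Hm as [| m Hm IH].
- destruct j as [| j]; auto; simpl; rewrite E by lia; ring.
- simpl; rewrite <- IH, (Z (S m)) by lia; ring.
Qed.

Lemma inner_unit j (y : l2) : l2_inner (unit_vec j) y = Cconj (coord y j).
Proof.
unfold l2_inner, Cconj, l2_rip, l2_iip; simpl; f_equal.
- rewrite (sum_only _ j); unfold unit_seq.
  + destruct (Nat.eq_dec j j); [simpl; ring | contradiction].
  + intros k Hk; destruct (Nat.eq_dec k j); [contradiction | simpl; ring].
- rewrite (sum_only _ j); unfold unit_seq.
  + destruct (Nat.eq_dec j j); [simpl; ring | contradiction].
  + intros k Hk; destruct (Nat.eq_dec k j); [contradiction | simpl; ring].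
Qed.

Lemma inner_scal_unit (a : C) j (y : l2) : l2_inner (l2_scal a (unit_vec j)) y = Cmult a (Cconj (coord y j)).
Proof. rewrite <- inner_unit; exact (@inner_scal_l l2_Hilbert a (unit_vec j) y). Qed.

Lemma diag_unit j : diag_sqrt (unit_vec j) (l2_scal (RtoC (sqrt (INR j))) (unit_vec j)).
Proof.
intros k; simpl; unfold unit_seq; destruct (Nat.eq_dec k j) as [-> |]; auto; rewrite !Cmult_0_r; auto.
Qed.

Definition truncate (x : nat -> C) (n k : nat) : C := if le_lt_dec n k then RtoC 0 else x k.

Lemma truncate_summable x n : ex_series (fun k => csq (truncate x n k)).
Proof. apply finite_support_summable with n; intros k Hk; unfold truncate; destruct (le_lt_dec n k); auto; lia. Qed.

(** Finitely supported sequences lie in the domain, and the squared error of truncation is the tail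
    of a convergent series. *)
Lemma diag_dense : densely_defined diag_sqrt.
Proof.
intros x eps.
pose proof (Series_correct _ (l2_summable x)) as L.
assert (Pe : 0 < eps ^ 2) by (pose proof (cond_pos eps); nra).
destruct (proj1 (filterlim_locally _ _) L (mkposreal _ Pe)) as [n Hn].
specialize (Hn n (le_n n)).
set (y := mkl2 _ (truncate_summable (coord x) (S n))).
exists y; split.
- assert (Sz : ex_series (fun k => csq (Cmult (RtoC (sqrt (INR k))) (truncate (coord x) (S n) k)))).
  { apply finite_support_summable with (S n); intros k Hk; unfold truncate; destruct (le_lt_dec (S n) k); [apply Cmult_0_r | lia]. }
  exists (mkl2 _ Sz); intros k; reflexivity.
- change (l2_norm (l2_minus x y) < eps).
  assert (l2_norm (l2_minus x y) ^ 2 < eps ^ 2).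
  { rewrite l2_norm_sq, l2_rip_self.
    assert (Ex2 : ex_series (fun k => csq (coord (l2_minus x y) k))) by apply l2_summable.
    rewrite (Series_incr_n _ (S n)) by (auto; lia).
    simpl Init.Nat.pred.
    assert (E0 : sum_f_R0 (fun k => csq (coord (l2_minus x y) k)) n = 0).
    { rewrite (sum_eq _ (fun _ => 0)).
      - clear; induction n as [| n IH]; simpl; lra.
      - intros k Hk; simpl; unfold truncate; destruct (le_lt_dec (S n) k); [lia |].
        unfold csq, Cplus, Cmult, RtoC; simpl; ring. }
    rewrite E0, Rplus_0_l.
    rewrite (Series_ext _ (fun k => csq (coord x (S n + k)%nat))).
    - pose proof (Series_incr_n _ (S n) ltac:(lia) (l2_summable x)) as E1; simpl Init.Nat.pred in E1.
      rewrite sum_n_Reals in Hn.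
      change (Rabs (sum_f_R0 (fun k => csq (coord x k)) n - Series (fun k => csq (coord x k))) < eps ^ 2) in Hn.
      apply Rabs_def2 in Hn; lra.
    - intros k; simpl; unfold truncate; destruct (le_lt_dec (S n) (S (n + k))); [| lia].
      unfold csq, Cplus, Cmult, RtoC; simpl; ring. }
  pose proof (l2_norm_nonneg (l2_minus x y)); pose proof (cond_pos eps); nra.
Qed.

(** Testing a pair of the adjoint against unit vectors yields the diagonal relation in each
    coordinate, which on the maximal domain is membership in the graph. *)
Lemma diag_self_adjoint : self_adjoint diag_sqrt.
Proof.
split; [split; [| split; [| split]] | split; [exact diag_dense |]].
- intros x y z Dy Dz; apply l2_ext; intros k; rewrite Dy, Dz; auto.
- intros k; simpl; rewrite Cmult_0_r; auto.
- intros x y u v Du Dv k; simpl; rewrite (Du k), (Dv k); ring.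
- intros a x u Du k; simpl; rewrite (Du k); ring.
- intros y z; split.
  + intros Ad k; pose proof (Ad _ _ (diag_unit k)) as E.
    change (l2_inner (l2_scal (RtoC (sqrt (INR k))) (unit_vec k)) y = l2_inner (unit_vec k) z) in E.
    rewrite inner_scal_unit, inner_unit in E.
    destruct (coord y k) as [p q], (coord z k) as [p' q'].
    unfold Cmult, Cconj, RtoC in *; simpl in *.
    pose proof (f_equal fst E) as E1; pose proof (f_equal snd E) as E2; simpl in E1, E2; f_equal; lra.
  + intros Dz x w Dw; change (l2_inner w y = l2_inner x z); unfold l2_inner, l2_rip, l2_iip; f_equal;
      apply Series_ext; intros k; rewrite (Dw k), (Dz k); simpl; ring.
Qed.

Lemma diag_spectrum n : spectrum diag_sqrt (RtoC (sqrt (INR n))).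
Proof.
intros [f [Lf E]].
(* Every multiple of the unit vector is an eigenvector, so an inverse would send 0 to both once and
   twice that vector. *)
assert (K : forall x, op_inv (op_sub (op_scal (RtoC (sqrt (INR n))) op_id) diag_sqrt) l2_zero (l2_scal x (unit_vec n))).
{ intros x; set (w := l2_scal x (unit_vec n)).
  exists (l2_scal (RtoC (sqrt (INR n))) w), (l2_scal (RtoC (-1)) (l2_scal (RtoC (sqrt (INR n))) w)); split; [| split].
  - exists w; split; reflexivity.
  - exists (l2_scal (RtoC (sqrt (INR n))) w); split; [| reflexivity].
    intros k; simpl; unfold unit_seq; destruct (Nat.eq_dec k n) as [-> |]; [ring | rewrite !Cmult_0_r; ring].
  - change (l2_zero = l2_plus (l2_scal (RtoC (sqrt (INR n))) w) (l2_scal (RtoC (-1)) (l2_scal (RtoC (sqrt (INR n))) w))).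
    apply l2_ext; intros k; simpl; ring. }
pose proof (proj1 (E _ _) (K (RtoC 1))) as E1; pose proof (proj1 (E _ _) (K (RtoC 2))) as E2.
unfold graph in E1, E2; rewrite <- E1 in E2.
apply (f_equal (fun z => fst (coord z n))) in E2; simpl in E2; unfold unit_seq in E2.
destruct (Nat.eq_dec n n); [simpl in E2; lra | contradiction].
Qed.

(** * Optimality *)

Section CayleyPowers.
Context {H : Hilbert} {B : op H} (SB : self_adjoint B).
Variables (c alpha : R).
Hypotheses (Hc : 0 < c) (Ha : 0 < alpha).
Let Hc1 : 0 < c + 1 := Rplus_lt_0_compat c 1 Hc Rlt_0_1.

Lemma A_generates : generates_exp_stable (op_opp (Aop B c)).
Proof. rewrite Aop_shift; apply (good_generates (shift_op_good SB 1 c R1_neq_R0 Hc)). Qed.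

Lemma cayley_neg_pow_graph n :
  op_comp (op_pow (Vop B c) n) (neg_pow alpha (Aop B c)) = graph (Fop B c c alpha n).
Proof. rewrite Aop_shift; apply V_neg_pow_graph; auto. Qed.

Lemma cayley_neg_pow_graph1 n :
  op_comp (op_pow (Vop B c) n) (neg_pow alpha (op_add (Aop B c) op_id)) = graph (Fop B c (c + 1) alpha n).
Proof. rewrite Aop_plus_id; apply V_neg_pow_graph; auto. Qed.

(** At the spectral point sqrt n of [B], the norm of V(A)^n A^(-alpha) dominates its symbol, which
    [NK_norm_pos] compares with the assumed bound for f. *)
Lemma cayley_lower_bound M1 n1 : 0 < M1 -> (1 <= n1)%nat ->
  (forall n, (n1 <= n)%nat -> f_val c (c + 1) alpha n (sqrt (INR n)) >= M1 / Rpower (INR n) (alpha / 2)) ->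
  forall n2, (1 <= n2)%nat -> (forall n, (n2 <= n)%nat -> spectrum B (RtoC (sqrt (INR n)))) ->
  0 < real (opnorm (neg_pow alpha (Kop B c))) /\
  forall n, (Nat.max n1 n2 <= n)%nat ->
    Rbar_le (M1 / real (opnorm (neg_pow alpha (Kop B c))) / Rpower (INR n) (alpha / 2))
      (opnorm (graph (Fop B c c alpha n))).
Proof.
intros PM Hn1 Low n2 Hn2 Sp.
rewrite (neg_pow_Kop SB c alpha Hc Ha).
destruct (opnorm_graph_finite _ (NK_linear SB c alpha Hc Ha)) as [m [Em _]]; rewrite Em; simpl real.
pose proof (NK_norm_pos SB c alpha Hc Ha m Em) as P.
destruct (P _ (spectrum_B_inv SB _ (Sp n2 (le_n n2)))) as [Pm _].
split; auto; intros n Hn.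
pose proof (spectrum_B_inv SB _ (Sp n ltac:(lia))) as A.
destruct (P _ A) as [_ Q]; specialize (Q n); specialize (Low n ltac:(lia)).
destruct (opnorm_graph_finite _ (Fop_linear SB c Hc c alpha n Hc Ha)) as [k [Ek _]]; rewrite Ek; simpl.
destruct (acts_Fop SB c Hc c alpha n Hc Ha (sqrt (INR n))) as [a [Ea Aa]].
pose proof (acts_lower _ a _ k (Fop_linear SB c Hc c alpha n Hc Ha) Ek Aa A) as L; rewrite Ea in L.
apply Rle_trans with (f_val c (c + 1) alpha n (sqrt (INR n)) / m); [| lra].
pose proof (Rpower_pos (INR n) (alpha / 2)).
replace (M1 / m / Rpower (INR n) (alpha / 2)) with (M1 / Rpower (INR n) (alpha / 2) / m) by (field; lra).
apply Rmult_le_compat_r; [left; apply Rinv_0_lt_compat; auto | lra].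
Qed.

Lemma cayley_prod_graph (w : nat -> R) n : (forall k, (1 <= k)%nat -> w k = 1) ->
  cayley_prod w (Aop B c) n = op_pow (Vop B c) n.
Proof.
intros W; rewrite (Vop_graph SB c Hc), op_pow_graph; induction n as [| n IH]; auto.
simpl cayley_prod; rewrite IH, (W (S n)) by lia; unfold cayley; rewrite <- op_id_scal.
change (op_comp (graph (Nat.iter n (cay B c))) (Vop B c) = graph (Nat.iter (S n) (cay B c))).
rewrite (Vop_graph SB c Hc), op_comp_graph; f_equal.
apply functional_extensionality; intros x; symmetry; apply Nat.iter_succ_r.
Qed.

(** The parameter interval [1, 1] forces every factor of the product to be V(A). *)
Lemma cayley_estimate_iff r : cayley_estimate (Aop B c) alpha 1 1 r <->
  exists M n0, 0 < M /\ forall n, (n0 <= n)%nat -> Rbar_le (opnorm (graph (Fop B c c alpha n))) (M * r n).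
Proof.
split; intros [M [n0 [PM E]]]; exists M, n0; split; auto; intros n Hn.
- specialize (E n Hn (fun _ => 1) ltac:(intros; lra)).
  rewrite cayley_prod_graph, cayley_neg_pow_graph in E by auto; exact E.
- intros w W; rewrite cayley_prod_graph, cayley_neg_pow_graph; auto.
  intros k Hk; specialize (W k Hk); lra.
Qed.

(** A positive norm is the value of the symbol modulus at some [lam], so the scalar bound
    [f_val_upper], uniform in [lam], applies. *)
Lemma cayley_upper_bound : cayley_estimate (Aop B c) alpha 1 1 (fun n => Rpower (INR n) (- (alpha / 2))).
Proof.
apply cayley_estimate_iff; destruct (f_val_upper c alpha Hc Ha) as [M [PM U]].
exists M, 1%nat; split; auto; intros n Hn.
destruct (opnorm_graph_finite _ (Fop_linear SB c Hc c alpha n Hc Ha)) as [m [Em Pm]]; rewrite Em; simpl.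
destruct Pm as [Pm | <-].
- destruct (Fop_norm_attained SB c Hc c alpha n Hc Ha m Em Pm) as [lam [_ <-]]; auto.
- left; apply Rmult_lt_0_compat; auto; apply Rpower_pos.
Qed.
End CayleyPowers.

Lemma Ci_mult_R (x : R) : Cmult Ci (RtoC x) = (0, x).
Proof. unfold Cmult, Ci, RtoC; simpl; f_equal; ring. Qed.

Theorem mainTheorem3 (c alpha : R) (hc : 0 < c) (halpha : 0 < alpha) :
  (exists (M1 : R) (n1 : nat), 0 < M1 /\ (1 <= n1)%nat /\
     forall n, (n1 <= n)%nat ->
       Cmod (f_na c alpha n (Ci * sqrt (INR n))%C) >= M1 / Rpower (INR n) (alpha / 2))
  /\
  (forall (M1 : R) (n1 : nat), 0 < M1 -> (1 <= n1)%nat ->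
     (forall n, (n1 <= n)%nat ->
       Cmod (f_na c alpha n (Ci * sqrt (INR n))%C) >= M1 / Rpower (INR n) (alpha / 2)) ->
   forall (H : Hilbert) (B : op H), self_adjoint B ->
   forall n2 : nat, (1 <= n2)%nat ->
     (forall n, (n2 <= n)%nat -> spectrum B (RtoC (sqrt (INR n)))) ->
   let A := op_add (op_scal Ci B) (op_scal (RtoC c) op_id) in
   let V := op_comp (op_sub A op_id) (op_inv (op_add A op_id)) in
   let N := neg_pow alpha (op_add op_id (op_inv A)) in
   let M2 := M1 / real (opnorm N) in
   generates_exp_stable (op_opp A)
   /\
   (forall n : nat,
      let T := op_comp (op_pow V n) (neg_pow alpha (op_add A op_id)) in
      bounded_op T /\
      bounded_op (f_op c alpha n B) /\
      opnorm T = opnorm (f_op c alpha n B) /\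
      opnorm (f_op c alpha n B) =
        Lub_Rbar (fun r => exists l : C,
          spectrum (op_scal Ci B) l /\ r = Cmod (f_na c alpha n l)))
   /\
   bounded_op N
   /\
   (forall n : nat, (Nat.max n1 n2 <= n)%nat ->
      let T := op_comp (op_pow V n) (neg_pow alpha A) in
      bounded_op T /\
      Rbar_le (M2 / Rpower (INR n) (alpha / 2)) (opnorm T)))
  /\
  (exists (H : Hilbert) (A : op H) (wp wq : R),
     generates_exp_stable (op_opp A) /\ 0 < wp /\ wp <= wq /\
     cayley_estimate A alpha wp wq (fun n => Rpower (INR n) (- (alpha / 2))) /\
     forall r : nat -> R, cayley_estimate A alpha wp wq r ->
       exists (m : R) (n0 : nat), 0 < m /\
         forall n, (n0 <= n)%nat -> m * Rpower (INR n) (- (alpha / 2)) <= r n).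
Proof.
assert (Hc1 : 0 < c + 1) by lra.
destruct (f_val_lower c alpha hc halpha) as [M1 [n1 [PM1 [Hn1 Low1]]]].
split; [| split].
- exists M1, n1; split; auto; split; auto; intros n Hn.
  rewrite Ci_mult_R, f_na_val by auto; auto.
- clear M1 n1 PM1 Hn1 Low1; intros M1 n1 PM1 Hn1 Low H B SB n2 Hn2 Sp A V N M2.
  assert (Low1 : forall n, (n1 <= n)%nat -> f_val c (c + 1) alpha n (sqrt (INR n)) >= M1 / Rpower (INR n) (alpha / 2)).
  { intros n Hn; rewrite <- f_na_val, <- Ci_mult_R by auto; auto. }
  change A with (Aop B c) in *; change V with (Vop B c) in *.
  change N with (neg_pow alpha (Kop B c)) in *.
  split; [apply A_generates; auto | split; [| split]].
  + intros n T; unfold T; rewrite (cayley_neg_pow_graph1 SB c alpha hc halpha), (f_op_graph SB c alpha hc halpha).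
    pose proof (Fop_linear SB c hc (c + 1) alpha n Hc1 halpha) as LF.
    split; [apply bounded_graph; auto | split; [apply bounded_graph; auto | split; auto]].
    apply (Lub_spectrum_norm SB c alpha hc halpha).
    (* A point witnessing that the spectrum is nonempty. *)
    exists (sqrt (INR n2)); apply (spectrum_B_inv SB), Sp; auto.
  + rewrite (neg_pow_Kop SB c alpha hc halpha); apply bounded_graph, (NK_linear SB c alpha hc halpha).
  + intros n Hn T; unfold T; rewrite (cayley_neg_pow_graph SB c alpha hc halpha); split.
    * apply bounded_graph, (Fop_linear SB c hc c alpha n hc halpha).
    * apply (cayley_lower_bound SB c alpha hc halpha M1 n1 PM1 Hn1 Low1 n2 Hn2 Sp); auto.
- pose proof diag_self_adjoint as SB.
  exists l2_Hilbert, (Aop diag_sqrt c), 1, 1.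
  split; [apply A_generates; auto | split; [lra | split; [lra | split]]].
  + apply cayley_upper_bound; auto.
  + intros r E; apply (cayley_estimate_iff SB c alpha hc halpha) in E; destruct E as [M [n0 [PM E]]].
    destruct (cayley_lower_bound SB c alpha hc halpha M1 n1 PM1 Hn1 Low1 1%nat (le_n 1) (fun n _ => diag_spectrum n)) as [Pm L].
    set (k := real (opnorm (neg_pow alpha (Kop diag_sqrt c)))) in *.
    (* The lower bound with M2 = [M1 / k] and the assumed upper bound [M * r n] enclose the same
       norm; dividing by [M] bounds [r n] from below. *)
    exists (M1 / k / M), (Nat.max n0 (Nat.max n1 1)); split; [repeat apply Rdiv_lt_0_compat; auto |].
    intros n Hn; specialize (L n ltac:(lia)); specialize (E n ltac:(lia)).
    pose proof (Rbar_le_trans _ _ _ L E) as Q; simpl in Q.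
    rewrite Rpower_Ropp; pose proof (Rpower_pos (INR n) (alpha / 2)).
    apply Rmult_le_reg_l with M; auto.
    replace (M * (M1 / k / M * / Rpower (INR n) (alpha / 2))) with (M1 / k / Rpower (INR n) (alpha / 2)) by (field; lra); lra.
Qed.
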